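(* Let $m=3$, let $n$ be a positive integer and let $\delta,\sigma_1,\sigma_2,\dots,\sigma_n$ be distinct positive constants. Fix $\hat x\in\mathbb{S}^2$ with $\hat x\cdot d\neq0$, and let $\tau$ be a real constant with $\tau\notin\left\{\frac{\ell\pi}{k\hat x\cdot d}:\ell\in\mathbb{Z}\right\}$. Define $$w(x,d):=|x|e^{k|x|}\,\frac{|u(x,d)|^2-|e^{ikx\cdot d}+u_H(x,d)|^2}{|e^{ikx\cdot d}+u_H(x,d)|}.$$ For each sufficiently large $t$ and $j\in\{1,\dots,n\}$ let $t_j=\sigma_jt+b_j$, with $b_1\in(-\delta,\delta)$ and $b_j\in\left(-\delta,\frac{2\pi}{k|\hat x\cdot d|}+\delta\right)$ for $j\ge2$, be such that $\arg\{e^{ikt_j\hat x\cdot d}+u_H(t_j\hat x,d)\}=k\sigma_1t\,\hat x\cdot d$ (modulo $2\pi$), and let $\tilde t_j=\sigma_jt+\tilde b_j$, with $\tilde b_1\in(\tau-\delta,\tau+\delta)$ and $\tilde b_j\in\left(-\delta,\frac{2\pi}{k|\hat x\cdot d|}+\delta\right)$ for $j\ge2$, be such that $\arg\{e^{ik\tilde t_j\hat x\cdot d}+u_H(\tilde t_j\hat x,d)\}=k(\sigma_1t+\tau)\hat x\cdot d$ (modulo $2\pi$). Define $$\begin{pmatrix}G_{1,M}\\ \vdots\\ G_{n,M}\end{pmatrix}=V(t_1,\dots,t_n)^{-1}\begin{pmatrix}w(t_1\hat x,d)\\ \vdots\\ w(t_n\hat x,d)\end{pmatrix},\qquad\begin{pmatrix}\widetilde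 G_{1,M}\\ \vdots\\ \widetilde G_{n,M}\end{pmatrix}=V(\tilde t_1,\dots,\tilde t_n)^{-1}\begin{pmatrix}w(\tilde t_1\hat x,d)\\ \vdots\\ w(\tilde t_n\hat x,d)\end{pmatrix},$$ where $V(s_1,\dots,s_n)$ is the $n\times n$ matrix whose $(i,j)$ entry is $s_i^{-(j-1)}$. Then, for $j=1,2,\dots,n$, $$\begin{pmatrix}g_j(\hat x)\\ \overline{g_j(\hat x)}\end{pmatrix}=\begin{pmatrix}e^{-ik\sigma_1t\hat x\cdot d}&e^{ik\sigma_1t\hat x\cdot d}\\ e^{-ik(\sigma_1t+\tau)\hat x\cdot d}&e^{ik(\sigma_1t+\tau)\hat x\cdot d}\end{pmatrix}^{-1}\begin{pmatrix}G_{j,M}\\ \widetilde G_{j,M}\end{pmatrix}+O\left(\frac1{t^{n+1-j}}\right)\quad\text{as }t\to\infty.$$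
   Context: Let $m=3$, $k>0$, and let $D\subset\mathbb{R}^3$ be a bounded domain with boundary $\partial D$ of class $C^{3,\alpha}$ which is the open complement of an unbounded domain. $\nu$ is the unit exterior normal on $\partial D$. Fix $d\in\mathbb{S}^2$. The incident field is $u^i(x,d)=e^{ikx\cdot d}$; the total field $u=u^i+u^s$ satisfies $\Delta^2u-k^4u=0$ in $\mathbb{R}^3\setminus\overline D$, $\mathscr{B}u=(0,0)$ on $\partial D$ with $\mathscr{B}u$ one of $(u,\partial_\nu u)$, $(u,\Delta u)$, $(\Delta u,\partial_\nu\Delta u)$, $(u,\partial_\nu\Delta u)$, $(\partial_\nu u,\Delta u)$, $(\partial_\nu u,\partial_\nu\Delta u)$, and $\lim_{r\to\infty}r\left(\partial_ru^s-iku^s\right)=0$, $r=|x|$, uniformly in all directions. Set $u_H:=\frac12(u^s-\Delta u^s/k^2)$ and $u_M:=\frac12(u^s+\Delta u^s/k^2)$, so $u^s=u_H+u_M$, $\Delta u_H+k^2u_H=0$, $\Delta u_M-k^2u_M=0$ in $\mathbb{R}^3\setminus\overline D$, and both satisfy the same radiation condition. The functions $g_j$ on $\mathbb{S}^2$ are the coefficients of the Atkinson-type expansion of $u_M=u_M(\cdot,d)$: for every $N\in\mathbb{N}$, $$u_M(x)=\frac{e^{-k|x|}}{|x|}\left\{\sum_{j=1}^N\frac{g_j(\hat x)}{|x|^{j-1}}+O\left(\frac1{|x|^N}\right)\right\},\quad|x|\to\infty,\ \hat x=x/|x|;$$ in particular $g_1=u_M^\infty$ is the far-field pattern of $u_M$.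 Arguments of complex numbers are understood modulo $2\pi$. Parameters $b_j,\tilde b_j$ with the stated properties exist for all sufficiently large $t$ (they depend on $t$). *)

(* Defs.v *)
From HB Require Import structures.
From mathcomp Require Import all_boot all_order all_algebra.
From mathcomp Require Import complex.
From mathcomp Require Import all_classical all_reals all_analysis.
Import Order.TTheory GRing.Theory Num.Theory.
Import numFieldNormedType.Exports.
Set Implicit Arguments.
Unset Strict Implicit.
Unset Printing Implicit Defensive.
Local Open Scope classical_set_scope.
Local Open Scope complex_scope.
Local Open Scope ring_scope.

Section Defs.
Variable R : realType.
Local Notation C := R[i].
Local Notation E3 := 'rV[R]_3.

(* The library norm on ['rV[R]_3] is the sup norm (same topology and same
   bounded sets); lengths below are Euclidean. *)
Definition dot (x y : E3) : R := \sum_(i < 3) x 0 i * y 0 i.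
Definition enorm (x : E3) : R := Num.sqrt (dot x x).
Definition unit_sphere : set E3 := [set x | enorm x = 1].

(* The modulus of a complex number as an element of [R]
   (the library norm [`|z|] lives in [R[i]]). *)
Definition cmod (z : C) : R := ComplexField.Normc.normc z.

(* e^{i t} *)
Definition expi (t : R) : C := cos t +i* sin t.

(* arg z = theta modulo 2 pi; only nonzero numbers have an argument. *)
Definition has_arg (z : C) (theta : R) : Prop :=
  z <> 0 /\ z = (cmod z)%:C * expi theta.

Definition partial (i : 'I_3) (f : E3 -> R) (x : E3) : R :=
  'D_(delta_mx 0 i) f x.

Definition iter_partial (s : seq 'I_3) (f : E3 -> R) : E3 -> R :=
  foldr partial f s.

Definition gradient (f : E3 -> R) (x : E3) : E3 := \row_i partial i f x.

Definition Ck (m : nat) (U : set E3) (f : E3 -> R) : Prop :=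
  forall s : seq 'I_3, (size s <= m)%N -> forall x, U x ->
    {for x, continuous (iter_partial s f)} /\
    ((size s < m)%N ->
       forall i : 'I_3, derivable (iter_partial s f) x (delta_mx 0 i)).

Definition Ck_holder (m : nat) (alpha : R) (U : set E3) (f : E3 -> R) : Prop :=
  Ck m U f /\
  forall s : seq 'I_3, size s = m -> exists M : R, forall x y, U x -> U y ->
    `|iter_partial s f x - iter_partial s f y| <= M * (enorm (x - y)) `^ alpha.

(* Complex-valued functions of real variables are differentiated
   componentwise. *)
Definition cCk (m : nat) (U : set E3) (f : E3 -> C) : Prop :=
  Ck m U (fun x => complex.Re (f x)) /\ Ck m U (fun x => complex.Im (f x)).

Definition cpartial (i : 'I_3) (f : E3 -> C) (x : E3) : C :=
  partial i (fun y => complex.Re (f y)) x +i* partial i (fun y => complex.Im (f y)) x.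

(* v . grad f (x) *)
Definition cdirderiv (v : E3) (f : E3 -> C) (x : E3) : C :=
  \sum_(i < 3) (v 0 i)%:C * cpartial i f x.

Definition laplacian (f : E3 -> C) (x : E3) : C :=
  \sum_(i < 3) cpartial i (cpartial i f) x.

Definition domain (U : set E3) : Prop := [/\ open U, connected U & U !=set0].

Definition bdry (D : set E3) : set E3 := closure D `\` interior D.

Definition exterior (D : set E3) : set E3 := ~` closure D.

(* [phi] describes D as a sublevel set near y. *)
Definition defining_function (alpha : R) (D : set E3) (y : E3)
    (phi : E3 -> R) : Prop :=
  exists2 e : R, 0 < e &
    Ck_holder 3 alpha (ball y e) phi /\
    forall x, ball y e x ->
      [/\ gradient phi x <> 0, D x <-> phi x < 0 & bdry D x <-> phi x = 0].

Definition boundary_C3holder (alpha : R) (D : set E3) : Prop :=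
  forall y, bdry D y -> exists phi, defining_function alpha D y phi.

Definition unit_exterior_normal (alpha : R) (D : set E3) (nu : E3 -> E3) :
    Prop :=
  forall y, bdry D y -> forall phi, defining_function alpha D y phi ->
    nu y = (enorm (gradient phi y))^-1 *: gradient phi y.

Definition obstacle (alpha : R) (D : set E3) : Prop :=
  [/\ domain D, bounded_set D, boundary_C3holder alpha D &
      [/\ domain (exterior D), ~ bounded_set (exterior D) &
          D = ~` closure (exterior D)]].

(* Boundary values are limits taken from the exterior domain. *)
Definition zero_trace (D : set E3) (y : E3) (f : E3 -> C) : Prop :=
  cmod (f x) @[x --> within (exterior D) (nbhs y)] --> (0 : R).

Definition dirichlet (D : set E3) (f : E3 -> C) : Prop :=
  forall y, bdry D y -> zero_trace D y f.

Definition neumann (D : set E3) (nu : E3 -> E3) (f : E3 -> C) : Prop :=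
  forall y, bdry D y -> zero_trace D y (cdirderiv (nu y) f).

Variant boundary_operator : Set :=
  | B_u_dnu | B_u_lap | B_lap_dnulap | B_u_dnulap | B_dnu_lap | B_dnu_dnulap.

Definition boundary_condition (B : boundary_operator) (D : set E3)
    (nu : E3 -> E3) (u : E3 -> C) : Prop :=
  match B with
  | B_u_dnu => dirichlet D u /\ neumann D nu u
  | B_u_lap => dirichlet D u /\ dirichlet D (laplacian u)
  | B_lap_dnulap => dirichlet D (laplacian u) /\ neumann D nu (laplacian u)
  | B_u_dnulap => dirichlet D u /\ neumann D nu (laplacian u)
  | B_dnu_lap => neumann D nu u /\ dirichlet D (laplacian u)
  | B_dnu_dnulap => neumann D nu u /\ neumann D nu (laplacian u)
  end.

Definition radiating (k : R) (f : E3 -> C) : Prop :=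
  forall eps : R, 0 < eps -> \forall r \near +oo,
    forall x : E3, enorm x = r ->
      r * cmod (cdirderiv (r^-1 *: x) f x - (0 +i* k) * f x) < eps.

Definition u_inc (k : R) (d : E3) (x : E3) : C := expi (k * dot x d).

Definition u_tot (k : R) (d : E3) (us : E3 -> C) (x : E3) : C :=
  u_inc k d x + us x.

Record scattering_solution (k : R) (D : set E3) (nu : E3 -> E3)
    (B : boundary_operator) (d : E3) (us : E3 -> C) : Prop := {
  scat_regular : cCk 4 (exterior D) (u_tot k d us);
  scat_biharmonic : forall x, exterior D x ->
    laplacian (laplacian (u_tot k d us)) x
      - (k ^+ 4)%:C * u_tot k d us x = 0;
  scat_boundary : boundary_condition B D nu (u_tot k d us);
  scat_radiating : radiating k us }.

Definition u_H (k : R) (us : E3 -> C) (x : E3) : C :=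
  2^-1 * (us x - laplacian us x / (k ^+ 2)%:C).

Definition u_M (k : R) (us : E3 -> C) (x : E3) : C :=
  2^-1 * (us x + laplacian us x / (k ^+ 2)%:C).

(* The coefficients are indexed from 1, and the remainder is uniform in the
   direction. *)
Definition atkinson_coefficients (k : R) (uM : E3 -> C) (g : nat -> E3 -> C) :
    Prop :=
  forall N : nat, (0 < N)%N ->
    exists M : R, \forall r \near +oo, forall xhat, unit_sphere xhat ->
      cmod (uM (r *: xhat)
            - (expR (- (k * r)) / r)%:C
              * \sum_(1 <= j < N.+1) g j xhat / (r ^+ j.-1)%:C)
      <= expR (- (k * r)) / r * (M / r ^+ N).

Definition w_data (k : R) (d : E3) (us : E3 -> C) (x : E3) : R :=
  enorm x * expR (k * enorm x)
  * (cmod (u_tot k d us x) ^+ 2 - cmod (u_inc k d x + u_H k us x) ^+ 2)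
  / cmod (u_inc k d x + u_H k us x).

(* With the column index counted from 0, s_i^{-(j-1)} becomes s_i^{-j}. *)
Definition V_mx (n : nat) (s : 'I_n -> R) : 'M[R]_n :=
  \matrix_(i < n, j < n) s i ^- j.

Definition G_data (k : R) (d : E3) (us : E3 -> C) (xhat : E3) (n : nat)
    (s : 'I_n -> R) : 'cV[R]_n :=
  invmx (V_mx s) *m \col_(i < n) w_data k d us (s i *: xhat).

Definition col2 (a b : C) : 'cV[C]_2 := \col_(i < 2) [:: a; b]`_i.

Definition phase_mx (th th' : R) : 'M[C]_2 :=
  \matrix_(i < 2, j < 2)
    (nth [::] [:: [:: expi (- th); expi th]; [:: expi (- th'); expi th']] i)`_j.

(* Entrywise f(t) = O(h(t)) as t tends to infinity. *)
Definition bigO_col (m : nat) (f : R -> 'cV[C]_m) (h : R -> R) : Prop :=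
  exists M : R, \forall t \near +oo, forall i : 'I_m,
    cmod (f t i 0) <= M * h t.

End Defs.

(* Main.v *)
Require Import Defs.
From HB Require Import structures.
From mathcomp Require Import all_boot all_order all_algebra.
From mathcomp Require Import complex.
From mathcomp Require Import all_classical all_reals all_analysis.
From mathcomp Require Import perm zify ring lra.
Import Order.TTheory GRing.Theory Num.Theory.
Import numFieldNormedType.Exports.
Local Open Scope classical_set_scope.
Local Open Scope complex_scope.
Local Open Scope ring_scope.
Set Implicit Arguments.
Unset Strict Implicit.
Unset Printing Implicit Defensive.

(** Write [r = |x|]. Let [A = u^i + u_H] be the total Helmholtz part, so that
    [u = A + u_M], and let [theta] be its argument at [x]. Then
    [(|u|^2 - |A|^2) / |A| = 2 Re (exp (- i theta) u_M) + |u_M|^2 / |A|].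
    As [u_M] is [exp (- k r) / r] times a series in [1 / r], the data [w] at
    the points [t_j xhat] is [sum_l 2 Re (exp (- i theta) g_l) / t_j^(l-1)] up to
    an error of order [t^-n], provided [|A|] stays away from zero
    ([w_expansion]). The argument is the same for all [j], so this is a
    Vandermonde system for the numbers [2 Re (exp (- i theta) g_l)]; its nodes
    grow linearly in [t], and solving it costs a factor [t^(j-1)] in the [j]-th
    unknown ([V_mx_solve_bound], [G_data_expansion]). Two phases differing by the
    constant [k tau (xhat . d)], which is not a multiple of [pi], determine
    [g_j] and its conjugate from two such real numbers ([phase_mx_solve]).

    The remaining point is that [|A| >= 1/2] far away, which follows once the
    scattered field [u^s] tends to zero at infinity ([scattered_field_decay]).
    This is a consequence of the radiation condition and of
    [lap u^s + k^2 u^s = 2 k^2 u_M], whose right-hand side is exponentially small;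
    it is proved without a representation formula. The function
    [F = exp (- i k r) u^s] satisfies [lap F = - (2 i k / r) (F + o(1))] and
    [d F / d r = o(1 / r)]. At the scale [sqrt r] this is a perturbation of
    [lap F = - 2 i k F], whose only bounded entire solution is zero. The
    quantitative form of this fact is [one_scale_decay]: the maximum of [|F|] on
    the sphere of radius [r] almost bounds [|F|] on the annulus of radii [r / 2]
    and [2 r], since [F] hardly varies along rays; the maximum principle bounds
    the gradient of [F] ([gradient_bound]), so that [|F|] stays large on a small
    cube around the point of maximum; and an energy identity with a cutoff
    ([energy_estimate]) shows that [|F|^2] is small in mean on a large cube. The
    mean is taken over a finite grid, on which a divergence sums to almost zero
    ([box_average]). *)

Local Notation e_ i := (delta_mx 0 i).

(** * Directional derivatives and the second derivative test *)

Section Derivatives.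
Variable R : realType.
Local Notation E3 := 'rV[R]_3.
Implicit Types (f g : E3 -> R) (x v : E3) (t : R).

Lemma is_derive_sliceP f x v t df :
  is_derive (x + t *: v) v f df <->
  is_derive t 1 (fun s => f (x + s *: v)) df.
Proof.
have E : (fun h : R => h^-1 *: ((f \o shift (x + t *: v)) (h *: v) - f (x + t *: v)))
   = (fun h => h^-1 *: (((fun s => f (x + s *: v)) \o shift t) (h *: 1) - f (x + t *: v))).
  apply/funext => h /=; congr (_ *: (f _ - _)).
  by rewrite [h *: 1]mulr1 scalerDl addrCA.
by split=> -[D1 D2]; apply: DeriveDef; move: D1 D2; rewrite /derivable /derive E.
Qed.

Lemma is_derive_slice0P f x v df :
  is_derive x v f df <-> is_derive (0:R) 1 (fun s => f (x + s *: v)) df.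
Proof. by rewrite -is_derive_sliceP scale0r addr0. Qed.

(** Mean value theorem on a segment of direction [v]. *)
Lemma MVT_dir f f1 x v (a b : R) : a <= b ->
  (forall s, a <= s <= b -> is_derive (x + s *: v) v f (f1 (x + s *: v))) ->
  exists2 c, a <= c <= b &
    f (x + b *: v) - f (x + a *: v) = f1 (x + c *: v) * (b - a).
Proof.
move=> ab D.
have D' s : a <= s <= b ->
   is_derive s 1 (fun s => f (x + s *: v)) (f1 (x + s *: v)).
  by move=> /D /is_derive_sliceP.
have [||c cab E] := @MVT_segment R (fun s => f (x + s *: v))
  (fun s => f1 (x + s *: v)) _ _ ab.
- by move=> s; rewrite in_itv/= => /andP[h1 h2]; apply: D'; rewrite !ltW.
- apply: derivable_within_continuous => s; rewrite in_itv/= => h.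
  by have := D' s h => -[].
- by exists c => //; move: cab; rewrite in_itv.
Qed.

Lemma derive_gt0_right (h : R -> R) (D e : R) : is_derive (0:R) 1 h D ->
  0 < D -> 0 < e -> exists2 s, 0 < s < e & forall r, 0 < r <= s -> h 0 < h r.
Proof.
move=> [hd hv] D0 e0.
have : (fun k : R => k^-1 *: ((h \o shift 0) (k *: 1) - h 0)) @ 0^' --> D.
  by rewrite -hv; exact: hd.
move=> /cvgr_gt -/(_ _ D0).
rewrite near_withinE => /nbhs_ballP[d /= d0 H].
exists (Num.min d e / 2).
  by rewrite divr_gt0 ?lt_min ?d0//= ltr_pdivrMr// gt_min; apply/orP; right; lra.
move=> r /andP[r0 rs].
have := H r; rewrite /ball/= sub0r normrN gtr0_norm//.
have rd : r < d.
  apply: le_lt_trans rs _; rewrite ltr_pdivrMr// gt_min; apply/orP; left; lra.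
move=> /(_ rd); rewrite gt_eqF// => /(_ isT).
by rewrite [r *: 1]mulr1 addr0 [_ *: _]mulrC pmulr_lgt0 ?invr_gt0// subr_gt0.
Qed.

Lemma derive_le0_right (h : R -> R) (D e : R) : is_derive (0:R) 1 h D ->
  0 < e -> (forall s, 0 < s < e -> h s <= h 0) -> D <= 0.
Proof.
move=> hD e0 H; rewrite leNgt; apply/negP => D0.
have [s /andP[s0 se] /(_ s)] := derive_gt0_right hD D0 e0.
by rewrite s0 lexx => /(_ isT); rewrite ltNge H ?s0.
Qed.

Lemma second_derivative_max (h h1 : R -> R) (D e : R) : 0 < e ->
  (forall s : R, `|s| < e -> is_derive s 1 h (h1 s)) ->
  is_derive (0:R) 1 h1 D ->
  (forall s, `|s| < e -> h s <= h 0) -> D <= 0.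
Proof.
move=> e0 hd h1d hmax; rewrite leNgt; apply/negP => D0.
have itvE s : (s \in `](- e), e[%R) = (`|s| < e) by rewrite in_itv/= ltr_norml.
have z : h1 0 = 0.
  have [||||_ E0] := @derive1_at_max R h (- e) e 0.
  - by lra.
  - by move=> t; rewrite itvE => /hd[].
  - by rewrite itvE normr0.
  - by move=> t; rewrite itvE => /hmax.
  - by have [|_ <-] := hd 0; rewrite ?normr0 ?E0.
have [s /andP[s0 se] H] := derive_gt0_right h1d D0 e0.
have [||c] := @MVT R h h1 0 s s0.
- move=> r; rewrite in_itv/= => /andP[r0 rs]; apply: hd.
  by rewrite gtr0_norm// (lt_trans rs).
- apply: derivable_within_continuous => r; rewrite in_itv/= => /andP[r0 rs].
  by have [|] := hd r; rewrite // ger0_norm// (le_lt_trans rs).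
rewrite in_itv/= => /andP[c0 cs] E.
have : 0 < h s - h 0.
  by rewrite E subr0 mulr_gt0//; rewrite -z; apply: H; rewrite c0 ltW.
by rewrite subr_gt0 ltNge hmax// gtr0_norm.
Qed.

Lemma is_derive_reflect (f : E3 -> R) x v df :
  is_derive x v f df -> is_derive x (- v) f (- df).
Proof.
move=> /is_derive_slice0P H; apply/is_derive_slice0P.
have E : (fun s => f (x + s *: - v)) = (fun s => f (x + s *: v)) \o -%R.
  by apply/funext => s /=; rewrite scalerN scaleNr.
rewrite E; have H' : is_derive (- (0:R)) 1 (fun s => f (x + s *: v)) df.
  by rewrite oppr0.
by have := is_derive1_comp H' (is_deriveNid (0:R) 1); rewrite mulrN1.
Qed.

(** [smooth2 U f f1 f2]: at each point of [U] the function [f] is continuous and,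
    for each [i], [f1 i] and [f2 i] are continuous and are the first and the
    pure second partial derivatives of [f] in the [i]-th variable. The
    derivatives are carried as explicit witnesses, and mixed second derivatives
    are left out: only gradients and Laplacians are needed. Differentiability
    at the points of [U] refers to the values of [f] around them, so [U] need
    not be open. *)
Definition smooth2 (U : set E3) (f : E3 -> R) (f1 f2 : 'I_3 -> E3 -> R) :=
  forall x, U x -> {for x, continuous f} /\
   forall i, [/\ {for x, continuous (f1 i)}, {for x, continuous (f2 i)},
     is_derive x (e_ i) f (f1 i x) & is_derive x (e_ i) (f1 i) (f2 i x)].

(** The closed cube of centre [x0] and half-side [L]. *)
Definition cube (x0 : E3) (L : R) : set E3 :=
  [set x | forall i, `|x 0 i - x0 0 i| <= L].

Lemma coordE x s (i j : 'I_3) :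
  (x + s *: e_ i) 0 j = x 0 j + s * (j == i)%:R :> R.
Proof. by rewrite !mxE eqxx andTb. Qed.

Lemma is_derive_ext (V : normedModType R) (f g : V -> R) (x v : V) (df dg : R) :
  is_derive x v f df -> (forall y, f y = g y) -> df = dg -> is_derive x v g dg.
Proof. by move=> H /funext <- <-. Qed.

Lemma is_derive_coordfun (p p1 : R -> R) x (i j : 'I_3) :
  is_derive (x 0 j) 1 p (p1 (x 0 j)) ->
  is_derive x (e_ i) (fun y => p (y 0 j)) ((j == i)%:R * p1 (x 0 j)).
Proof.
move=> pd; apply/is_derive_slice0P.
have -> : (fun s => p ((x + s *: e_ i) 0 j)) =
    p \o (fun s => x 0 j + s * (j == i)%:R).
  by apply/funext => s /=; rewrite coordE.
have H : is_derive (x 0 j + 0 * (j == i)%:R) 1 p (p1 (x 0 j)).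
  by rewrite mul0r addr0.
have H2 : is_derive (0:R) 1 (fun s => x 0 j + s * (j == i)%:R) ((j == i)%:R).
  apply: is_derive_ext (is_deriveD (is_derive_cst (x 0 j) (0:R) 1)
    (is_deriveZ ((j == i)%:R) (is_derive_id (0:R) 1))) _ _.
    by move=> s; congr (_ + _); exact: mulrC.
  by rewrite add0r; exact: mulr1.
have := @is_derive1_comp R p (fun s => x 0 j + s * (j == i)%:R) 0 _ _ H H2.
by rewrite mulrC.
Qed.

End Derivatives.

Section MaximumPrinciple.
Variable R : realType.
Local Notation E3 := 'rV[R]_3.
Implicit Types (f g : E3 -> R) (x v : E3) (t : R).

Lemma norm_rV_le n (x : 'rV[R]_n.+1) (e : R) : 0 <= e ->
  (forall i, `|x 0 i| <= e) -> `|x| <= e.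
Proof.
move=> e0 H; rewrite /Num.norm/= mx_normrE; apply/bigmax_leP; split => // -[i j] _ /=.
by rewrite ord1.
Qed.

Lemma norm_rV_lt n (x : 'rV[R]_n.+1) (e : R) : 0 < e ->
  (forall i, `|x 0 i| < e) -> `|x| < e.
Proof.
move=> e0 H; rewrite /Num.norm/= mx_normrE; apply/bigmax_ltP; split => // -[i j] _ /=.
by rewrite ord1.
Qed.

Lemma norm_coord_le n (x : 'rV[R]_n.+1) i : `|x 0 i| <= `|x|.
Proof.
by rewrite /Num.norm/= mx_normrE; apply: (le_bigmax _ (fun j => `|x j.1 j.2|) (0, i)).
Qed.

Lemma compact_cube (x0 : E3) (L : R) : compact (cube x0 L).
Proof.
have -> : cube x0 L =
   [set v : E3 | forall i, `[x0 0 i - L, x0 0 i + L]%classic (v ord0 i)].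
  apply/seteqP; split => x /= H i; have := H i; rewrite /= in_itv/= ler_distl//.
by apply: (@rV_compact _ _ (fun i => `[x0 0 i - L, x0 0 i + L]%classic)) => i;
  exact: segment_compact.
Qed.

(** Heine--Cantor, in the form where continuity holds at each point of [K] as
    a function on the whole space. *)
Lemma uniform_continuity (K : set E3) f (e : R) : compact K ->
  (forall x, K x -> {for x, continuous f}) -> 0 < e ->
  exists2 d : R, 0 < d & forall x y, K x -> `|x - y| < d -> `|f x - f y| < e.
Proof.
move=> /compact_near_coveringP/near_covering_withinP cK cf e0.
have := cK _ (0 : R)^'+ (fun d x => forall y, `|x - y| < d -> `|f x - f y| < e) _.
case.
- move=> x Kx.
  have /cvgrPdist_lt/(_ (e / 2)) := cf x Kx.
  rewrite divr_gt0// => /(_ isT)/nbhs_ballP[r /= r0 H].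
  exists (ball x (r / 2), [set d | d < r / 2]).
    split; first by apply: nbhsx_ballx; rewrite divr_gt0.
    by apply: nbhs_right_lt; rewrite divr_gt0.
  move=> [y d] /= [xy dr] Ky z yz.
  have fy : `|f x - f y| < e / 2.
    apply: H; apply: le_ball xy; lra.
  have fz : `|f x - f z| < e / 2.
    apply: H; move: xy; rewrite -!ball_normE /= => xy.
    rewrite -(subrKA y) (le_lt_trans (ler_normD _ _))//.
    have := lt_trans yz dr; move: xy; lra.
  have -> : f y - f z = (f x - f z) - (f x - f y) by ring.
  by rewrite (le_lt_trans (ler_normB _ _))//; lra.
- move=> d /= d0 H.
  exists (d / 2); first by rewrite divr_gt0.
  move=> x y Kx xy; apply: (H (d / 2)) => //=; last by rewrite divr_gt0.
  by rewrite sub0r normrN gtr0_norm ?divr_gt0// ltr_pdivrMr//; lra.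
Qed.

Lemma derive_sum_coord (P P1 : 'I_3 -> R -> R) x (i : 'I_3) :
  (forall j t, is_derive t 1 (P j) (P1 j t)) ->
  is_derive x (e_ i) (fun y => \sum_j P j (y 0 j)) (P1 i (x 0 i)).
Proof.
move=> H.
have -> : (fun y : E3 => \sum_j P j (y 0 j)) = \sum_j (fun y : E3 => P j (y 0 j)).
  by apply/funext => y; rewrite fct_sumE.
have := @is_derive_sum R E3 R 3 (fun j (y : E3) => P j (y 0 j)) x (e_ i)
  (fun j => (j == i)%:R * P1 j (x 0 j)).
have -> : \sum_j (j == i)%:R * P1 j (x 0 j) = P1 i (x 0 i).
  rewrite (bigD1 i)//= eqxx mul1r big1 ?addr0// => j /negbTE ->.
  by rewrite mul0r.
by apply => j; apply: is_derive_coordfun; exact: H.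
Qed.

(** A local maximum along each axis forces the pure second derivatives to be
    nonpositive, hence the Laplacian. *)
Lemma laplacian_max (g : E3 -> R) (g1 g2 : 'I_3 -> E3 -> R) (c : E3) (e : R) :
  0 < e ->
  (forall i s, `|s| < e -> is_derive (c + s *: e_ i) (e_ i) g (g1 i (c + s *: e_ i))) ->
  (forall i, is_derive c (e_ i) (g1 i) (g2 i c)) ->
  (forall i s, `|s| < e -> g (c + s *: e_ i) <= g c) ->
  \sum_i g2 i c <= 0.
Proof.
move=> e0 H1 H2 H3; apply: sumr_le0 => i _.
apply: (@second_derivative_max R (fun s => g (c + s *: e_ i))
  (fun s => g1 i (c + s *: e_ i)) _ e) => //.
- by move=> s /(H1 i) /is_derive_sliceP.
- by apply/is_derive_slice0P; exact: H2.
- by move=> s /(H3 i); rewrite scale0r addr0.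
Qed.
End MaximumPrinciple.

(** * An interior gradient estimate by the maximum principle *)

Section GradientEstimate.
Variable R : realType.
Local Notation E3 := 'rV[R]_3.
Implicit Types (f g : E3 -> R) (x v : E3) (t : R).

Lemma contD (f g : E3 -> R) x : {for x, continuous f} -> {for x, continuous g} ->
  {for x, continuous (fun y => f y + g y)}.
Proof. exact: continuousD. Qed.

Lemma contB (f g : E3 -> R) x : {for x, continuous f} -> {for x, continuous g} ->
  {for x, continuous (fun y => f y - g y)}.
Proof. exact: continuousB. Qed.

Lemma contM (f g : E3 -> R) x : {for x, continuous f} -> {for x, continuous g} ->
  {for x, continuous (fun y => f y * g y)}.
Proof. exact: continuousM. Qed.

Lemma cont_cst (c : R) x : {for x, continuous (fun=> c : R)}.
Proof. exact: cst_continuous. Qed.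

Lemma cont_sum (n : nat) (h : 'I_n -> E3 -> R) x :
  (forall i, {for x, continuous (h i)}) ->
  {for x, continuous (fun y => \sum_i h i y)}.
Proof.
move=> H; rewrite (_ : (fun y : E3 => _) = \sum_i h i); last first.
  by apply/funext => y; rewrite fct_sumE.
elim/big_ind : _ => [|u w cu cw|j _]; [exact: cst_continuous|exact: continuousD|exact: H].
Qed.

Lemma continuous_sum_coord (P P1 : 'I_3 -> R -> R) :
  (forall j t, is_derive t 1 (P j) (P1 j t)) ->
  continuous (fun y : E3 => \sum_j P j (y 0 j)).
Proof.
move=> H x; apply: cont_sum => j.
apply: (@continuous_comp _ _ _ (fun y : E3 => y 0 j) (P j)).
  exact: coord_continuous.
by have [/derivable1_diffP/differentiable_continuous] := H j (x 0 j).
Qed.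

Lemma compact_box (lo hi : 'I_3 -> R) :
  compact [set v : E3 | forall i, lo i <= v 0 i <= hi i].
Proof.
have -> : [set v : E3 | forall i, lo i <= v 0 i <= hi i] =
   [set v : E3 | forall i, `[lo i, hi i]%classic (v ord0 i)].
  by apply/seteqP; split => x /= H i; have := H i; rewrite /= in_itv/=.
by apply: (@rV_compact _ _ (fun i => `[lo i, hi i]%classic)) => i;
  exact: segment_compact.
Qed.

(** Reflection in the plane through [x0] orthogonal to the [i]-th axis. *)
Definition mirror (x0 : E3) (i : 'I_3) (y : E3) : E3 :=
  y - (2 * (y 0 i - x0 0 i)) *: e_ i.

Lemma mirror_coord x0 (i j : 'I_3) y :
  mirror x0 i y 0 j = if j == i then 2 * x0 0 i - y 0 i else y 0 j.
Proof.
rewrite /mirror !mxE eqxx andTb.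
by case: eqP => [->|_]; rewrite ?mulr1 ?mulr0 ?subr0//; ring.
Qed.

Lemma mirror_shift x0 (i j : 'I_3) y s :
  mirror x0 i (y + s *: e_ j) = mirror x0 i y + s *: ((-1) ^+ (j == i) *: e_ j).
Proof.
apply/rowP => l; rewrite [RHS]mxE !mirror_coord !coordE !mxE eqxx andTb.
case: (l =P i) => [->|/eqP li]; case: (j =P i) => [->|/eqP ji];
  rewrite ?eqxx ?expr1 ?expr0 ?(eq_sym i j) ?(negbTE li) ?(negbTE ji) ?mulr1 /=;
  ring.
Qed.

Lemma mirror_continuous x0 i : continuous (mirror x0 i).
Proof.
move=> y; have H : {for y, continuous (fun z : E3 => 2 * (z 0 i - x0 0 i))}.
  apply: contM; first exact: cont_cst.
  by apply: contB; [exact: coord_continuous | exact: cont_cst].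
apply: (@continuousB R E3 E3 id (fun z => (2 * (z 0 i - x0 0 i)) *: e_ i) y).
  by move=> A.
exact: continuousZr_tmp H.
Qed.

Lemma is_derive_mirror f x0 (i j : 'I_3) y df :
  is_derive (mirror x0 i y) (e_ j) f df ->
  is_derive y (e_ j) (f \o mirror x0 i) ((-1) ^+ (j == i) * df).
Proof.
move=> H; have H' : is_derive (mirror x0 i y) ((-1) ^+ (j == i) *: e_ j) f
    ((-1) ^+ (j == i) * df).
  case: eqP => _; rewrite ?expr1 ?expr0 ?scale1r ?mul1r//.
  by rewrite scaleN1r mulN1r; exact: is_derive_reflect.
apply/is_derive_slice0P; move/is_derive_slice0P : H'.
by congr is_derive; apply/funext => s /=; rewrite mirror_shift.
Qed.

Lemma is_derive_quadratic (al be ga z t : R) :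
  is_derive t 1 (fun s : R => al + be * (s - z) + ga * (s - z) ^+ 2)
    (be + 2 * ga * (t - z)).
Proof.
have D := is_deriveB (is_derive_id t (1 : R)) (is_derive_cst z t 1).
apply: is_derive_ext (is_deriveD (is_deriveD (is_derive_cst al t 1) (is_deriveZ be D))
  (is_deriveZ ga (is_deriveM D D))) _ _.
  move=> u; change (al + be * (u - z) + ga * ((u - z) * (u - z)) =
    al + be * (u - z) + ga * (u - z) ^+ 2); ring.
change (0 + be * (1 - 0) + ga * ((t - z) * (1 - 0) + (t - z) * (1 - 0)) =
  be + 2 * ga * (t - z)); ring.
Qed.

(** If [f] is bounded by [M] and its Laplacian by [K] on a cube of half-side [d],
    then each first derivative at the centre is at most [3 M / d + K d / 2].
    The odd part of [f] in the [i]-th variable is compared, on the half of the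
    cube where that variable is at least its central value, with a quadratic
    barrier [psi] of Laplacian [- K]: the difference [g] has a positive
    Laplacian, so its maximum lies on the boundary, where it is nonpositive. *)
Lemma gradient_upper_bound f (f1 f2 : 'I_3 -> E3 -> R) x0 (d M K : R) (i : 'I_3) : 0 < d ->
  smooth2 (cube x0 d) f f1 f2 ->
  (forall x, cube x0 d x -> `|f x| <= M) ->
  (forall x, cube x0 d x -> `|\sum_j f2 j x| < K) ->
  f1 i x0 <= 3 * M / d + K * d / 2.
Proof.
move=> d0 sf fM lK.
have cx0 : cube x0 d x0 by move=> j; rewrite subrr normr0 ltW.
have M0 : 0 <= M by apply: le_trans (fM _ cx0).
have K0 : 0 < K by apply: le_lt_trans (lK _ cx0).
pose q := M / d ^+ 2.
have q0 : 0 <= q by rewrite divr_ge0// sqr_ge0.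
have qd : q * d ^+ 2 = M by rewrite divfK// sqrf_eq0 gt_eqF.
pose o j : R := (j == i)%:R.
pose P j t := q * ((t - x0 0 j) ^+ 2 + o j * (3 * d * (t - x0 0 j) - 3 * (t - x0 0 j) ^+ 2))
   + o j * K / 2 * (d * (t - x0 0 j) - (t - x0 0 j) ^+ 2).
pose P1 j t := q * (2 * (t - x0 0 j) + o j * (3 * d - 6 * (t - x0 0 j)))
   + o j * K / 2 * (d - 2 * (t - x0 0 j)).
pose P2 j := q * (2 - 6 * o j) - o j * K.
have dP j t : is_derive t 1 (P j) (P1 j t).
  have := is_derive_quadratic 0 (q * o j * 3 * d + o j * K / 2 * d)
    (q - q * o j * 3 - o j * K / 2) (x0 0 j) t.
  by congr is_derive; [apply/funext => s; rewrite /P | rewrite /P1]; field.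
have dP1 j t : is_derive t 1 (P1 j) (P2 j).
  have := is_derive_quadratic (q * o j * 3 * d + o j * K / 2 * d)
    (2 * (q - q * o j * 3 - o j * K / 2)) 0 (x0 0 j) t.
  by congr is_derive; [apply/funext => s; rewrite /P1 | rewrite /P2]; field.
have so (F : 'I_3 -> R) : \sum_j o j * F j = F i.
  rewrite (bigD1 i)//= big1 /o ?eqxx ?mul1r ?addr0// => j /negbTE ->.
  by rewrite mul0r.
have sumP2 : \sum_j P2 j = - K.
  rewrite (eq_bigr (fun j => 2 * q + o j * (- 6 * q - K))); last first.
    by move=> j _; rewrite /P2; ring.
  by rewrite big_split/= so sumr_const card_ord; ring.
pose m := mirror x0 i.
have cm y : cube x0 d y -> cube x0 d (m y).
  move=> Hy j; rewrite mirror_coord; case: eqP => [->|_]; last exact: Hy.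
  by rewrite (_ : _ - _ = - (y 0 i - x0 0 i)) ?normrN//; ring.
pose psi (y : E3) := \sum_j P j (y 0 j).
pose g y := (f y - f (m y)) / 2 - psi y.
pose g1 (j : 'I_3) y := (f1 j y - (-1) ^+ (j == i) * f1 j (m y)) / 2 - P1 j (y 0 j).
pose g2 (j : 'I_3) y := (f2 j y - f2 j (m y)) / 2 - P2 j.
have psiE y : psi y = q * (\sum_j (y 0 j - x0 0 j) ^+ 2
   + 3 * d * (y 0 i - x0 0 i) - 3 * (y 0 i - x0 0 i) ^+ 2)
   + K / 2 * (d * (y 0 i - x0 0 i) - (y 0 i - x0 0 i) ^+ 2).
  rewrite /psi /P big_split/= -mulr_sumr big_split/= so -addrA.
  congr (_ * _ + _).
  rewrite (eq_bigr (fun j => o j *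
      (K / 2 * (d * (y 0 j - x0 0 j) - (y 0 j - x0 0 j) ^+ 2)))) ?so//.
  by move=> j _; rewrite !mulrA.
have dg y j : cube x0 d y -> is_derive y (e_ j) g (g1 j y).
  move=> Hy; have [_ /(_ j)[_ _ D1 _]] := sf _ Hy.
  have [_ /(_ j)[_ _ D2 _]] := sf _ (cm _ Hy).
  have D2' := is_derive_mirror D2.
  have D3 := derive_sum_coord y j dP.
  apply: is_derive_ext (is_deriveB (is_deriveZ (2^-1) (is_deriveB D1 D2')) D3) _ _.
    by move=> z; rewrite /g mulrC.
  by congr (_ - _); exact: mulrC.
have dg1 y j : cube x0 d y -> is_derive y (e_ j) (g1 j) (g2 j y).
  move=> Hy; have [_ /(_ j)[_ _ _ D1]] := sf _ Hy.
  have [_ /(_ j)[_ _ _ D2]] := sf _ (cm _ Hy).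
  have D2' := is_derive_mirror D2.
  have D3 := @is_derive_coordfun R (P1 j) (fun=> P2 j) y j j (dP1 j _).
  apply: is_derive_ext (is_deriveB (is_deriveZ (2^-1)
    (is_deriveB D1 (is_deriveZ ((-1) ^+ (j == i)) D2'))) D3) _ _.
    by move=> z; congr (_ - _); exact: mulrC.
  rewrite eqxx mul1r; congr (_ - _); rewrite [LHS]mulrC; congr (_ * _).
  congr (_ - _); rewrite -[_ *: _]/(_ * _) mulrA.
  by rewrite -expr2 sqrr_sign mul1r.
have cg y : cube x0 d y -> {for y, continuous g}.
  move=> Hy; have [C1 _] := sf _ Hy; have [C2 _] := sf _ (cm _ Hy).
  apply: contB; last exact: (continuous_sum_coord dP).
  apply: contM; last exact: cont_cst.
  by apply: (contB C1); exact: (@continuous_comp _ _ _ m f y (@mirror_continuous _ _ y) C2).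
pose H : set E3 := [set y | cube x0 d y /\ 0 <= y 0 i - x0 0 i].
have cH : compact H.
  rewrite (_ : H = [set v : E3 | forall j, (if j == i then x0 0 j else x0 0 j - d) <= v 0 j <= x0 0 j + d]).
    exact: compact_box.
  apply/seteqP; split => y /=.
    move=> [Hy yi] j; have := Hy j; rewrite ler_distl => /andP[h1 h2].
    by rewrite h2 andbT; case: eqP => // ->; rewrite -subr_ge0.
  move=> Hy; split; last by have := Hy i; rewrite eqxx subr_ge0 => /andP[].
  move=> j; have /andP[h1 h2] := Hy j; rewrite ler_distl h2 andbT.
  by apply: le_trans h1; case: eqP => // _; rewrite lerBlDr lerDl ltW.
have [|||c] := @EVT_max_rV R 3 g H.
- by exists x0; split; rewrite ?subrr.
- exact: cH.
- by apply: continuous_in_subspaceT => y; rewrite inE => -[/cg].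
rewrite inE => -[cc ci] cmax.
(* On the faces of the cube the barrier dominates the odd part of [f]. *)
have Mpsi y : cube x0 d y -> 0 <= y 0 i - x0 0 i -> (exists j, `|y 0 j - x0 0 j| = d) ->
    M <= psi y.
  move=> Hy s0 [j jd]; have := Hy i; rewrite psiE -qd; set s := y 0 i - x0 0 i in s0 *.
  rewrite ger0_norm// => sd.
  suff : d ^+ 2 <= \sum_j (y 0 j - x0 0 j) ^+ 2 + 3 * d * s - 3 * s ^+ 2.
    move=> h; have : 0 <= K / 2 * (d * s - s ^+ 2).
      by rewrite mulr_ge0//; [lra | rewrite subr_ge0 expr2 ler_wpM2r].
    have := ler_wpM2l q0 h; lra.
  rewrite (bigD1 i)//= -/s.
  have [ji|ji] := eqVneq j i.
    have sE : s = d by rewrite -jd ji ger0_norm.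
    have : 0 <= \sum_(j | j != i) (y 0 j - x0 0 j) ^+ 2.
      by apply: sumr_ge0 => l _; exact: sqr_ge0.
    by rewrite sE; lra.
  rewrite (bigD1 j)//= -(real_normK (num_real (y 0 j - x0 0 j))) jd.
  have : 0 <= \sum_(l | (l != i) && (l != j)) (y 0 l - x0 0 l) ^+ 2.
    by apply: sumr_ge0 => l _; exact: sqr_ge0.
  have : 0 <= s * (d - s) by rewrite mulr_ge0// subr_ge0.
  have : 0 <= s * d by rewrite mulr_ge0// ltW.
  by rewrite !expr2; nra.
have gc0 : g c <= 0.
  have [si|si] := eqVneq (c 0 i - x0 0 i) 0.
    have -> : g c = - psi c.
      rewrite /g (_ : m c = c) ?subrr ?mul0r ?sub0r//.
      by rewrite /m /mirror si mulr0 scale0r subr0.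
    rewrite oppr_le0 psiE si expr0n/= !mulr0 !subr0 !addr0 mulr0 addr0 mulr_ge0//.
    by apply: sumr_ge0 => l _; exact: sqr_ge0.
  have [jd|/forallNP nd] := pselect (exists j, `|c 0 j - x0 0 j| = d).
    have := Mpsi _ cc ci jd; rewrite /g.
    have := fM _ cc; rewrite ler_norml => /andP[_].
    have := fM _ (cm _ cc); rewrite ler_norml => /andP[].
    lra.
  have si0 : 0 < c 0 i - x0 0 i by rewrite lt_neqAle eq_sym si.
  have cd : `|c - x0| < d.
    apply: norm_rV_lt => // j; rewrite !mxE lt_neqAle cc andbT.
    exact/eqP/nd.
  exfalso; have e0 : 0 < Num.min (c 0 i - x0 0 i) (d - `|c - x0|).
    by rewrite lt_min si0 subr_gt0.
  have inH (j : 'I_3) s : `|s| < Num.min (c 0 i - x0 0 i) (d - `|c - x0|) ->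
      H (c + s *: e_ j).
    rewrite lt_min => /andP[s1 s2]; split.
      move=> l; rewrite coordE.
      have -> : c 0 l + s * (l == j)%:R - x0 0 l = (c - x0) 0 l + s * (l == j)%:R.
        by rewrite !mxE; ring.
      apply: le_trans (ler_normD _ _) _.
      have := norm_coord_le (c - x0) l.
      have : `|s * (l == j)%:R| <= `|s|.
        by case: eqP; rewrite ?mulr1 ?mulr0 ?normr0.
      by move: s2; lra.
    rewrite coordE; move: s1; case: eqP; rewrite ?mulr0 ?addr0 ?mulr1 => _.
      by rewrite ltr_norml => /andP[]; lra.
    by [].
  have := @laplacian_max R g g1 g2 c _ e0 _ _ _.
  have -> : \sum_j g2 j c = (\sum_j f2 j c - \sum_j f2 j (m c)) / 2 + K.
    rewrite /g2 sumrB sumP2 opprK -mulr_suml; congr (_ / _ + _).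
    by rewrite sumrB.
  move=> H0; suff : (\sum_j f2 j c - \sum_j f2 j (m c)) / 2 + K <= 0.
    have := lK _ cc; have := lK _ (cm _ cc); rewrite !ltr_norml => /andP[_ h1] /andP[h2 _].
    move: h1 h2; lra.
  apply: H0 => [j s /(inH j)[hs _]|j|j s /(inH j) hs].
  - exact: dg.
  - exact: dg1.
  - by apply: cmax; rewrite inE.
have gle s : 0 < s < d -> (f (x0 + s *: e_ i) - f (x0 - s *: e_ i)) / 2
   <= s * (3 * M / d + K * d / 2).
  move=> /andP[s0 sd]; have ii : (x0 + s *: e_ i) 0 i - x0 0 i = s :> R.
    by rewrite coordE eqxx mulr1 addrAC subrr add0r.
  have HH : H (x0 + s *: e_ i).
    split; last by rewrite ii ltW.
    move=> l; rewrite coordE (addrC (x0 0 l)) addrK.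
    by case: eqP => _; rewrite ?mulr1 ?mulr0 ?normr0 ?ltW ?gtr0_norm.
  have : g (x0 + s *: e_ i) <= 0.
    by apply: le_trans gc0; apply: cmax; rewrite inE.
  rewrite /g psiE ii.
  rewrite (_ : m _ = x0 - s *: e_ i); last first.
    rewrite /m mirror_shift eqxx expr1 scaleN1r scalerN; congr (_ - _).
    by rewrite /mirror subrr mulr0 scale0r subr0.
  rewrite (_ : \sum_j _ = s ^+ 2); last first.
    rewrite (eq_bigr (fun l => o l * s ^+ 2)) ?so// => l _.
    rewrite coordE (addrC (x0 0 l)) addrK /o; case: eqP => _;
    by rewrite ?mulr1 ?mulr0 ?mul1r ?mul0r ?expr0n.
  have -> : s * (3 * M / d + K * d / 2) = q * (3 * d * s) + K / 2 * (d * s).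
    by rewrite /q; field; rewrite gt_eqF.
  have : 0 <= q * s ^+ 2 by rewrite mulr_ge0// sqr_ge0.
  have : 0 <= K * s ^+ 2 by rewrite mulr_ge0// ?sqr_ge0// ltW.
  lra.
have [_ /(_ i)[_ _ D1 _]] := sf _ cx0.
have D1' := is_derive_reflect D1.
move/is_derive_slice0P : D1 => D1; move/is_derive_slice0P : D1' => D1'.
have D3 := is_derive_quadratic 0 (3 * M / d + K * d / 2) 0 0 0.
have D := is_deriveB (is_deriveZ (2^-1) (is_deriveB D1 D1')) D3.
have := derive_le0_right D d0.
have -> : 2^-1 *: (f1 i x0 - - f1 i x0) -
       (3 * M / d + K * d / 2 + 2 * 0 * (0 - 0)) = f1 i x0 - (3 * M / d + K * d / 2).
  by rewrite -[2^-1 *: _]/(2^-1 * _); field; rewrite gt_eqF.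
rewrite subr_le0; apply => s sd.
rewrite !fctE !subr0 expr0n/= !mulr0 !addr0 !add0r !scale0r subrr scaler0 subr0.
rewrite subr_le0 mul0r addr0 [X in _ <= X]mulrC.
have := gle _ sd; rewrite scalerN.
by rewrite -[2^-1 *: _]/(2^-1 * _); lra.
Qed.
End GradientEstimate.

(** * Calculus of twice differentiable functions *)

Section Smooth2.
Variable R : realType.
Local Notation E3 := 'rV[R]_3.
Implicit Types (x v : E3) (t : R) (U : set E3).

Lemma smooth2D U f f1 f2 g g1 g2 : smooth2 U f f1 f2 -> smooth2 U g g1 g2 ->
  smooth2 U (fun x : E3 => f x + g x) (fun i x => f1 i x + g1 i x)
    (fun i x => f2 i x + g2 i x : R).
Proof.
move=> sf sg x Ux; have [cf Hf] := sf _ Ux; have [cg Hg] := sg _ Ux.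
split; first exact: contD.
move=> i; have [cf1 cf2 df1 df2] := Hf i; have [cg1 cg2 dg1 dg2] := Hg i.
by split; [exact: contD|exact: contD|exact: is_deriveD|exact: is_deriveD].
Qed.

Lemma smooth2M U f f1 f2 g g1 g2 : smooth2 U f f1 f2 -> smooth2 U g g1 g2 ->
  smooth2 U (fun x : E3 => f x * g x) (fun i x => f1 i x * g x + f x * g1 i x)
    (fun i x => f2 i x * g x + 2 * (f1 i x * g1 i x) + f x * g2 i x : R).
Proof.
move=> sf sg x Ux; have [cf Hf] := sf _ Ux; have [cg Hg] := sg _ Ux.
split; first exact: contM.
move=> i; have [cf1 cf2 df1 df2] := Hf i; have [cg1 cg2 dg1 dg2] := Hg i.
split.
- by apply: contD; exact: contM.
- do 2?apply: contD; try exact: contM.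
  by apply: contM; [exact: cont_cst|exact: contM].
- apply: is_derive_ext (is_deriveM df1 dg1) _ _ => //.
  by rewrite addrC -[_ *: _]/(_ * _) -[f x *: _]/(_ * _) (mulrC (g x)).
- apply: is_derive_ext (is_deriveD (is_deriveM df2 dg1) (is_deriveM df1 dg2)) _ _ => //.
  change (f1 i x * g1 i x + g x * f2 i x + (f x * g2 i x + g1 i x * f1 i x) =
    f2 i x * g x + 2 * (f1 i x * g1 i x) + f x * g2 i x); ring.
Qed.

Lemma smooth2N U f f1 f2 : smooth2 U f f1 f2 ->
  smooth2 U (fun x : E3 => - f x) (fun i x => - f1 i x) (fun i x => - f2 i x : R).
Proof.
move=> sf x Ux; have [cf Hf] := sf _ Ux.
split; first exact: continuousN.
move=> i; have [cf1 cf2 df1 df2] := Hf i.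
by split; [exact: continuousN|exact: continuousN|exact: is_deriveN|exact: is_deriveN].
Qed.

Lemma smooth2S U V f f1 f2 : V `<=` U -> smooth2 U f f1 f2 ->
  smooth2 (R := R) V f f1 f2.
Proof. by move=> VU sf x /VU /sf. Qed.

Lemma is_derive_comp_dir (p : R -> R) (h : E3 -> R) x v p1 h1 :
  is_derive (h x) 1 p p1 -> is_derive x v h h1 ->
  is_derive x v (fun y => p (h y)) (p1 * h1).
Proof.
move=> dp /is_derive_slice0P dh; apply/is_derive_slice0P.
have dp' : is_derive (h (x + 0 *: v)) 1 p p1 by rewrite scale0r addr0.
exact: (@is_derive1_comp R p (fun s => h (x + s *: v)) 0 _ _ dp' dh).
Qed.

Lemma cont_comp (p : R -> R) (h : E3 -> R) x :
  {for x, continuous h} -> {for h x, continuous p} ->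
  {for x, continuous (fun y => p (h y))}.
Proof. by move=> ch cp; exact: (@continuous_comp _ _ _ h p). Qed.

Lemma smooth2_comp U (p p1 p2 : R -> R) h h1 h2 : smooth2 U h h1 h2 ->
  (forall x, U x -> [/\ {for h x, continuous p2},
     is_derive (h x) 1 p (p1 (h x)) & is_derive (h x) 1 p1 (p2 (h x))]) ->
  smooth2 U (fun x : E3 => p (h x)) (fun i x => p1 (h x) * h1 i x)
    (fun i x => p2 (h x) * h1 i x ^+ 2 + p1 (h x) * h2 i x).
Proof.
move=> sh H x Ux; have [ch Hh] := sh _ Ux; have [cp2 dp dp1] := H _ Ux.
have cp : {for h x, continuous p}.
  by case: dp => /derivable1_diffP/differentiable_continuous.
have cp1 : {for h x, continuous p1}.
  by case: dp1 => /derivable1_diffP/differentiable_continuous.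
split; first exact: cont_comp.
move=> i; have [ch1 ch2 dh1 dh2] := Hh i.
split.
- by apply: contM => //; exact: cont_comp.
- apply: contD; apply: contM => //; [exact: cont_comp| |exact: cont_comp].
  by rewrite (_ : (fun _ => _) = (fun y => h1 i y * h1 i y)) //; exact: contM.
- exact: is_derive_comp_dir.
- apply: is_derive_ext (is_deriveM (is_derive_comp_dir dp1 dh1) dh2) _ _ => //.
  change (p1 (h x) * h2 i x + h1 i x * (p2 (h x) * h1 i x) =
    p2 (h x) * h1 i x ^+ 2 + p1 (h x) * h2 i x); ring.
Qed.

Lemma smooth2_sum_coord U (P P1 P2 : 'I_3 -> R -> R) :
  (forall j t, is_derive t 1 (P j) (P1 j t)) ->
  (forall j t, is_derive t 1 (P1 j) (P2 j t)) ->
  (forall j, continuous (P2 j)) ->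
  smooth2 U (fun x : E3 => \sum_j P j (x 0 j)) (fun i x => P1 i (x 0 i))
   (fun i x => P2 i (x 0 i)).
Proof.
move=> dP dP1 cP2 x _; split; first exact: (continuous_sum_coord dP).
move=> i; split.
- apply: cont_comp; first exact: coord_continuous.
  by case: (dP1 i (x 0 i)) => /derivable1_diffP/differentiable_continuous.
- by apply: cont_comp; [exact: coord_continuous | exact: cP2].
- exact: derive_sum_coord.
- by have := is_derive_coordfun i (dP1 i (x 0 i)); rewrite eqxx mul1r.
Qed.

Lemma smooth2_ext U f f1 f2 g g1 g2 : smooth2 U f f1 f2 ->
  (forall x : E3, f x = g x) -> (forall i x, f1 i x = g1 i x) ->
  (forall i x, f2 i x = g2 i x :> R) -> smooth2 U g g1 g2.
Proof.
move=> sf /funext <- E1 E2.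
have <- : f1 = g1 by apply/funext => i; apply/funext => x; exact: E1.
have <- : f2 = g2 by apply/funext => i; apply/funext => x; exact: E2.
by [].
Qed.

(** The two-sided form of the gradient estimate. *)
Lemma gradient_bound f (f1 f2 : 'I_3 -> E3 -> R) x0 (d M K : R) (i : 'I_3) : 0 < d ->
  smooth2 (cube x0 d) f f1 f2 ->
  (forall x, cube x0 d x -> `|f x| <= M) ->
  (forall x, cube x0 d x -> `|\sum_j f2 j x| < K) ->
  `|f1 i x0| <= 3 * M / d + K * d / 2.
Proof.
move=> d0 sf fM lK; rewrite ler_norml; apply/andP; split; last first.
  exact: (gradient_upper_bound i d0 sf).
rewrite lerNl; apply: (gradient_upper_bound i d0 (smooth2N sf)) => x cx.
  by rewrite normrN fM.
by rewrite sumrN normrN lK.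
Qed.

Lemma dot_ge0 x : 0 <= dot x x.
Proof. by apply: sumr_ge0 => i _; rewrite -expr2 sqr_ge0. Qed.

Lemma enorm_sqr x : enorm x ^+ 2 = \sum_i x 0 i ^+ 2.
Proof. by rewrite /enorm sqr_sqrtr ?dot_ge0//; apply: eq_bigr => i _; rewrite expr2. Qed.

Lemma enorm_ge0 x : 0 <= enorm x.
Proof. exact: sqrtr_ge0. Qed.

Lemma is_derive_sqr (t : R) : is_derive t 1 (fun s : R => s ^+ 2) (2 * t).
Proof.
apply: is_derive_ext (is_derive_quadratic 0 0 1 0 t) _ _.
  by move=> s; ring.
by ring.
Qed.

Lemma is_derive_lin (c t : R) : is_derive t 1 (fun s : R => c * s) c.
Proof.
apply: is_derive_ext (is_derive_quadratic 0 c 0 0 t) _ _.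
  by move=> s; ring.
by ring.
Qed.

(** The Euclidean norm is smooth away from the origin, with the usual derivatives. *)
Lemma smooth2_enorm :
  smooth2 [set x : E3 | 0 < enorm x] (@enorm R) (fun i x => x 0 i / enorm x)
    (fun i x => (enorm x)^-1 - x 0 i ^+ 2 / enorm x ^+ 3).
Proof.
have S := @smooth2_sum_coord [set x : E3 | 0 < enorm x] (fun _ s => s ^+ 2)
  (fun _ s => 2 * s) (fun _ _ => 2) (fun _ => is_derive_sqr)
  (fun _ => is_derive_lin 2) (fun _ => @cst_continuous R R 2).
have := @smooth2_comp _ Num.sqrt (fun s => (2 * Num.sqrt s)^-1)
  (fun s => - (4 * Num.sqrt s ^+ 3)^-1) _ _ _ S.
have E x : Num.sqrt (\sum_j x 0 j ^+ 2) = enorm x.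
  by rewrite -enorm_sqr sqrtr_sqr ger0_norm ?enorm_ge0.
move=> H; apply: smooth2_ext (H _) _ _ _.
- move=> x /= x0; have s0 : 0 < \sum_j x 0 j ^+ 2 by rewrite -enorm_sqr exprn_gt0.
  have r0 : Num.sqrt (\sum_j x 0 j ^+ 2) != 0 by rewrite E gt_eqF.
  have D1 := is_derive1_sqrt s0.
  split => //.
    apply: cvgN; apply: cvgV; first by rewrite mulf_neq0// expf_neq0.
    apply: cvgM; first exact: cvg_cst.
    have c := @sqrt_continuous R (\sum_j x 0 j ^+ 2).
    by apply: (@continuous_comp _ _ _ Num.sqrt (fun s : R => s ^+ 3)); [exact: c | exact: exprn_continuous].
  have D : is_derive (\sum_j x 0 j ^+ 2) 1 (2 *: (Num.sqrt : R -> R))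
      (2 *: (2 * Num.sqrt (\sum_j x 0 j ^+ 2))^-1).
    exact: is_deriveZ.
  have N : (2 *: (Num.sqrt : R -> R)) (\sum_j x 0 j ^+ 2) != 0.
    by rewrite /GRing.scale/= mulf_neq0.
  apply: is_derive_ext (is_deriveV N D) _ _ => //.
  set r := Num.sqrt _ in r0 *.
  change (- (2 * r) ^- 2 * (2 * (2 * r)^-1) = - (4 * r ^+ 3)^-1).
  by field.
- exact: E.
- by move=> i x; rewrite E invfM; set r := (enorm x)^-1; field.
- move=> i x; rewrite E exprMn !invfM; set r := (enorm x)^-1.
  by field.
Qed.

End Smooth2.

(** * Integration of a divergence over a cube by Riemann sums *)

Section GridSums.
Variable R : realType.
Local Notation E3 := 'rV[R]_3.
Implicit Types (x v : E3) (t : R) (U : set E3).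

(** One-dimensional Riemann sum of a derivative: if [W] vanishes at both ends of
    a segment of length [2 L], the sum of its derivative over [N] equally spaced
    points telescopes, up to the modulus of continuity of the derivative. *)
Lemma line_sum (W D : E3 -> R) (x0 y : E3) (i : 'I_3) (L eps del : R) (N : nat) :
  (0 < N)%N -> 0 < L -> 2 * L / N%:R < del ->
  cube x0 L y -> y 0 i = x0 0 i ->
  (forall x, cube x0 L x -> is_derive x (e_ i) W (D x)) ->
  (forall x x', cube x0 L x -> `|x - x'| < del -> `|D x - D x'| < eps) ->
  W (y + (- L) *: e_ i) = 0 -> W (y + L *: e_ i) = 0 ->
  \sum_(a < N) D (y + (- L + 2 * L / N%:R * a%:R) *: e_ i) <= N%:R * eps.
Proof.
move=> N0 L0 ldel Cy yi dW uD W0 W1.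
have N0' : 0 < N%:R :> R by rewrite ltr0n.
set l := 2 * L / N%:R in ldel *.
have l0 : 0 < l by rewrite divr_gt0// mulr_gt0.
have lN : l * N%:R = 2 * L by rewrite divfK ?gt_eqF.
pose s (a : nat) : R := - L + l * a%:R.
have inC r : `|r| <= L -> cube x0 L (y + r *: e_ i).
  move=> rL j; rewrite coordE; have := Cy j.
  by case: eqP => [->|_]; rewrite ?mulr1 ?mulr0 ?addr0// yi addrAC subrr add0r.
have sL (a : nat) : (a <= N)%N -> `|s a| <= L.
  move=> aN; rewrite ler_norml /s lerDl mulr_ge0 ?(ltW l0)//=.
  have : l * a%:R <= l * N%:R by rewrite ler_wpM2l ?ler_nat// ltW.
  by rewrite lN; lra.
have step (a : 'I_N) : l * (D (y + s a *: e_ i) - eps) <= W (y + s a.+1 *: e_ i) - W (y + s a *: e_ i).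
  have sS : s a.+1 - s a = l by rewrite /s -natr1; ring.
  have [||c /andP[c1 c2] ->] := @MVT_dir R W D y (e_ i) (s a) (s a.+1).
  - by rewrite -subr_ge0 sS ltW.
  - move=> r /andP[r1 r2]; apply: dW; apply: inC.
    have := sL a (ltnW (ltn_ord a)); have := sL a.+1 (ltn_ord a).
    by rewrite !ler_norml => /andP[h1 h2] /andP[h3 h4]; apply/andP; split; lra.
  rewrite sS mulrC ler_wpM2r ?(ltW l0)//.
  have : `|D (y + s a *: e_ i) - D (y + c *: e_ i)| < eps.
    apply: uD; first by apply: inC; apply: sL; rewrite ltnW.
    rewrite opprD addrACA subrr add0r -scalerBl normrZ.
    apply: le_lt_trans ldel; rewrite -[leRHS]mulr1 ler_pM//.
      rewrite ler_norml; apply/andP; split; last lra.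
      by rewrite -sS; lra.
    apply: norm_rV_le => // j; rewrite !mxE eqxx andTb.
    by case: eqP; rewrite ?normr1 ?normr0.
  rewrite ltr_norml => /andP[_]; lra.
have : \sum_(a < N) l * (D (y + s a *: e_ i) - eps) <= 0.
  apply: le_trans (_ : \sum_(a < N) (W (y + s a.+1 *: e_ i) - W (y + s a *: e_ i)) <= _).
    by apply: ler_sum => a _; exact: step.
  rewrite -(big_mkord xpredT (fun a => W (y + s a.+1 *: e_ i) - W (y + s a *: e_ i))).
  rewrite telescope_sumr// /s mulr0 addr0 W0 lN.
  by rewrite (_ : - L + 2 * L = L) ?W1 ?subrr//; ring.
rewrite -mulr_sumr pmulr_rle0// sumrB subr_le0 sumr_const card_ord.
by rewrite mulr_natl.
Qed.

(** The point at displacement [(u, v, w)] from [x0]; with [u], [v], [w] running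
    over equally spaced values these are the nodes of a cubic grid. *)
Definition grid_point (x0 : E3) (u v w : R) : E3 :=
  x0 + u *: e_ (0 : 'I_3) + v *: e_ (1 : 'I_3) + w *: e_ (2%:R : 'I_3).

Lemma grid_point_coord x0 (u v w : R) (j : 'I_3) :
  grid_point x0 u v w 0 j = x0 0 j + nth 0 [:: u; v; w] j.
Proof.
rewrite /grid_point !coordE; case: j => -[|[|[|//]]] h /=; rewrite /eq_op/= ?mulr1 ?mulr0 ?addr0//.
Qed.

Lemma cube_grid_point x0 (L u v w : R) : `|u| <= L -> `|v| <= L -> `|w| <= L ->
  cube x0 L (grid_point x0 u v w).
Proof.
by move=> hu hv hw j; rewrite grid_point_coord addrAC subrr add0r; case: j => -[|[|[|//]]].
Qed.

(** Of the [2 q K] nodes on an edge, [2 K] lie in the central part which is [q]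
    times shorter. *)
Lemma sum_middle (q K : nat) (c : nat -> R) : (0 < q)%N ->
  (forall a, 0 <= c a) ->
  (forall a, (q * K - K <= a < q * K + K)%N -> 1 <= c a) ->
  (2 * K)%:R <= \sum_(a < 2 * q * K) c a.
Proof.
move=> q0 c0 c1; rewrite -(big_mkord xpredT c).
rewrite (@big_cat_nat _ _ _ (q * K - K)%N)//=; last by nia.
rewrite (@big_cat_nat _ _ _ (q * K + K)%N (q * K - K)%N)//=; [|nia|nia].
have h1 : 0 <= \sum_(0 <= a < q * K - K) c a by apply: sumr_ge0.
have h2 : 0 <= \sum_(q * K + K <= a < 2 * q * K) c a by apply: sumr_ge0.
have h3 : (2 * K)%:R <= \sum_(q * K - K <= a < q * K + K) c a.
  apply: le_trans (_ : \sum_(q * K - K <= a < q * K + K) 1 <= _).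
    rewrite sumr_const_nat (_ : (q * K + K - (q * K - K) = 2 * K)%N)//; nia.
  by rewrite big_nat [leRHS]big_nat; apply: ler_sum => a /c1.
lra.
Qed.

End GridSums.

Section BoxAverage.
Lemma le_of_eq d (T : porderType d) (x y : T) : x = y -> (x <= y)%O.
Proof. by move=> ->. Qed.

Variable R : realType.
Local Notation E3 := 'rV[R]_3.
Implicit Types (x v : E3) (t : R) (U : set E3).

(** If [Phi] is bounded by a constant [c] plus the divergence of a field whose
    normal components vanish on the faces of a cube, then the mean of [Phi] over
    the cube is at most [c]. The mean is replaced by its lower bound coming from
    the concentric cube [q] times smaller, where [Phi >= h]. Finite grids replace
    the integral: no Fubini theorem is needed to sum each [D i] along its own
    axis first. *)
Lemma box_average (Phi : E3 -> R) (W D : 'I_3 -> E3 -> R) (x0 : E3) (L c h : R)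
    (q : nat) : (0 < q)%N -> 0 < L -> 0 <= h ->
  (forall i x, cube x0 L x -> is_derive x (e_ i) (W i) (D i x)) ->
  (forall i x, cube x0 L x -> {for x, continuous (D i)}) ->
  (forall i x, cube x0 L x -> `|x 0 i - x0 0 i| = L -> W i x = 0) ->
  (forall x, cube x0 L x -> 0 <= Phi x) ->
  (forall x, cube x0 (L / q%:R) x -> h <= Phi x) ->
  (forall x, cube x0 L x -> Phi x <= \sum_i D i x + c) ->
  h / q%:R ^+ 3 <= c.
Proof.
move=> q0 L0 h0 dW cD bW P0 Ph PD.
have q0' : 0 < q%:R :> R by rewrite ltr0n.
apply/ler_addgt0Pr => e e0.
have e3 : 0 < e / 3 by rewrite divr_gt0.
have /(_ _)/cid2 H i := uniform_continuity (@compact_cube R x0 L) (cD i) e3.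
pose del := Num.min (s2val (H 0)) (Num.min (s2val (H 1)) (s2val (H 2%:R))).
have del0 : 0 < del.
  by rewrite !lt_min; do ?(apply/andP; split); exact: (s2valP (H _)).
have uD i x x' : cube x0 L x -> `|x - x'| < del -> `|D i x - D i x'| < e / 3.
  move=> Cx xx; apply: (s2valP' (H i)) => //; apply: lt_le_trans xx _.
  case: i => -[|[|[|//]]] hi; rewrite /del.
  - by rewrite (_ : Ordinal hi = 0) ?ge_min ?lexx//; exact: val_inj.
  - by rewrite (_ : Ordinal hi = 1) ?ge_min ?lexx ?orbT//; exact: val_inj.
  - by rewrite (_ : Ordinal hi = 2%:R) ?ge_min ?lexx ?orbT//; exact: val_inj.
have [K K0 HK] : exists2 K : nat, (0 < K)%N & L / del < K%:R.
  by exists (Num.truncn (L / del)).+1 => //; exact: truncnS_gt.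
pose N := (2 * q * K)%N.
have N0 : (0 < N)%N by rewrite /N; nia.
have N0' : 0 < N%:R :> R by rewrite ltr0n.
have K0' : 0 < K%:R :> R by rewrite ltr0n.
have ldel : 2 * L / N%:R < del.
  rewrite /N !natrM ltr_pdivrMr ?mulr_gt0// mulrA mulrCA -mulrA ltr_pM2l//.
  move: HK; rewrite ltr_pdivrMr// => h1; apply: lt_le_trans h1 _.
  by rewrite mulrC -mulrA ler_pM2l// ler_peMl ?ler1n// ltW.
pose s (a : nat) : R := - L + 2 * L / N%:R * a%:R.
have sL (a : nat) : (a <= N)%N -> `|s a| <= L.
  move=> aN; rewrite ler_norml /s lerDl mulr_ge0 ?divr_ge0 ?mulr_ge0 ?(ltW L0) ?(ltW N0')//=.
  have : 2 * L / N%:R * a%:R <= 2 * L / N%:R * N%:R.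
    by rewrite ler_wpM2l ?ler_nat// divr_ge0 ?mulr_ge0 ?ltW.
  by rewrite divfK ?gt_eqF//; lra.
have sm (a : nat) : (q * K - K <= a <= q * K + K)%N -> `|s a| <= L / q%:R.
  move=> /andP[a1 a2].
  have -> : s a = L / (q%:R * K%:R) * (a%:R - q%:R * K%:R).
    by rewrite /s /N !natrM; field; rewrite !gt_eqF.
  rewrite normrM ger0_norm; last first.
    by rewrite divr_ge0 ?mulr_ge0 ?(ltW L0) ?(ltW q0') ?(ltW K0').
  apply: le_trans (_ : L / (q%:R * K%:R) * K%:R <= _).
    rewrite ler_wpM2l ?divr_ge0 ?mulr_ge0 ?(ltW L0) ?(ltW q0') ?(ltW K0')//.
    rewrite -natrM ler_distl -natrD ler_nat a2 andbT lerBlDr -natrD ler_nat.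
    by rewrite addnC -leq_subLR.
  by apply: le_of_eq; field; rewrite !gt_eqF.
pose S := \sum_(a < N) \sum_(b < N) \sum_(d < N) Phi (grid_point x0 (s a) (s b) (s d)).
have CC (a b d : 'I_N) : cube x0 L (grid_point x0 (s a) (s b) (s d)).
  by apply: cube_grid_point; apply: sL; apply: ltnW.
have z0 : `|0 : R| <= L by rewrite normr0 ltW.
have LL : `|L| <= L by rewrite gtr0_norm.
have nLL : `|- L| <= L by rewrite normrN gtr0_norm.
have up : S <= N%:R ^+ 3 * (c + e).
  have T0 (b d : 'I_N) : \sum_(a < N) D 0 (grid_point x0 (s a) (s b) (s d)) <= N%:R * (e / 3).
    have := @line_sum R (W 0) (D 0) x0 (grid_point x0 0 (s b) (s d)) 0 L (e / 3) del N N0 L0 ldel.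
    have E r : grid_point x0 0 (s b) (s d) + r *: e_ (0 : 'I_3) = grid_point x0 r (s b) (s d).
      by rewrite /grid_point scale0r addr0 addrAC (addrAC x0).
    rewrite !E (eq_bigr _ (fun (a : 'I_N) _ => congr1 (D 0) (E (s a)))); apply.
    - by apply: cube_grid_point => //; apply: sL; apply: ltnW.
    - by rewrite grid_point_coord addr0.
    - exact: uD.
    - apply: bW; first by apply: cube_grid_point => //; apply: sL; apply: ltnW.
      by rewrite grid_point_coord addrAC subrr add0r normrN gtr0_norm.
    - apply: bW; first by apply: cube_grid_point => //; apply: sL; apply: ltnW.
      by rewrite grid_point_coord addrAC subrr add0r gtr0_norm.
  have T1 (a d : 'I_N) : \sum_(b < N) D 1 (grid_point x0 (s a) (s b) (s d)) <= N%:R * (e / 3).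
    have := @line_sum R (W 1) (D 1) x0 (grid_point x0 (s a) 0 (s d)) 1 L (e / 3) del N N0 L0 ldel.
    have E r : grid_point x0 (s a) 0 (s d) + r *: e_ (1 : 'I_3) = grid_point x0 (s a) r (s d).
      by rewrite /grid_point scale0r addr0 addrAC.
    rewrite !E (eq_bigr _ (fun (b : 'I_N) _ => congr1 (D 1) (E (s b)))); apply.
    - by apply: cube_grid_point => //; apply: sL; apply: ltnW.
    - by rewrite grid_point_coord addr0.
    - exact: uD.
    - apply: bW; first by apply: cube_grid_point => //; apply: sL; apply: ltnW.
      by rewrite grid_point_coord addrAC subrr add0r normrN gtr0_norm.
    - apply: bW; first by apply: cube_grid_point => //; apply: sL; apply: ltnW.
      by rewrite grid_point_coord addrAC subrr add0r gtr0_norm.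
  have T2 (a b : 'I_N) : \sum_(d < N) D 2%:R (grid_point x0 (s a) (s b) (s d)) <= N%:R * (e / 3).
    have := @line_sum R (W 2%:R) (D 2%:R) x0 (grid_point x0 (s a) (s b) 0) 2%:R L (e / 3) del N N0 L0 ldel.
    have E r : grid_point x0 (s a) (s b) 0 + r *: e_ (2%:R : 'I_3) = grid_point x0 (s a) (s b) r.
      by rewrite /grid_point scale0r addr0.
    rewrite !E (eq_bigr _ (fun (d : 'I_N) _ => congr1 (D 2%:R) (E (s d)))); apply.
    - by apply: cube_grid_point => //; apply: sL; apply: ltnW.
    - by rewrite grid_point_coord addr0.
    - exact: uD.
    - apply: bW; first by apply: cube_grid_point => //; apply: sL; apply: ltnW.
      by rewrite grid_point_coord addrAC subrr add0r normrN gtr0_norm.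
    - apply: bW; first by apply: cube_grid_point => //; apply: sL; apply: ltnW.
      by rewrite grid_point_coord addrAC subrr add0r gtr0_norm.
  have sumc (r : R) : \sum_(a < N) r = N%:R * r by rewrite sumr_const card_ord mulr_natl.
  apply: le_trans (_ : \sum_(a < N) \sum_(b < N) \sum_(d < N)
     (D 0 (grid_point x0 (s a) (s b) (s d)) + D 1 (grid_point x0 (s a) (s b) (s d)) +
      D 2%:R (grid_point x0 (s a) (s b) (s d)) + c) <= _).
    apply: ler_sum => a _; apply: ler_sum => b _; apply: ler_sum => d _.
    apply: le_trans (PD _ (CC a b d)) _; rewrite lerD2r !big_ord_recl big_ord0 addr0.
    rewrite addrA; apply: le_of_eq; congr (D _ _ + D _ _ + D _ _); exact: val_inj.
  have -> : \sum_(a < N) \sum_(b < N) \sum_(d < N)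
     (D 0 (grid_point x0 (s a) (s b) (s d)) + D 1 (grid_point x0 (s a) (s b) (s d)) +
      D 2%:R (grid_point x0 (s a) (s b) (s d)) + c) =
     \sum_(b < N) \sum_(d < N) \sum_(a < N) D 0 (grid_point x0 (s a) (s b) (s d)) +
     \sum_(a < N) \sum_(d < N) \sum_(b < N) D 1 (grid_point x0 (s a) (s b) (s d)) +
     \sum_(a < N) \sum_(b < N) \sum_(d < N) D 2%:R (grid_point x0 (s a) (s b) (s d)) +
     N%:R ^+ 3 * c.
    under eq_bigr do under eq_bigr do rewrite !big_split/= sumc.
    under eq_bigr do rewrite !big_split/= sumc.
    rewrite !big_split/= sumc.
    congr (_ + _ + _ + _).
    - by rewrite exchange_big/=; apply: eq_bigr => b _; rewrite exchange_big.
    - by apply: eq_bigr => b _; rewrite exchange_big.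
    - by ring.
  have T F : (forall b d : 'I_N, F b d <= N%:R * (e / 3)) ->
      \sum_(b < N) \sum_(d < N) F b d <= N%:R ^+ 3 * (e / 3).
    move=> HF; apply: le_trans (_ : \sum_(b < N) \sum_(d < N) N%:R * (e / 3) <= _).
      by apply: ler_sum => b _; apply: ler_sum => d _; exact: HF.
    by rewrite !sumc; apply: le_of_eq; ring.
  have := T _ T0; have := T _ T1; have := T _ T2; lra.
have low : h * (2 * K)%:R ^+ 3 <= S.
  pose chi (a : nat) : R := (q * K - K <= a < q * K + K)%N%:R.
  have chi0 a : 0 <= chi a by rewrite ler0n.
  have HX : (2 * K)%:R <= \sum_(a < N) chi a.
    by apply: sum_middle => // a Ha; rewrite /chi Ha.
  apply: le_trans (_ : \sum_(a < N) \sum_(b < N) \sum_(d < N) h * (chi a * chi b * chi d) <= _).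
    have -> : \sum_(a < N) \sum_(b < N) \sum_(d < N) h * (chi a * chi b * chi d) =
      h * (\sum_(a < N) chi a) ^+ 3.
      rewrite exprS expr2 mulr_suml mulr_sumr; apply: eq_bigr => a _.
      rewrite mulr_suml !mulr_sumr; apply: eq_bigr => b _.
      by rewrite !mulr_sumr; apply: eq_bigr => d _; ring.
    by rewrite ler_wpM2l// lerXn2r// ?nnegrE// sumr_ge0.
  apply: ler_sum => a _; apply: ler_sum => b _; apply: ler_sum => d _.
  have := P0 _ (CC a b d); rewrite /chi.
  have [ha|] := boolP (_ <= a < _)%N; last by rewrite !(mul0r, mulr0).
  have [hb|] := boolP (_ <= b < _)%N; last by rewrite !(mul0r, mulr0).
  have [hd|] := boolP (_ <= d < _)%N; last by rewrite !(mul0r, mulr0).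
  rewrite !mulr1 => _; apply: Ph; apply: cube_grid_point; apply: sm.
  - by case/andP: ha => -> /ltnW.
  - by case/andP: hb => -> /ltnW.
  - by case/andP: hd => -> /ltnW.
have := le_trans low up.
have -> : N%:R ^+ 3 = q%:R ^+ 3 * (2 * K)%:R ^+ 3 :> R.
  by rewrite -exprMn -natrM /N mulnA (mulnC q 2).
have K3 : 0 < (2 * K)%:R ^+ 3 :> R by rewrite natrM exprn_gt0// mulr_gt0.
rewrite mulrAC ler_pM2r// => H1.
by rewrite ler_pdivrMr ?exprn_gt0// mulrC.
Qed.
End BoxAverage.

(** * The energy estimate *)

Section Energy.
Variable R : realType.
Local Notation E3 := 'rV[R]_3.
Implicit Types (x v : E3) (t : R) (U : set E3).

Lemma ord3P (i : 'I_3) : [\/ i = 0, i = 1 | i = 2%:R].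
Proof.
by case: i => -[|[|[|//]]] hi; [apply: Or31|apply: Or32|apply: Or33]; exact: val_inj.
Qed.

Lemma smooth2_coordfun U (m : 'I_3) (p p1 p2 : R -> R) :
  (forall t, is_derive t 1 p (p1 t)) -> (forall t, is_derive t 1 p1 (p2 t)) ->
  continuous p2 ->
  smooth2 U (fun x : E3 => p (x 0 m)) (fun i x => (m == i)%:R * p1 (x 0 m))
    (fun i x => (m == i)%:R * p2 (x 0 m)).
Proof.
move=> dp dp1 cp2 x _.
have cp : continuous p.
  by move=> t; case: (dp t) => /derivable1_diffP/differentiable_continuous.
have cp1 : continuous p1.
  by move=> t; case: (dp1 t) => /derivable1_diffP/differentiable_continuous.
split; first by apply: cont_comp; [exact: coord_continuous | exact: cp].
move=> i; split.
- apply: contM; first exact: cont_cst.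
  by apply: cont_comp; [exact: coord_continuous | exact: cp1].
- apply: contM; first exact: cont_cst.
  by apply: cont_comp; [exact: coord_continuous | exact: cp2].
- exact: is_derive_coordfun.
- have := is_deriveZ ((m == i)%:R) (is_derive_coordfun i (dp1 (x 0 m))).
  by rewrite -[_ *: _]/(_ * _) mulrA -natrM mulnb andbb.
Qed.

(** A nonnegative cutoff vanishing on the faces of a cube. *)
Lemma cutoff (x0 : E3) (L : R) : 0 < L ->
  exists z z1 z2, [/\ smooth2 setT z z1 z2,
    forall x, cube x0 L x -> 0 <= z x <= 1,
    forall x i, cube x0 L x -> `|z1 i x| <= 2 / L,
    forall x i, `|x 0 i - x0 0 i| = L -> z x = 0 &
    forall x, cube x0 (L / 4) x -> 3 / 4 <= z x].
Proof.
move=> L0; have L2 : 0 < L ^+ 2 by rewrite exprn_gt0.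
pose Z (m : 'I_3) (t : R) := 1 - ((t - x0 0 m) / L) ^+ 2.
pose Z1 (m : 'I_3) (t : R) := - (2 * (t - x0 0 m) / L ^+ 2).
pose Z2 (t : R) : R := - (2 / L ^+ 2).
have dZ m t : is_derive t 1 (Z m) (Z1 m t).
  apply: is_derive_ext (is_derive_quadratic 1 0 (- L ^- 2) (x0 0 m) t) _ _.
    by move=> s; rewrite /Z; field; rewrite gt_eqF.
  by rewrite /Z1; field; rewrite gt_eqF.
have dZ1 m t : is_derive t 1 (Z1 m) (Z2 t).
  apply: is_derive_ext (is_derive_quadratic 0 (- (2 / L ^+ 2)) 0 (x0 0 m) t) _ _.
    by move=> s; rewrite /Z1; field; rewrite gt_eqF.
  by rewrite /Z2; field; rewrite gt_eqF.
have S m := @smooth2_coordfun setT m _ _ _ (dZ m) (dZ1 m) (@cst_continuous R R _).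
have SZ := smooth2M (smooth2M (S 0) (S 1)) (S 2%:R).
exists (fun x : E3 => Z 0 (x 0 0) * Z 1 (x 0 1) * Z 2%:R (x 0 2%:R)).
eexists; eexists; split; first exact: SZ.
- have Z01 m x : cube x0 L x -> 0 <= Z m (x 0 m) <= 1.
    move=> /(_ m) h; have : `|(x 0 m - x0 0 m) / L| <= 1.
      by rewrite normrM normfV (gtr0_norm L0) ler_pdivrMr// mul1r.
    rewrite /Z lerBlDr lerDl sqr_ge0 andbT subr_ge0 => h1.
    by rewrite -real_normK ?num_real// expr_le1.
  move=> x Cx; have /andP[a1 a2] := Z01 0 _ Cx; have /andP[b1 b2] := Z01 1 _ Cx.
  have /andP[c1 c2] := Z01 2%:R _ Cx.
  by rewrite !mulr_ge0//= !mulr_ile1// mulr_ge0.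
- move=> x i Cx.
  have Z01 m : `|Z m (x 0 m)| <= 1.
    have : `|(x 0 m - x0 0 m) / L| <= 1.
      by rewrite normrM normfV (gtr0_norm L0) ler_pdivrMr// mul1r; exact: Cx.
    move=> h1; rewrite ger0_norm /Z ?lerBlDr ?lerDl ?sqr_ge0// subr_ge0.
    by rewrite -real_normK ?num_real// expr_le1.
  have ZZ m : `|Z1 m (x 0 m)| <= 2 / L.
    rewrite /Z1 normrN !normrM (gtr0_norm (_ : 0 < 2 :> R))// normfV (gtr0_norm L2).
    have := Cx m => h; rewrite ler_pdivrMr//.
    have -> : 2 / L * L ^+ 2 = 2 * L by field; rewrite gt_eqF.
    by rewrite ler_pM2l.
  have L20 : 0 <= 2 / L by rewrite divr_ge0// ltW.
  have [F01 F02 F12] : [/\ (0 == 1 :> 'I_3) = false, (0 == 2%:R :> 'I_3) = false & (1 == 2%:R :> 'I_3) = false] by [].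
  case: (ord3P i) => ->; rewrite ?eqxx ?(eq_sym 1 0) ?(eq_sym 2%:R 0) ?(eq_sym 2%:R 1) ?F01 ?F02 ?F12
    !(mul1r, mul0r, mulr0, addr0, add0r) !normrM.
  + by rewrite -[leRHS]mulr1 ler_pM// -[leRHS]mulr1 ler_pM.
  + by rewrite -[leRHS]mulr1 ler_pM// -[leRHS]mul1r ler_pM.
  + by rewrite -[leRHS]mul1r ler_pM// mulr_ile1.
- move=> x i xi; have : Z i (x 0 i) = 0.
    rewrite /Z -real_normK ?num_real// normrM normfV (gtr0_norm L0) xi.
    by rewrite divff ?gt_eqF// expr1n subrr.
  by case: (ord3P i) => -> ->; rewrite !(mul0r, mulr0).
- move=> x Cx; have ZZ m : 15 / 16 <= Z m (x 0 m) <= 1.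
    rewrite /Z lerBlDr lerDl sqr_ge0 andbT lerBrDr -lerBrDl.
    rewrite -real_normK ?num_real// normrM normfV (gtr0_norm L0).
    have : `|x 0 m - x0 0 m| / L <= 1 / 4.
      by rewrite ler_pdivrMr//; have := Cx m; lra.
    have : 0 <= `|x 0 m - x0 0 m| / L by rewrite divr_ge0// ltW.
    by move: (`|_| / L) => r; nra.
  have /andP[a1 a2] := ZZ 0; have /andP[b1 b2] := ZZ 1; have /andP[c1 c2] := ZZ 2%:R.
  move: (Z 0 _) (Z 1 _) (Z 2%:R _) a1 a2 b1 b2 c1 c2 => a b c *.
  have : 15 / 16 * (15 / 16) <= a * b by rewrite ler_pM; lra.
  move: (a * b) => ab hab; have : 15 / 16 * (15 / 16) * (15 / 16) <= ab * c by rewrite ler_pM; lra.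
  lra.
Qed.

Lemma energy_combination (u1 u2 u3 u4 u5 u6 u7 u8 u9 : R) : 0 <= u1 -> u2 <= u3 ->
  u4 <= u5 -> 2 * u6 <= u7 -> u3 <= u6 + u4 -> - u9 <= u8 ->
  u6 <= u1 - u2 + (u7 + u8) + (u5 + u9).
Proof. by lra. Qed.

(** Quantitative Liouville property of the system [lap A = 2 kap B + F1],
    [lap B = - 2 kap A + F2], that is of a complex equation whose zero-order
    coefficient is purely imaginary. With [z] the cutoff of the cube, the field
    [W i = z^4 ((A + B) A_i - (A - B) B_i)] satisfies
    [div W >= 2 kap z^4 |F|^2 - (terms in grad z and F1, F2)], because the squares
    of the gradients of [A] and [B] absorb the cross terms. As [div W] has mean
    zero, [|F|^2 = A^2 + B^2] is small in mean when [k0 L^2] is large and [eta]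
    small. *)
Lemma energy_estimate (A B : E3 -> R) (A1 A2 B1 B2 : 'I_3 -> E3 -> R)
    (kap F1 F2 : E3 -> R) (x0 : E3) (L k0 eta M m : R) (q : nat) :
  0 < L -> 0 < k0 -> 0 <= M -> 0 <= eta -> (4 <= q)%N ->
  smooth2 (cube x0 L) A A1 A2 -> smooth2 (cube x0 L) B B1 B2 ->
  (forall x, cube x0 L x -> \sum_i A2 i x = 2 * kap x * B x + F1 x) ->
  (forall x, cube x0 L x -> \sum_i B2 i x = - (2 * kap x * A x) + F2 x) ->
  (forall x, cube x0 L x -> k0 <= kap x) ->
  (forall x, cube x0 L x -> `|F1 x| <= eta * k0 /\ `|F2 x| <= eta * k0) ->
  (forall x, cube x0 L x -> A x ^+ 2 + B x ^+ 2 <= M ^+ 2) ->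
  (forall x, cube x0 (L / q%:R) x -> m ^+ 2 <= A x ^+ 2 + B x ^+ 2) ->
  m ^+ 2 / 4 / q%:R ^+ 3 <= 2304 * M ^+ 2 / (k0 * L ^+ 2) ^+ 2 + 4 * M * eta.
Proof.
move=> L0 k00 M0 eta0 q4 sA sB eA eB kk FF AM mA.
have [z [z1 [z2 [sz z01 zd zb zc]]]] := cutoff x0 L0.
have q0 : (0 < q)%N by apply: leq_trans q4.
have q0' : 0 < q%:R :> R by rewrite ltr0n.
have sQ := smooth2M (smooth2M sz sz) (smooth2M sz sz).
set Q := (fun x => z x * z x * (z x * z x)) in sQ.
set Q1 := (fun i x => _ + z x * z x * _) in sQ.
have Q1E i x : Q1 i x = 4 * z x ^+ 3 * z1 i x by rewrite /Q1; ring.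
have QE x : Q x = z x ^+ 4 by rewrite /Q; ring.
pose X i x := (A x + B x) * A1 i x - (A x - B x) * B1 i x.
pose X1 i x := (A1 i x + B1 i x) * A1 i x + (A x + B x) * A2 i x
   - ((A1 i x - B1 i x) * B1 i x + (A x - B x) * B2 i x).
pose W i x := Q x * X i x.
pose D i x := Q1 i x * X i x + Q x * X1 i x.
have Lq : cube x0 (L / q%:R) `<=` cube x0 (L / 4).
  move=> x Cx i; apply: le_trans (Cx i) _.
  by rewrite ler_pM2l// lef_pV2 ?posrE// ler_nat.
have Lq' : cube x0 (L / q%:R) `<=` cube x0 L.
  move=> x Cx i; apply: le_trans (Cx i) _.
  by rewrite ler_pdivrMr// ler_peMr ?ler1n// ltW.
have := @box_average R (fun x => k0 * (Q x * (A x ^+ 2 + B x ^+ 2))) W D x0 L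
  (2304 * M ^+ 2 / (L ^+ 4 * k0) + 4 * M * eta * k0) (k0 * (m ^+ 2 / 4)) q.
have F0 x : 0 <= A x ^+ 2 + B x ^+ 2 by rewrite addr_ge0// sqr_ge0.
move=> H; have {}H : k0 * (m ^+ 2 / 4) / q%:R ^+ 3 <= 2304 * M ^+ 2 / (L ^+ 4 * k0) + 4 * M * eta * k0.
  apply: H => //.
  - by rewrite mulr_ge0 ?divr_ge0 ?sqr_ge0// ltW.
  - move=> i x Cx; have [_ /(_ i)[_ _ dA dA1]] := sA _ Cx.
    have [_ /(_ i)[_ _ dB dB1]] := sB _ Cx.
    have [_ /(_ i)[_ _ dQ _]] := sQ x I.
    have dX : is_derive x (e_ i) (X i) (X1 i x).
      apply: is_derive_ext (is_deriveB (is_deriveM (is_deriveD dA dB) dA1)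
        (is_deriveM (is_deriveB dA dB) dB1)) _ _ => //.
      rewrite -![_ *: _]/(_ * _) /X1.
      change ((A x + B x) * A2 i x + A1 i x * (A1 i x + B1 i x) -
        ((A x - B x) * B2 i x + B1 i x * (A1 i x - B1 i x)) =
        (A1 i x + B1 i x) * A1 i x + (A x + B x) * A2 i x
        - ((A1 i x - B1 i x) * B1 i x + (A x - B x) * B2 i x)); ring.
    apply: is_derive_ext (is_deriveM dQ dX) _ _ => //.
    by change (Q x * X1 i x + X i x * Q1 i x = D i x); rewrite /D; ring.
  - move=> i x Cx; have [cA /(_ i)[cA1 cA2 _ _]] := sA _ Cx.
    have [cB /(_ i)[cB1 cB2 _ _]] := sB _ Cx.
    have [cQ /(_ i)[cQ1 _ _ _]] := sQ x I.
    rewrite /D /X /X1.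
    apply: contD.
      apply: (contM cQ1); apply: contB; first exact: contM (contD cA cB) cA1.
      exact: contM (contB cA cB) cB1.
    apply: (contM cQ); apply: contB.
      exact: contD (contM (contD cA1 cB1) cA1) (contM (contD cA cB) cA2).
    exact: contD (contM (contB cA1 cB1) cB1) (contM (contB cA cB) cB2).
  - by move=> i x Cx /zb zx; rewrite /W /Q zx !mul0r.
  - move=> x Cx; rewrite mulr_ge0 ?(ltW k00)// mulr_ge0// QE.
    by rewrite exprn_ge0//; case/andP: (z01 _ Cx).
  - move=> x Cx; rewrite ler_pM2l// QE.
    have zx := zc _ (Lq _ Cx).
    have : 1 / 4 <= z x ^+ 4.
      apply: le_trans (_ : (3 / 4) ^+ 4 <= _); first by lra.
      by rewrite lerXn2r// nnegrE; lra.
    have := mA _ Cx; have := sqr_ge0 m.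
    move: (m ^+ 2) (_ + _) (z x ^+ 4) => a b c a0 ab hc.
    by rewrite mulrC ler_pM//; lra.
  - move=> x Cx; have /andP[zx0 zx1] := z01 _ Cx.
    have Fx := AM _ Cx; have [n1 n2] := FF _ Cx.
    (* Completing the squares in the divergence of [W]. *)
    have sumD : \sum_i D i x = \sum_i ((z x ^+ 2 * A1 i x + 2 * z x * z1 i x * (A x + B x)) ^+ 2
        + (z x ^+ 2 * B1 i x - 2 * z x * z1 i x * (A x - B x)) ^+ 2)
        - 8 * z x ^+ 2 * (A x ^+ 2 + B x ^+ 2) * (\sum_i z1 i x ^+ 2)
        + z x ^+ 4 * ((A x + B x) * \sum_i A2 i x - (A x - B x) * \sum_i B2 i x).
      rewrite !mulr_sumr -!sumrB mulr_sumr -big_split/=; apply: eq_bigr => i _.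
      by rewrite /D QE Q1E /X /X1; ring.
    have sq0 : 0 <= \sum_i ((z x ^+ 2 * A1 i x + 2 * z x * z1 i x * (A x + B x)) ^+ 2
        + (z x ^+ 2 * B1 i x - 2 * z x * z1 i x * (A x - B x)) ^+ 2).
      by apply: sumr_ge0 => i _; rewrite addr_ge0// sqr_ge0.
    have sz1 : \sum_i z1 i x ^+ 2 <= 12 / L ^+ 2.
      apply: le_trans (_ : \sum_(i < 3) (2 / L) ^+ 2 <= _).
        apply: ler_sum => i _; rewrite -(real_normK (num_real (z1 i x))).
        by rewrite lerXn2r ?nnegrE ?divr_ge0 ?(ltW L0)// zd.
      by rewrite sumr_const card_ord; apply: le_of_eq; field; rewrite gt_eqF.
    rewrite sumD (eA _ Cx) (eB _ Cx) QE.
    have kx := kk _ Cx.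
    have absA : `|A x| <= M.
      by rewrite -ler_sqr ?nnegrE// real_normK ?num_real//; have := sqr_ge0 (B x); lra.
    have absB : `|B x| <= M.
      by rewrite -ler_sqr ?nnegrE// real_normK ?num_real//; have := sqr_ge0 (A x); lra.
    have ek0 : 0 <= eta * k0 by rewrite mulr_ge0// ltW.
    have err : - (4 * M * eta * k0) <= z x ^+ 4 * ((A x + B x) * F1 x - (A x - B x) * F2 x).
      have h1 : `|(A x + B x) * F1 x - (A x - B x) * F2 x| <= 4 * M * eta * k0.
        have h2 : `|(A x + B x) * F1 x| <= 2 * M * (eta * k0).
          by rewrite normrM ler_pM//; have := ler_normD (A x) (B x); lra.
        have h3 : `|(A x - B x) * F2 x| <= 2 * M * (eta * k0).
          by rewrite normrM ler_pM//; have := ler_normB (A x) (B x); lra.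
        by have := ler_normB ((A x + B x) * F1 x) ((A x - B x) * F2 x); lra.
      rewrite lerNl -mulrN; apply: le_trans (ler_norm _) _; rewrite normrM normrN.
      rewrite -[leRHS]mul1r ler_pM// normrX ger0_norm// exprn_ile1//.
    (* The cutoff error is absorbed by Young's inequality, at the cost of a
       constant; the power four of the cutoff makes this possible. *)
    have main : 96 / L ^+ 2 * z x ^+ 2 <= k0 * z x ^+ 4 + 2304 / (L ^+ 4 * k0).
      rewrite -subr_ge0 (_ : _ - _ = k0 * (z x ^+ 2 - 48 / (L ^+ 2 * k0)) ^+ 2).
        by rewrite mulr_ge0 ?sqr_ge0// ltW.
      by field; rewrite !gt_eqF.
    have main' := ler_wpM2r (F0 x) main.
    have t1 : 8 * z x ^+ 2 * (A x ^+ 2 + B x ^+ 2) * (\sum_i z1 i x ^+ 2) <=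
       96 / L ^+ 2 * z x ^+ 2 * (A x ^+ 2 + B x ^+ 2).
      have -> : 96 / L ^+ 2 * z x ^+ 2 * (A x ^+ 2 + B x ^+ 2) =
        8 * z x ^+ 2 * (A x ^+ 2 + B x ^+ 2) * (12 / L ^+ 2).
        by field; rewrite gt_eqF.
      by rewrite ler_wpM2l// mulr_ge0// mulr_ge0// sqr_ge0.
    have t2 : 2304 / (L ^+ 4 * k0) * (A x ^+ 2 + B x ^+ 2) <= 2304 * M ^+ 2 / (L ^+ 4 * k0).
      rewrite mulrAC ler_wpM2r ?invr_ge0 ?mulr_ge0 ?exprn_ge0 ?(ltW L0) ?(ltW k00)//.
      by apply: ler_wpM2l Fx; exact: ler0n.
    have t3 : 2 * k0 * (z x ^+ 4 * (A x ^+ 2 + B x ^+ 2)) <=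
       z x ^+ 4 * (2 * kap x * (A x ^+ 2 + B x ^+ 2)).
      rewrite mulrCA ler_wpM2l ?exprn_ge0// ler_wpM2r// ler_pM2l//.
    have -> : (A x + B x) * (2 * kap x * B x + F1 x) - (A x - B x) * (- (2 * kap x * A x) + F2 x)
      = 2 * kap x * (A x ^+ 2 + B x ^+ 2) + ((A x + B x) * F1 x - (A x - B x) * F2 x) by ring.
    have t3' : 2 * (k0 * (z x ^+ 4 * (A x ^+ 2 + B x ^+ 2))) <=
       z x ^+ 4 * (2 * kap x * (A x ^+ 2 + B x ^+ 2)) by rewrite mulrA.
    have main'' : 96 / L ^+ 2 * z x ^+ 2 * (A x ^+ 2 + B x ^+ 2) <=
       k0 * (z x ^+ 4 * (A x ^+ 2 + B x ^+ 2)) +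
       2304 / (L ^+ 4 * k0) * (A x ^+ 2 + B x ^+ 2) by rewrite mulrA -mulrDl.
    rewrite [z x ^+ 4 * (_ + (_ - _))]mulrDr.
    exact: (energy_combination sq0 t1 t2 t3' main'' err).
rewrite -(ler_pM2l k00).
have -> : k0 * (m ^+ 2 / 4 / q%:R ^+ 3) = k0 * (m ^+ 2 / 4) / q%:R ^+ 3.
  by rewrite !mulrA.
apply: le_trans H _; apply: le_of_eq; field.
by rewrite !gt_eqF.
Qed.

End Energy.

(** * Directional derivatives from continuous partial derivatives *)

Section DirectionalDerivatives.
Variable R : realType.
Local Notation E3 := 'rV[R]_3.
Implicit Types (x v : E3) (t : R) (U : set E3).

Lemma MVT_dir0 f f1 x v (b : R) :
  (forall s, `|s| <= `|b| -> is_derive (x + s *: v) v f (f1 (x + s *: v))) ->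
  exists2 c, `|c| <= `|b| & f (x + b *: v) - f x = f1 (x + c *: v) * b :> R.
Proof.
move=> D; have [b0|b0] := leP 0 b.
  have [s /andP[s0 sb]|c /andP[c0 cb]] := @MVT_dir R f f1 x v 0 b b0.
    by apply: D; rewrite !ger0_norm.
  rewrite scale0r addr0 subr0 => E; exists c => //.
  by rewrite !ger0_norm.
have [s /andP[s0 sb]|c /andP[c0 cb]] := @MVT_dir R f f1 x v b 0 (ltW b0).
  by apply: D; rewrite (ler0_norm (ltW b0)) ler0_norm// lerN2.
rewrite scale0r addr0 sub0r => E; exists c.
  by rewrite (ler0_norm (ltW b0)) ler0_norm// lerN2.
by rewrite -opprB E mulrN opprK.
Qed.

Lemma row3_decomposition v : v = v 0 0 *: e_ (0 : 'I_3) + v 0 1 *: e_ (1 : 'I_3) + v 0 2%:R *: e_ (2%:R : 'I_3) :> E3.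
Proof.
apply/rowP => j; rewrite !mxE !eqxx !andTb.
by case: (ord3P j) => ->; rewrite /eq_op/= ?(mulr1, mulr0, addr0, add0r).
Qed.

Lemma sum_ord3 (F : 'I_3 -> R) : \sum_i F i = F 0 + F 1 + F 2%:R.
Proof.
rewrite !big_ord_recl big_ord0 addr0 addrA.
by congr (F _ + F _ + F _); exact: val_inj.
Qed.

(** Continuous partial derivatives give all directional derivatives. *)
Lemma is_derive_C1 (f : E3 -> R) (f1 : 'I_3 -> E3 -> R) x v (d : R) : 0 < d ->
  (forall i y, `|y - x| < d -> is_derive y (e_ i) f (f1 i y)) ->
  (forall i, {for x, continuous (f1 i)}) ->
  is_derive x v f (\sum_i v 0 i * f1 i x).
Proof.
move=> d0 H cf.
suff C : h^-1 *: ((f \o shift x) (h *: v) - f x) @[h --> (0 : R)^'] -->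
    (\sum_i v 0 i * f1 i x : R).
  apply: DeriveDef; first by apply/cvg_ex; exists (\sum_i v 0 i * f1 i x).
  by apply/cvg_lim.
apply/cvgrPdist_lt => e e0.
pose V := `|v| + 1.
have V0 : 0 < V by rewrite ltr_wpDl.
have e3 : 0 < e / (3 * V) by rewrite divr_gt0// mulr_gt0.
have cd i : exists2 r : R, 0 < r & forall y, `|y - x| < r -> `|f1 i x - f1 i y| < e / (3 * V).
  have /cvgrPdist_lt/(_ _ e3)/nbhs_ballP[r /= r0 Hr] := cf i.
  by exists r => // y yx; apply: Hr; rewrite -ball_normE/= distrC.
have [r0 r00 H0] := cd 0; have [r1 r10 H1] := cd 1; have [r2 r20 H2] := cd 2%:R.
pose rr := Num.min d (Num.min r0 (Num.min r1 r2)).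
have rr0 : 0 < rr by rewrite !lt_min d0 r00 r10 r20.
rewrite near_withinE; apply/nbhs_ballP; exists (rr / (3 * V)) => /=.
  by rewrite divr_gt0// mulr_gt0.
move=> h; rewrite /ball/= sub0r normrN ltr_pdivlMr ?mulr_gt0// => hr h0.
have hV i : `|h * v 0 i| < rr / 3.
  rewrite normrM ltr_pdivlMr// -mulrA; apply: le_lt_trans hr.
  rewrite ler_wpM2l// mulrC ler_wpM2l//.
  by apply: le_trans (norm_coord_le v i) _; rewrite lerDl.
have ne (i : 'I_3) (s : R) : `|s *: e_ i : E3| <= `|s|.
  apply: norm_rV_le => // j; rewrite !mxE eqxx andTb normrM.
  by case: eqP => _; rewrite ?normr1 ?normr0 ?mulr1 ?mulr0.
pose y1 := x + (h * v 0 0) *: e_ (0 : 'I_3).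
pose y2 := y1 + (h * v 0 1) *: e_ (1 : 'I_3).
have near0 s : `|s| <= `|h * v 0 0| -> `|x + s *: e_ (0 : 'I_3) - x| < rr.
  move=> sh; rewrite addrAC subrr add0r; have := ne 0 s; have := hV 0.
  have := rr0; lra.
have near1 s : `|s| <= `|h * v 0 1| -> `|y1 + s *: e_ (1 : 'I_3) - x| < rr.
  move=> sh; rewrite /y1 -!addrA addrC !addrA subrK.
  have := ler_normD ((h * v 0 0) *: e_ (0 : 'I_3) : E3) (s *: e_ (1 : 'I_3)).
  have := ne 0 (h * v 0 0); have := hV 0; have := ne 1 s; have := hV 1.
  have := rr0; lra.
have near2 s : `|s| <= `|h * v 0 2%:R| -> `|y2 + s *: e_ (2%:R : 'I_3) - x| < rr.
  move=> sh; rewrite /y2 /y1 -!addrA addrC !addrA subrK.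
  have := ler_normD ((h * v 0 0) *: e_ (0 : 'I_3) + (h * v 0 1) *: e_ (1 : 'I_3) : E3) (s *: e_ (2%:R : 'I_3)).
  have := ler_normD ((h * v 0 0) *: e_ (0 : 'I_3) : E3) ((h * v 0 1) *: e_ (1 : 'I_3)).
  have := ne 0 (h * v 0 0); have := hV 0; have := ne 1 (h * v 0 1); have := hV 1.
  have := ne 2%:R s; have := hV 2%:R.
  have := rr0; lra.
have rd y : `|y - x| < rr -> [/\ `|y - x| < d, `|y - x| < r0, `|y - x| < r1 & `|y - x| < r2].
  by rewrite !lt_min => /andP[-> /andP[-> /andP[-> ->]]].
have [|c0 c0h E0] := @MVT_dir0 f (f1 0) x (e_ 0) (h * v 0 0).
  by move=> s /near0/rd[hd _ _ _]; exact: H.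
have [|c1 c1h E1] := @MVT_dir0 f (f1 1) y1 (e_ 1) (h * v 0 1).
  by move=> s /near1/rd[hd _ _ _]; exact: H.
have [|c2 c2h E2] := @MVT_dir0 f (f1 2%:R) y2 (e_ 2%:R) (h * v 0 2%:R).
  by move=> s /near2/rd[hd _ _ _]; exact: H.
have [_ G0 _ _] := rd _ (near0 _ c0h); have {}G0 := H0 _ G0.
have [_ _ G1 _] := rd _ (near1 _ c1h); have {}G1 := H1 _ G1.
have [_ _ _ G2] := rd _ (near2 _ c2h); have {}G2 := H2 _ G2.
rewrite /=; have -> : f (h *: v + x) = f (y2 + (h * v 0 2%:R) *: e_ 2%:R).
  by rewrite [v in LHS]row3_decomposition !scalerDr !scalerA /y2 /y1 addrC !addrA.
have -> : f (y2 + (h * v 0 2%:R) *: e_ 2%:R) - f x =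
  h * (v 0 0 * f1 0 (x + c0 *: e_ 0) + v 0 1 * f1 1 (y1 + c1 *: e_ 1) + v 0 2%:R * f1 2%:R (y2 + c2 *: e_ 2%:R)).
  have -> : f (y2 + (h * v 0 2%:R) *: e_ 2%:R) - f x =
    (f (y2 + (h * v 0 2%:R) *: e_ 2%:R) - f y2) + (f y2 - f y1) + (f y1 - f x) by ring.
  by rewrite E0 E1 E2; ring.
rewrite -[h^-1 *: _]/(h^-1 * _) mulKf// sum_ord3.
set a0 := f1 0 x; set a1 := f1 1 x; set a2 := f1 2%:R x.
rewrite -/a0 in G0; rewrite -/a1 in G1; rewrite -/a2 in G2.
move: (f1 0 _) (f1 1 _) (f1 2%:R _) G0 G1 G2 => b0 b1 b2 G0 G1 G2.
have -> : v 0 0 * a0 + v 0 1 * a1 + v 0 2%:R * a2 - (v 0 0 * b0 + v 0 1 * b1 + v 0 2%:R * b2) =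
  v 0 0 * (a0 - b0) + v 0 1 * (a1 - b1) + v 0 2%:R * (a2 - b2) by ring.
have P i (g : R) : `|g| < e / (3 * V) -> `|v 0 i * g| < e / 3.
  move=> gl; rewrite normrM.
  have -> : e / 3 = V * (e / (3 * V)) by field; rewrite gt_eqF.
  apply: le_lt_trans (_ : V * `|g| < _); last by rewrite ltr_pM2l.
  by rewrite ler_wpM2r// (le_trans (norm_coord_le v i))// lerDl.
have := P 0 _ G0; have := P 1 _ G1; have := P 2%:R _ G2.
have := ler_normD (v 0 0 * (a0 - b0) + v 0 1 * (a1 - b1)) (v 0 2%:R * (a2 - b2)).
have := ler_normD (v 0 0 * (a0 - b0)) (v 0 1 * (a1 - b1)).
lra.
Qed.

End DirectionalDerivatives.

(** * Spheres, annuli and rays *)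

Section Spheres.
Variable R : realType.
Local Notation E3 := 'rV[R]_3.
Implicit Types (x v : E3) (t : R) (U : set E3).

Lemma enorm_continuous : continuous (@enorm R).
Proof.
have c : continuous (fun x : E3 => \sum_j x 0 j ^+ 2).
  exact: (@continuous_sum_coord R (fun _ s => s ^+ 2) (fun _ s => 2 * s)
    (fun _ => @is_derive_sqr R)).
move=> x; have -> : @enorm R = (fun y : E3 => Num.sqrt (\sum_j y 0 j ^+ 2)).
  by apply/funext => y; rewrite -enorm_sqr sqrtr_sqr ger0_norm ?enorm_ge0.
by apply: cont_comp; [exact: c | exact: sqrt_continuous].
Qed.

Lemma coord_le_enorm x i : `|x 0 i| <= enorm x.
Proof.
rewrite -ler_sqr ?nnegrE ?enorm_ge0// real_normK ?num_real// enorm_sqr.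
by rewrite (bigD1 i)//= lerDl sumr_ge0// => j _; rewrite sqr_ge0.
Qed.

Lemma norm_le_enorm x : `|x| <= enorm x.
Proof. by apply: norm_rV_le; [exact: enorm_ge0 | exact: coord_le_enorm]. Qed.

Lemma enormZ (s : R) x : enorm (s *: x) = `|s| * enorm x.
Proof.
apply/eqP; rewrite -(@eqrXn2 _ 2)// ?mulr_ge0 ?enorm_ge0//.
rewrite exprMn !enorm_sqr real_normK ?num_real// mulr_sumr.
by apply/eqP/eq_bigr => i _; rewrite mxE exprMn.
Qed.

Lemma enorm_e i : enorm (e_ i : E3) = 1.
Proof.
apply/eqP; rewrite -(@eqrXn2 _ 2)// ?enorm_ge0// enorm_sqr (bigD1 i)//= big1.
  by rewrite !mxE !eqxx addr0.
by move=> j /negbTE ji; rewrite !mxE ji andbF expr0n.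
Qed.

Lemma compact_sphere (r : R) : compact [set x : E3 | enorm x = r].
Proof.
apply: bounded_closed_compact.
  exists r; split; first exact: num_real.
  by move=> M rM x /= xr; rewrite (le_trans (norm_le_enorm x))// xr ltW.
have -> : [set x : E3 | enorm x = r] = @enorm R @^-1` [set r] by [].
apply: preimage_closed => [x _|]; first exact: enorm_continuous.
exact: closed_eq.
Qed.

(** A continuous function attains its maximum on a sphere. *)
Lemma sphere_max (r : R) (f : E3 -> R) : 0 <= r ->
  (forall x, enorm x = r -> {for x, continuous f}) ->
  exists2 x0, enorm x0 = r & forall x, enorm x = r -> f x <= f x0.
Proof.
move=> r0 cf; have [|||x] := @EVT_max_rV R 3 f [set x : E3 | enorm x = r].
- by exists (r *: e_ 0); rewrite /= enormZ enorm_e ger0_norm// mulr1.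
- exact: compact_sphere.
- by apply: continuous_in_subspaceT => y; rewrite inE => /cf.
rewrite inE => xr xm; exists x => // y yr; by apply: xm; rewrite inE.
Qed.

Lemma open_outer (r : R) : open [set x : E3 | r < enorm x].
Proof.
have -> : [set x : E3 | r < enorm x] = @enorm R @^-1` [set s | r < s] by [].
apply: open_comp => [x _|]; first exact: enorm_continuous.
exact: open_gt.
Qed.

Lemma cube_annulus x0 (r L : R) x : enorm x0 = r -> 0 < r -> 0 <= L -> L <= r / 16 ->
  cube x0 L x -> r / 2 <= enorm x <= 2 * r.
Proof.
move=> xr r0 L0 Lr Cx.
have h1 i : `|x 0 i ^+ 2 - x0 0 i ^+ 2| <= r ^+ 2 / 4.
  have -> : x 0 i ^+ 2 - x0 0 i ^+ 2 = (x 0 i - x0 0 i) * (2 * x0 0 i + (x 0 i - x0 0 i)) by ring.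
  rewrite normrM; have := Cx i; have := coord_le_enorm x0 i; rewrite xr => h2 h3.
  have h4 : `|2 * x0 0 i + (x 0 i - x0 0 i)| <= 2 * r + r / 16.
    apply: le_trans (ler_normD _ _) _; rewrite normrM gtr0_norm//; lra.
  apply: le_trans (_ : r / 16 * (2 * r + r / 16) <= _); last first.
    by have := sqr_ge0 r; rewrite expr2; lra.
  by rewrite ler_pM//; lra.
have h2 : `|enorm x ^+ 2 - r ^+ 2| <= 3 / 4 * r ^+ 2.
  rewrite -[X in _ - X ^+ 2]xr !enorm_sqr -sumrB; apply: le_trans (ler_norm_sum _ _ _) _.
  apply: le_trans (_ : \sum_(i < 3) r ^+ 2 / 4 <= _).
    by apply: ler_sum => i _; exact: h1.
  by rewrite sumr_const card_ord; apply: le_of_eq; field.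
move: h2; rewrite ler_norml => /andP[h3 h4].
rewrite -(@ler_sqr _ (r / 2)) ?nnegrE ?enorm_ge0 ?divr_ge0 ?(ltW r0)//.
rewrite -(@ler_sqr _ (enorm x)) ?nnegrE ?enorm_ge0 ?mulr_ge0 ?(ltW r0)//.
by apply/andP; split; have := sqr_ge0 r; lra.
Qed.

(** A bound on the partial derivatives gives a Lipschitz bound on a cube, by moving
    along one axis at a time. *)
Lemma lipschitz_cube (f : E3 -> R) (f1 : 'I_3 -> E3 -> R) x0 (s G : R) x :
  0 <= s -> 0 <= G ->
  (forall i y, cube x0 s y -> is_derive y (e_ i) f (f1 i y)) ->
  (forall i y, cube x0 s y -> `|f1 i y| <= G) ->
  cube x0 s x -> `|f x - f x0| <= 3 * s * G.
Proof.
move=> s0 G0 df fG Cx.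
pose h i := x 0 i - x0 0 i.
have xE : x = grid_point x0 (h 0) (h 1) (h 2%:R).
  by apply/rowP => j; rewrite grid_point_coord; case: (ord3P j) => -> /=; rewrite /h addrC subrK.
have C0 : `|0 : R| <= s by rewrite normr0.
have hs i : `|h i| <= s by exact: Cx.
have step (i : 'I_3) y (b : R) : (forall t, `|t| <= `|b| -> cube x0 s (y + t *: e_ i)) ->
    `|b| <= s -> `|f (y + b *: e_ i) - f y| <= s * G.
  move=> Cy bs; have [t /Cy/df//|c cb ->] := @MVT_dir0 R f (f1 i) y (e_ i) b.
  by rewrite normrM mulrC ler_pM// fG//; exact: Cy.
have F0 t : grid_point x0 0 0 0 + t *: e_ (0 : 'I_3) = grid_point x0 t 0 0 by rewrite /grid_point !scale0r !addr0.
have F1 u t : grid_point x0 u 0 0 + t *: e_ (1 : 'I_3) = grid_point x0 u t 0 by rewrite /grid_point !scale0r !addr0.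
have F2 u (v : R) t : grid_point x0 u v 0 + t *: e_ (2%:R : 'I_3) = grid_point x0 u v t by rewrite /grid_point !scale0r !addr0.
have S0 : `|f (grid_point x0 (h 0) 0 0) - f x0| <= s * G.
  have G00 : grid_point x0 0 0 0 = x0 by rewrite /grid_point !scale0r !addr0.
  have := @step 0 (grid_point x0 0 0 0) (h 0); rewrite F0 G00; apply => //.
  move=> t th; rewrite (_ : x0 + _ = grid_point x0 t 0 0); last by rewrite -F0 G00.
  by apply: cube_grid_point => //; exact: le_trans th (hs 0).
have S1 : `|f (grid_point x0 (h 0) (h 1) 0) - f (grid_point x0 (h 0) 0 0)| <= s * G.
  have := @step 1 (grid_point x0 (h 0) 0 0) (h 1); rewrite F1; apply => //.
  by move=> t th; rewrite F1; apply: cube_grid_point => //; exact: le_trans th (hs 1).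
have S2 : `|f x - f (grid_point x0 (h 0) (h 1) 0)| <= s * G.
  have := @step 2%:R (grid_point x0 (h 0) (h 1) 0) (h 2%:R); rewrite F2 -xE; apply => //.
  by move=> t th; rewrite F2; apply: cube_grid_point => //; exact: le_trans th (hs _).
have -> : f x - f x0 = (f x - f (grid_point x0 (h 0) (h 1) 0)) +
  (f (grid_point x0 (h 0) (h 1) 0) - f (grid_point x0 (h 0) 0 0)) + (f (grid_point x0 (h 0) 0 0) - f x0) by ring.
have := ler_normD ((f x - f (grid_point x0 (h 0) (h 1) 0)) +
  (f (grid_point x0 (h 0) (h 1) 0) - f (grid_point x0 (h 0) 0 0))) (f (grid_point x0 (h 0) 0 0) - f x0).
have := ler_normD (f x - f (grid_point x0 (h 0) (h 1) 0)) (f (grid_point x0 (h 0) (h 1) 0) - f (grid_point x0 (h 0) 0 0)).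
lra.
Qed.

(** A small radial derivative, of order [1 / r], keeps a function almost constant
    along rays between the radii [r / 2] and [2 r]. *)
Lemma ray_variation U (f : E3 -> R) (f1 f2 : 'I_3 -> E3 -> R) (r e : R) x :
  open U -> smooth2 U f f1 f2 -> 0 < r -> 0 <= e ->
  (forall y, r / 2 <= enorm y <= 2 * r -> U y) ->
  (forall y, r / 2 <= enorm y <= 2 * r ->
     `|\sum_i y 0 i / enorm y * f1 i y| <= 2 * e / r) ->
  r / 2 <= enorm x <= 2 * r ->
  `|f x - f (r / enorm x *: x)| <= 2 * e.
Proof.
move=> oU sf r0 e0 inU rad /[dup] xr /andP[x1 x2].
have x0 : 0 < enorm x by apply: lt_le_trans x1; rewrite divr_gt0.
pose w := (enorm x)^-1 *: x.
have w1 : enorm w = 1 by rewrite enormZ normfV gtr0_norm// mulVf ?gt_eqF.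
have xE : x = 0 + enorm x *: w by rewrite add0r scalerA mulfV ?gt_eqF// scale1r.
have D (s : R) : r / 2 <= s <= 2 * r -> is_derive (0 + s *: w) w f (\sum_i w 0 i * f1 i (0 + s *: w)).
  move=> /[dup] sr /andP[s1 s2]; rewrite !add0r.
  have s0 : 0 < s by apply: lt_le_trans s1; rewrite divr_gt0.
  have Us : U (s *: w) by apply: inU; rewrite enormZ w1 mulr1 gtr0_norm.
  have /nbhs_ballP[d /= d0 Hd] := open_nbhs_nbhs (conj oU Us).
  apply: (@is_derive_C1 R f f1 (s *: w) w d d0).
    move=> i y yd; have Uy : U y by apply: Hd; rewrite -ball_normE/= distrC.
    by have [_ /(_ i)[]] := sf _ Uy.
  by move=> i; have [_ /(_ i)[]] := sf _ Us.
have B (s : R) : r / 2 <= s <= 2 * r -> `|\sum_i w 0 i * f1 i (0 + s *: w)| <= 2 * e / r.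
  move=> /[dup] sr /andP[s1 s2]; rewrite !add0r.
  have s0 : 0 < s by apply: lt_le_trans s1; rewrite divr_gt0.
  have E : enorm (s *: w) = s by rewrite enormZ w1 mulr1 gtr0_norm.
  have := rad (s *: w); rewrite E => /(_ sr).
  congr (`|_| <= _); apply: eq_bigr => i _; congr (_ * _).
  by rewrite mxE mulrAC divff ?mul1r ?gt_eqF.
have -> : r / enorm x *: x = 0 + r *: w by rewrite add0r scalerA.
rewrite [in f x]xE.
have fin (a b : R) : a <= b -> r / 2 <= a -> b <= 2 * r -> b - a <= r ->
   `|f (0 + b *: w) - f (0 + a *: w)| <= 2 * e.
  move=> ab ra br bar.
  have [s /andP[s1 s2]|c /andP[c1 c2] ->] := @MVT_dir R f (fun y => \sum_i w 0 i * f1 i y) 0 w a b ab.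
    by apply: D; apply/andP; split; lra.
  rewrite normrM (ger0_norm (_ : 0 <= b - a)) ?subr_ge0//.
  have -> : 2 * e = 2 * e / r * r by rewrite divfK ?gt_eqF.
  by rewrite ler_pM// ?subr_ge0// B//; apply/andP; split; lra.
have [rx|rx] := leP r (enorm x); first by apply: fin => //; lra.
by rewrite distrC; apply: fin; lra.
Qed.

End Spheres.

(** * Decay at one scale *)

Section OneScale.
Variable R : realType.
Local Notation E3 := 'rV[R]_3.
Implicit Types (x v : E3) (t : R) (U : set E3).

Lemma sqr_sum_le (a b u v N e : R) : 0 <= N -> 0 <= e -> a ^+ 2 + b ^+ 2 <= N ^+ 2 ->
  `|u - a| <= 2 * e -> `|v - b| <= 2 * e -> u ^+ 2 + v ^+ 2 <= (N + 4 * e) ^+ 2.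
Proof.
move=> N0 e0 ab; have an : `|a| <= N.
  by rewrite -ler_sqr ?nnegrE// real_normK ?num_real//; have := sqr_ge0 b; lra.
have bn : `|b| <= N.
  by rewrite -ler_sqr ?nnegrE// real_normK ?num_real//; have := sqr_ge0 a; lra.
move=> ua vb; have -> : u = a + (u - a) by ring.
have -> : v = b + (v - b) by ring.
move: (u - a) (v - b) ua vb => s t sb tb.
have key (c y : R) : `|c| <= N -> `|y| <= 2 * e -> (c + y) ^+ 2 <= c ^+ 2 + 4 * e * N + 4 * e ^+ 2.
  move=> cN ye; have h1 : c * y <= N * (2 * e).
    by apply: le_trans (ler_norm _) _; rewrite normrM ler_pM.
  have h2 : y ^+ 2 <= (2 * e) ^+ 2.
    by rewrite -(real_normK (num_real y)) lerXn2r// nnegrE ?mulr_ge0.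
  have -> : (c + y) ^+ 2 = c ^+ 2 + 2 * (c * y) + y ^+ 2 by ring.
  by rewrite exprMn in h2; lra.
have := key a s an sb; have := key b t bn tb; have := sqr_ge0 e.
have -> : (N + 4 * e) ^+ 2 = N ^+ 2 + 8 * e * N + 16 * e ^+ 2 by ring.
lra.
Qed.

Lemma sqr_sum_ge (a b u v N : R) : 0 <= N -> a ^+ 2 + b ^+ 2 = N ^+ 2 ->
  `|u - a| <= N / 4 -> `|v - b| <= N / 4 -> (N / 2) ^+ 2 <= u ^+ 2 + v ^+ 2.
Proof.
move=> N0 ab ua vb; have -> : u = a + (u - a) by ring.
have -> : v = b + (v - b) by ring.
move: (u - a) (v - b) ua vb => s t sb tb.
have key (c y : R) : `|y| <= N / 4 -> c ^+ 2 - N / 2 * `|c| <= (c + y) ^+ 2.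
  move=> ye; have h1 : - (c * y) <= `|c| * (N / 4).
    by apply: le_trans (ler_norm _) _; rewrite normrN normrM ler_wpM2l.
  have -> : (c + y) ^+ 2 = c ^+ 2 + 2 * (c * y) + y ^+ 2 by ring.
  by have := sqr_ge0 y; lra.
have := key a s sb; have := key b t tb.
have h : `|a| + `|b| <= 3 / 2 * N.
  rewrite -ler_sqr ?nnegrE ?addr_ge0 ?mulr_ge0//.
  have -> : (3 / 2 * N) ^+ 2 = 9 / 4 * N ^+ 2 by field.
  rewrite -ab -(real_normK (num_real a)) -(real_normK (num_real b)).
  have := sqr_ge0 (`|a| - `|b|); have := sqr_ge0 `|a|; have := sqr_ge0 `|b|.
  rewrite sqrrB sqrrD; lra.
have h2 := ler_wpM2l (_ : 0 <= N / 2) h.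
have := h2 _; rewrite divr_ge0// => /(_ isT).
rewrite exprMn exprVn; rewrite -ab; have -> : N / 2 * (3 / 2 * N) = 3 / 4 * (a ^+ 2 + b ^+ 2).
  by rewrite ab; field.
lra.
Qed.

(** The complex function [A + i B] solves [lap F = - (2 i k / |y|) F] up to an
    error of order [e / r], and its radial derivative is of order [e / r], on the
    annulus of radii [r / 2] and [2 r]; then it is of order [e] on the sphere of
    radius [r].

    Let [N] be the maximum of the modulus on this sphere, reached at [x0]. The
    radial bound makes [5 N] a bound on the whole annulus, once [e < N]. The
    gradient estimate at the scale [s = sqrt r] shows that the modulus is at
    least [N / 2] on the cube of half-side [s / c] around [x0]. The energy
    estimate on the cube of half-side [L = Lm s] compares a lower bound of order
    [N^2 / Lm^3] with an upper bound of order [N^2 / Lm^4 + N e], so that [N] is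
    of order [e] if [Lm] is a large enough constant. *)
Lemma one_scale_decay (k : R) : 0 < k ->
  exists C rho : R, 0 < C /\ 0 < rho /\
  forall U (A B : E3 -> R) (A1 A2 B1 B2 : 'I_3 -> E3 -> R) (F1 F2 : E3 -> R) (r e : R),
  open U -> rho < r -> 0 < e -> smooth2 U A A1 A2 -> smooth2 U B B1 B2 ->
  (forall y, r / 2 <= enorm y <= 2 * r -> U y) ->
  (forall y, r / 2 <= enorm y <= 2 * r -> \sum_i A2 i y = 2 * (k / enorm y) * B y + F1 y) ->
  (forall y, r / 2 <= enorm y <= 2 * r -> \sum_i B2 i y = - (2 * (k / enorm y) * A y) + F2 y) ->
  (forall y, r / 2 <= enorm y <= 2 * r -> `|F1 y| <= 2 * e / r /\ `|F2 y| <= 2 * e / r) ->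
  (forall y, r / 2 <= enorm y <= 2 * r -> `|\sum_i y 0 i / enorm y * A1 i y| <= 2 * e / r) ->
  (forall y, r / 2 <= enorm y <= 2 * r -> `|\sum_i y 0 i / enorm y * B1 i y| <= 2 * e / r) ->
  forall x, enorm x = r -> A x ^+ 2 + B x ^+ 2 <= (C * e) ^+ 2.
Proof.
move=> k0.
pose C2 : R := 15 + (20 * k + 3) / 2.
have C20 : 0 < C2 by rewrite /C2; lra.
(* [C2 N / s] bounds the gradient; the ratio [c] makes the variation over a cube
   of half-side [s / c] at most [N / 4]. *)
have [c c4 cC] : exists2 c : nat, (4 <= c)%N & 12 * C2 <= c%:R.
  exists (maxn 4 (Num.truncn (12 * C2)).+1); first exact: leq_maxl.
  by apply: le_trans (ltW (truncnS_gt _)) _; rewrite ler_nat leq_maxr.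
(* [K1] is the constant in the error term [N^2 / Lm^4] of the energy estimate. *)
have [K1 K1E] : exists K1 : R, forall N l : R, l != 0 ->
    2304 * (5 * N) ^+ 2 / (k * l ^+ 2 / 2) ^+ 2 = K1 * N ^+ 2 / l ^+ 4.
  by exists (2304 * 100 / k ^+ 2) => N l l0; field; rewrite l0 gt_eqF.
have [Lm Lm2 LmK] : exists2 n : nat, (2 <= n)%N & 32 * c%:R ^+ 3 * K1 <= n%:R.
  exists (maxn 2 (Num.truncn (32 * c%:R ^+ 3 * K1)).+1); first exact: leq_maxl.
  by apply: le_trans (ltW (truncnS_gt _)) _; rewrite ler_nat leq_maxr.
have [K2 K20 K2E] : exists2 K2 : R, 0 < K2 &
    forall N e X : R, 80 * N * e / k * (32 * X) = N * (K2 * X / k * e).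
  exists (80 * 32); first by rewrite mulr_gt0// ltr0n.
  by move=> N e X; field; rewrite gt_eqF.
have c0 : 0 < c%:R :> R by rewrite ltr0n (leq_trans _ c4).
have Lm0 : 0 < Lm%:R :> R by rewrite ltr0n (leq_trans _ Lm2).
have Lm2' : 2 <= Lm%:R :> R by rewrite (ler_nat _ 2).
pose X : R := (c%:R * Lm%:R) ^+ 3.
have X0 : 0 < X by rewrite exprn_gt0// mulr_gt0.
exists (1 + K2 * X / k), ((16 * Lm%:R) ^+ 2).
have XX : 0 < K2 * X / k by rewrite divr_gt0// mulr_gt0.
split; first by rewrite addr_gt0.
split; first by rewrite exprn_gt0// mulr_gt0.
move=> U A B A1 A2 B1 B2 F1 F2 r e oU rr e0 sA sB inU eA eB FF rA rB.
have r0 : 0 < r by apply: lt_trans rr; rewrite exprn_gt0// mulr_gt0.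
pose s := Num.sqrt r.
have s0 : 0 < s by rewrite sqrtr_gt0.
have sr : s ^+ 2 = r by rewrite sqr_sqrtr// ltW.
have s16 : 16 * Lm%:R < s.
  by rewrite -ltr_sqr ?nnegrE ?(ltW s0) ?mulr_ge0 ?(ltW Lm0)// sr.
pose L := Lm%:R * s.
have L0 : 0 < L by rewrite mulr_gt0.
have Lr : L <= r / 16.
  rewrite -sr /L expr2; have : 16 * Lm%:R * s <= s * s by rewrite ler_wpM2r ?ltW.
  by clear; lra.
pose F x := A x ^+ 2 + B x ^+ 2.
have F0 x : 0 <= F x by rewrite addr_ge0// sqr_ge0.
have rin x : enorm x = r -> r / 2 <= enorm x <= 2 * r by move=> ->; clear -r0; apply/andP; split; lra.
have [|x0 x0r x0m] := @sphere_max R r F (ltW r0) _.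
  move=> x /rin/inU Ux; have [cA _] := sA _ Ux; have [cB _] := sB _ Ux.
  have ec t : {for t, continuous (fun u : R => u ^+ 2)} by exact: exprn_continuous.
  by apply: contD; [exact: (cont_comp cA (ec _)) | exact: (cont_comp cB (ec _))].
pose N := Num.sqrt (F x0).
have N0 : 0 <= N by exact: sqrtr_ge0.
have NN : A x0 ^+ 2 + B x0 ^+ 2 = N ^+ 2 by rewrite sqr_sqrtr.
suff NC : N <= (1 + K2 * X / k) * e.
  move=> x xr; apply: le_trans (x0m _ xr) _; rewrite /F NN.
  by rewrite lerXn2r ?nnegrE// mulr_ge0 ?addr_ge0 ?(ltW XX)// ltW.
have [Ne|eN] := leP N e.
  by apply: le_trans Ne _; rewrite mulrDl mul1r lerDl mulr_ge0 ?ltW.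
have Np : 0 < N by apply: lt_trans eN.
have e50 : 0 <= N + 4 * e by rewrite addr_ge0// mulr_ge0// ltW.
have e5 : N + 4 * e <= 5 * N by clear - eN; lra.
have N50 : 0 <= 5 * N by rewrite mulr_ge0.
have Fann y : r / 2 <= enorm y <= 2 * r -> A y ^+ 2 + B y ^+ 2 <= (5 * N) ^+ 2.
  move=> yr; have y0 : 0 < enorm y by case/andP: yr => h _; apply: lt_le_trans h; rewrite divr_gt0.
  have hA := ray_variation oU sA r0 (ltW e0) inU rA yr.
  have hB := ray_variation oU sB r0 (ltW e0) inU rB yr.
  apply: le_trans (sqr_sum_le N0 (ltW e0) _ hA hB) _.
    rewrite -NN; apply: x0m; rewrite enormZ ger0_norm ?divr_ge0 ?ltW//.
    by rewrite divfK ?gt_eqF.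
  by apply: (lerXn2r 2) => //; rewrite nnegrE.
have absA y : r / 2 <= enorm y <= 2 * r -> `|A y| <= 5 * N.
  move=> /Fann h; rewrite -ler_sqr ?nnegrE ?mulr_ge0// real_normK ?num_real//.
  by rewrite (le_trans _ h)// lerDl sqr_ge0.
have absB y : r / 2 <= enorm y <= 2 * r -> `|B y| <= 5 * N.
  move=> /Fann h; rewrite -ler_sqr ?nnegrE ?mulr_ge0// real_normK ?num_real//.
  by rewrite (le_trans _ h)// lerDr sqr_ge0.
have Lann y : cube x0 L y -> r / 2 <= enorm y <= 2 * r.
  exact: (cube_annulus x0r r0 (ltW L0) Lr).
have lap (D2 : 'I_3 -> E3 -> R) (G H : E3 -> R) (sg : R) y : `|sg| = 1 ->
    r / 2 <= enorm y <= 2 * r -> \sum_i D2 i y = sg * (2 * (k / enorm y) * G y) + H y ->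
    `|G y| <= 5 * N -> `|H y| <= 2 * e / r -> `|\sum_i D2 i y| < (20 * k + 3) * N / r.
  move=> sg1 /andP[y1 y2] -> Gy Hy.
  have y0 : 0 < enorm y by apply: lt_le_trans y1; rewrite divr_gt0.
  have kp : 0 <= 2 * (k / enorm y) by rewrite mulr_ge0// divr_ge0 ?(ltW k0) ?(ltW y0).
  apply: le_lt_trans (ler_normD _ _) _.
  rewrite normrM sg1 mul1r normrM (ger0_norm kp).
  have h1 : k / enorm y <= 2 * k / r.
    rewrite ler_pdivrMr// mulrAC ler_pdivlMr// -mulrA mulrCA ler_pM2l//.
    by clear -y1; lra.
  have h2 : 2 * (k / enorm y) * `|G y| <= 2 * (2 * k / r) * (5 * N).
    apply: ler_pM => //.
    by rewrite ler_pM2l.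
  apply: le_lt_trans (lerD h2 Hy) _.
  have -> : 2 * (2 * k / r) * (5 * N) + 2 * e / r = (20 * k * N + 2 * e) / r by ring.
  by rewrite ltr_pM2r ?invr_gt0//; clear -eN k0 Np; lra.
have grad (D : E3 -> R) (D1 D2 : 'I_3 -> E3 -> R) i y : smooth2 U D D1 D2 ->
   (forall z, r / 2 <= enorm z <= 2 * r -> `|D z| <= 5 * N) ->
   (forall z, r / 2 <= enorm z <= 2 * r -> `|\sum_i D2 i z| < (20 * k + 3) * N / r) ->
   cube x0 (s / c%:R) y -> `|D1 i y| <= C2 * N / s.
  move=> sD hD lD Cy.
  have CL z : cube y s z -> cube x0 L z.
    move=> Cz j; have := Cz j; have := Cy j.
    have -> : z 0 j - x0 0 j = (z 0 j - y 0 j) + (y 0 j - x0 0 j) by ring.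
    have := ler_normD (z 0 j - y 0 j) (y 0 j - x0 0 j).
    have : s / c%:R <= s by rewrite ler_pdivrMr// ler_peMr ?(ltW s0)// ler1n (leq_trans _ c4).
    have : 2 * s <= L by rewrite ler_wpM2r// ltW.
    by clear; lra.
  have := @gradient_bound R D D1 D2 y s (5 * N) ((20 * k + 3) * N / r) i s0 _ _ _.
  have -> : 3 * (5 * N) / s + (20 * k + 3) * N / r * s / 2 = C2 * N / s.
    by rewrite -sr /C2; field; rewrite gt_eqF.
  apply.
  - by apply: smooth2S sD => z /CL/Lann/inU.
  - by move=> z /CL/Lann/hD.
  - by move=> z /CL/Lann/lD.
have sc : 0 <= s / c%:R by rewrite divr_ge0 ?ltW.
have CN0 : 0 <= C2 * N / s by rewrite divr_ge0 ?mulr_ge0 ?ltW.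
have scL : cube x0 (s / c%:R) `<=` cube x0 L.
  move=> z Cz j; apply: le_trans (Cz j) _.
  have : s / c%:R <= s by rewrite ler_pdivrMr// ler_peMr ?(ltW s0)// ler1n (leq_trans _ c4).
  have : 2 * s <= L by rewrite ler_wpM2r// ltW.
  by clear -s0; lra.
have var (D : E3 -> R) (D1 D2 : 'I_3 -> E3 -> R) y : smooth2 U D D1 D2 ->
   (forall z, r / 2 <= enorm z <= 2 * r -> `|D z| <= 5 * N) ->
   (forall z, r / 2 <= enorm z <= 2 * r -> `|\sum_i D2 i z| < (20 * k + 3) * N / r) ->
   cube x0 (s / c%:R) y -> `|D y - D x0| <= N / 4.
  move=> sD hD lD Cy.
  apply: le_trans (@lipschitz_cube R D D1 x0 (s / c%:R) (C2 * N / s) y sc CN0 _ _ Cy) _.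
  - by move=> i z /scL/Lann/inU/sD[_ /(_ i)[]].
  - by move=> i z; exact: (grad D D1 D2).
  - have -> : 3 * (s / c%:R) * (C2 * N / s) = 3 * C2 * N / c%:R.
      by field; rewrite !gt_eqF.
    by rewrite ler_pdivrMr//; move: (ler_wpM2r N0 cC); clear; lra.
have lA z : r / 2 <= enorm z <= 2 * r -> `|\sum_i A2 i z| < (20 * k + 3) * N / r.
  move=> zr; have [n1 _] := FF _ zr.
  by apply: (lap A2 B F1 1 z) => //; [exact: normr1 | rewrite mul1r eA | exact: absB].
have lB z : r / 2 <= enorm z <= 2 * r -> `|\sum_i B2 i z| < (20 * k + 3) * N / r.
  move=> zr; have [_ n2] := FF _ zr.
  by apply: (lap B2 A F2 (-1) z) => //; [rewrite normrN normr1 | rewrite mulN1r eB | exact: absA].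
have := @energy_estimate R A B A1 A2 B1 B2 (fun y => k / enorm y) F1 F2 x0 L (k / (2 * r))
  (4 * e / k) (5 * N) (N / 2) (c * Lm)%N.
have k00 : 0 < k / (2 * r) by rewrite divr_gt0// mulr_gt0.
have eta0 : 0 <= 4 * e / k by rewrite divr_ge0 ?mulr_ge0 ?ltW.
have q4 : (4 <= c * Lm)%N by rewrite (leq_trans c4)// leq_pmulr// (leq_trans _ Lm2).
have sA' : smooth2 (cube x0 L) A A1 A2 by apply: smooth2S sA => z /Lann/inU.
have sB' : smooth2 (cube x0 L) B B1 B2 by apply: smooth2S sB => z /Lann/inU.
move=> /(_ L0 k00 N50 eta0 q4 sA' sB').
have Lq : L / (c * Lm)%:R = s / c%:R by rewrite natrM /L; field; rewrite !gt_eqF.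
rewrite Lq.
have ee : 4 * e / k * (k / (2 * r)) = 2 * e / r by field; rewrite !gt_eqF.
rewrite ee.
have E1 z (Cz : cube x0 L z) := eA z (Lann z Cz).
have E2 z (Cz : cube x0 L z) := eB z (Lann z Cz).
have E3' z : cube x0 L z -> k / (2 * r) <= k / enorm z.
  move=> /Lann/andP[z1 z2].
  have z0 : 0 < enorm z by apply: lt_le_trans z1; rewrite divr_gt0.
  by rewrite ler_pM2l// lef_pV2 ?posrE ?mulr_gt0.
have E4 z (Cz : cube x0 L z) := FF z (Lann z Cz).
have E5 z (Cz : cube x0 L z) := Fann z (Lann z Cz).
have E6 z : cube x0 (s / c%:R) z -> (N / 2) ^+ 2 <= A z ^+ 2 + B z ^+ 2.
  move=> Cz; apply: (sqr_sum_ge N0 NN); first exact: (var A A1 A2).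
  exact: (var B B1 B2).
move=> /(_ E1 E2 E3' E4 E5 E6).
have -> : k / (2 * r) * L ^+ 2 = k * Lm%:R ^+ 2 / 2.
  by rewrite /L exprMn sr; field; rewrite gt_eqF.
rewrite K1E ?gt_eqF//.
rewrite natrM -/X.
have hK : K1 * N ^+ 2 / Lm%:R ^+ 4 <= N ^+ 2 / (32 * X).
  rewrite mulrAC mulrC ler_pM2l ?exprn_gt0// ler_pdivrMr ?exprn_gt0//.
  rewrite mulrC ler_pdivlMr ?mulr_gt0// /X exprMn.
  have := ler_wpM2r (exprn_ge0 3 (ltW Lm0)) LmK.
  rewrite -exprS; apply: le_trans; apply: le_of_eq; ring.
move=> H1; have {}H1 := le_trans H1 (lerD hK (lexx _)).
have {}H1 : N ^+ 2 / (32 * X) <= 80 * N * e / k.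
  move: H1; have -> : (N / 2) ^+ 2 / 4 / X = N ^+ 2 / (32 * X) + N ^+ 2 / (32 * X).
    by field; rewrite gt_eqF.
  by rewrite lerD2l => /le_trans; apply; apply: le_of_eq; ring.
move: H1; rewrite ler_pdivrMr ?mulr_gt0//.
rewrite K2E expr2 ler_pM2l// => /le_trans; apply.
by rewrite mulrDl lerDr mul1r ltW.
Qed.

End OneScale.

(** * Removal of the spherical phase from the scattered field *)

Section ScatteredField.
Variable R : realType.
Local Notation E3 := 'rV[R]_3.
Local Notation C := R[i].
Implicit Types (x v : E3) (t : R) (U : set E3).

Lemma Ck_smooth2 U f : Ck 4 U f ->
  smooth2 U f (fun i => partial i f) (fun i => partial i (partial i f)).
Proof.
move=> H x Ux; have [cf df] := H [::] isT x Ux; split => // i.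
have [cf1 df1] := H [:: i] isT x Ux; have [cf2 _] := H [:: i; i] isT x Ux.
split; [exact: cf1|exact: cf2| |].
- exact: derivableP (df isT i).
- exact: derivableP (df1 isT i).
Qed.

(** On an open set the witnesses are the partial derivatives. *)
Lemma smooth2_partial U f f1 f2 i x : open U -> smooth2 U f f1 f2 -> U x ->
  partial i f x = f1 i x /\ partial i (partial i f) x = f2 i x :> R.
Proof.
move=> oU sf Ux; split.
  by have [_ /(_ i)[_ _ [_ E] _]] := sf _ Ux.
have [_ /(_ i)[_ _ _ [_ <-]]] := sf _ Ux.
apply: near_eq_derive.
have : \forall y \near x, U y by apply: open_nbhs_nbhs.
apply: filterS => y Uy.
by have [_ /(_ i)[_ _ [_ E] _]] := sf _ Uy.
Qed.

Lemma is_derive_mul_arg (p p1 : R -> R) (k t : R) : (forall s : R, is_derive s 1 p (p1 s)) ->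
  is_derive t 1 (fun s => p (k * s)) (k * p1 (k * t)).
Proof.
move=> H; rewrite mulrC.
exact: (@is_derive1_comp R p (fun s => k * s) t _ _ (H _) (is_derive_lin k t)).
Qed.

Lemma is_derive_cosk (k t : R) : is_derive t 1 (fun s => cos (k * s)) (- k * sin (k * t)).
Proof.
have D (s : R) : is_derive s 1 (@cos R) (- sin s) by exact: is_derive_cos.
by rewrite mulNr -mulrN; exact: (@is_derive_mul_arg cos (fun s => - sin s)).
Qed.

Lemma is_derive_sink (k t : R) : is_derive t 1 (fun s => sin (k * s)) (k * cos (k * t)).
Proof.
have D (s : R) : is_derive s 1 (@sin R) (cos s) by exact: is_derive_sin.
exact: (@is_derive_mul_arg sin cos).
Qed.

Lemma is_derive_cosk2 (k t : R) :
  is_derive t 1 (fun s => - k * sin (k * s)) (- k ^+ 2 * cos (k * t)).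
Proof.
apply: is_derive_ext (is_deriveZ (- k) (is_derive_sink k t)) _ _ => //.
by rewrite -[_ *: _]/(_ * _); ring.
Qed.

Lemma is_derive_sink2 (k t : R) :
  is_derive t 1 (fun s => k * cos (k * s)) (- k ^+ 2 * sin (k * t)).
Proof.
apply: is_derive_ext (is_deriveZ k (is_derive_cosk k t)) _ _ => //.
by rewrite -[_ *: _]/(_ * _); ring.
Qed.

Lemma continuous_trigk (k : R) :
  continuous (fun t : R => - k ^+ 2 * cos (k * t)) /\
  continuous (fun t : R => - k ^+ 2 * sin (k * t)).
Proof.
have l : continuous (fun t : R => k * t).
  by move=> t; case: (is_derive_lin k t) => /derivable1_diffP/differentiable_continuous.
split=> t; apply: (@continuousM R R (cst _)).
- exact: cst_continuous.
- by apply: (@continuous_comp _ _ _ (fun t : R => k * t) cos); [exact: l | exact: continuous_cos].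
- exact: cst_continuous.
- by apply: (@continuous_comp _ _ _ (fun t : R => k * t) sin); [exact: l | exact: continuous_sin].
Qed.

Lemma smooth2_cosk U (k : R) h h1 h2 : smooth2 U h h1 h2 ->
  smooth2 U (fun x => cos (k * h x)) (fun i x => - k * sin (k * h x) * h1 i x)
    (fun i x => - k ^+ 2 * cos (k * h x) * h1 i x ^+ 2 + - k * sin (k * h x) * h2 i x).
Proof.
move=> sh; apply: (smooth2_comp (p := fun s => cos (k * s)) (p1 := fun s => - k * sin (k * s))
  (p2 := fun s => - k ^+ 2 * cos (k * s)) sh) => x _; split.
- by have [H _] := continuous_trigk k; exact: H.
- exact: is_derive_cosk.
- exact: is_derive_cosk2.
Qed.

Lemma smooth2_sink U (k : R) h h1 h2 : smooth2 U h h1 h2 ->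
  smooth2 U (fun x => sin (k * h x)) (fun i x => k * cos (k * h x) * h1 i x)
    (fun i x => - k ^+ 2 * sin (k * h x) * h1 i x ^+ 2 + k * cos (k * h x) * h2 i x).
Proof.
move=> sh; apply: (smooth2_comp (p := fun s => sin (k * s)) (p1 := fun s => k * cos (k * s))
  (p2 := fun s => - k ^+ 2 * sin (k * s)) sh) => x _; split.
- by have [_ H] := continuous_trigk k; exact: H.
- exact: is_derive_sink.
- exact: is_derive_sink2.
Qed.

Lemma smooth2_dot U (d : E3) :
  smooth2 U (fun x => dot x d) (fun i _ => d 0 i) (fun _ _ => 0).
Proof.
have D (j : 'I_3) (t : R) := is_derive_lin (d 0 j) t.
have D1 (j : 'I_3) (t : R) : is_derive t 1 (fun=> d 0 j) 0 by exact: is_derive_cst.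
have c0 (j : 'I_3) : continuous (fun _ : R => 0 : R) by exact: cst_continuous.
apply: smooth2_ext (@smooth2_sum_coord R U (fun j s => d 0 j * s) (fun j _ => d 0 j)
  (fun _ _ => 0) D D1 c0) _ _ _ => // x.
by apply: eq_bigr => i _; rewrite mulrC.
Qed.

(** The scattered field is twice continuously differentiable. *)
Lemma smooth2_scattered_field U k d (us : E3 -> C) : cCk 4 U (u_tot k d us) ->
  exists a1 a2 b1 b2, smooth2 U (fun x => complex.Re (us x)) a1 a2 /\
    smooth2 U (fun x => complex.Im (us x)) b1 b2.
Proof.
move=> [/Ck_smooth2 sa /Ck_smooth2 sb].
have sc := smooth2N (smooth2_cosk k (@smooth2_dot U d)).
have ss := smooth2N (smooth2_sink k (@smooth2_dot U d)).
do 4 eexists; split.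
  apply: smooth2_ext (smooth2D sa sc) _ _ _ => // x.
  by rewrite /u_tot /u_inc /expi; case: (us x) => u v /=; rewrite addrAC subrr add0r.
apply: smooth2_ext (smooth2D sb ss) _ _ _ => // x.
by rewrite /u_tot /u_inc /expi; case: (us x) => u v /=; rewrite addrAC subrr add0r.
Qed.

(** The Laplacian of [c a + s b], for [c = cos (k |x|)] and [s = sin (k |x|)]: the
    vectors [h1] and [h2] are the first and second derivatives of [|x|]. *)
Lemma phase_removed_laplacian (h1 h2 a1 a2 b1 b2 : 'I_3 -> R) (k c s a b r : R) :
  \sum_i h1 i ^+ 2 = 1 -> \sum_i h2 i = 2 / r ->
  \sum_i ((- k ^+ 2 * c * h1 i ^+ 2 + - k * s * h2 i) * a + 2 * (- k * s * h1 i * a1 i) + c * a2 i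
    + ((- k ^+ 2 * s * h1 i ^+ 2 + k * c * h2 i) * b + 2 * (k * c * h1 i * b1 i) + s * b2 i)) =
  2 * (k / r) * (c * b - s * a) +
   (c * ((\sum_i a2 i + k ^+ 2 * a) + 2 * k * (\sum_i h1 i * b1 i - k * a)) +
    s * ((\sum_i b2 i + k ^+ 2 * b) - 2 * k * (\sum_i h1 i * a1 i + k * b))).
Proof.
move=> S1 S2; apply/eqP; rewrite -subr_eq0; apply/eqP.
transitivity ((\sum_i h1 i ^+ 2 - 1) * (- k ^+ 2 * (c * a + s * b)) +
  (\sum_i h2 i - 2 / r) * (k * (c * b - s * a))).
  by rewrite !sum_ord3; ring.
by rewrite S1 S2 !subrr !mul0r addr0.
Qed.

Lemma sum_direction_sqr x : 0 < enorm x -> \sum_i (x 0 i / enorm x) ^+ 2 = 1.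
Proof.
move=> x0; under eq_bigr do rewrite exprMn.
by rewrite -mulr_suml -enorm_sqr -exprMn mulfV ?gt_eqF// expr1n.
Qed.

Lemma sum_enorm2 x : 0 < enorm x ->
  \sum_(i < 3) ((enorm x)^-1 - x 0 i ^+ 2 / enorm x ^+ 3) = 2 / enorm x.
Proof.
move=> x0; rewrite sumrB -mulr_suml -enorm_sqr sumr_const card_ord -mulr_natr.
by field; rewrite gt_eqF.
Qed.

End ScatteredField.

(** * Real and imaginary parts of the scattering problem *)

Section Components.
Variable R : realType.
Local Notation E3 := 'rV[R]_3.
Local Notation C := R[i].
Implicit Types (x v : E3) (t : R) (U : set E3).

Lemma Re_scal (r : R) (z : C) : complex.Re (r%:C * z) = r * complex.Re z.
Proof. by case: z => a b /=; rewrite mul0r subr0. Qed.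

Lemma Im_scal (r : R) (z : C) : complex.Im (r%:C * z) = r * complex.Im z.
Proof. by case: z => a b /=; rewrite mul0r addr0. Qed.

Lemma Re_add (z z' : C) : complex.Re (z + z') = complex.Re z + complex.Re z'.
Proof. by case: z z' => a b [c d]. Qed.

Lemma Im_add (z z' : C) : complex.Im (z + z') = complex.Im z + complex.Im z'.
Proof. by case: z z' => a b [c d]. Qed.

Lemma Re_opp (z : C) : complex.Re (- z) = - complex.Re z.
Proof. by case: z. Qed.

Lemma Im_opp (z : C) : complex.Im (- z) = - complex.Im z.
Proof. by case: z. Qed.

Lemma Re_sum (I : finType) (f : I -> C) : complex.Re (\sum_i f i) = \sum_i complex.Re (f i).
Proof. exact: (big_morph _ Re_add). Qed.

Lemma Im_sum (I : finType) (f : I -> C) : complex.Im (\sum_i f i) = \sum_i complex.Im (f i).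
Proof. exact: (big_morph _ Im_add). Qed.

Lemma cmodE (z : C) : cmod z = Num.sqrt (complex.Re z ^+ 2 + complex.Im z ^+ 2).
Proof. by case: z. Qed.

Lemma cmod_ge0 (z : C) : 0 <= cmod z.
Proof. by rewrite cmodE sqrtr_ge0. Qed.

Lemma cmod_sqr (z : C) : cmod z ^+ 2 = complex.Re z ^+ 2 + complex.Im z ^+ 2.
Proof. by rewrite cmodE sqr_sqrtr// addr_ge0// sqr_ge0. Qed.

Lemma Re_le_cmod (z : C) : `|complex.Re z| <= cmod z.
Proof.
rewrite -ler_sqr ?nnegrE ?cmod_ge0// real_normK ?num_real// cmod_sqr.
by rewrite lerDl sqr_ge0.
Qed.

Lemma Im_le_cmod (z : C) : `|complex.Im z| <= cmod z.
Proof.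
rewrite -ler_sqr ?nnegrE ?cmod_ge0// real_normK ?num_real// cmod_sqr.
by rewrite lerDr sqr_ge0.
Qed.

Lemma cmodD (z z' : C) : cmod (z + z') <= cmod z + cmod z'.
Proof. exact: le_normcD. Qed.

Lemma cmodN (z : C) : cmod (- z) = cmod z.
Proof. exact: normcN. Qed.

Lemma cmodM (z z' : C) : cmod (z * z') = cmod z * cmod z'.
Proof. exact: ComplexField.Normc.normcM. Qed.

Lemma cmod_real (r : R) : cmod r%:C = `|r|.
Proof. by rewrite cmodE/= expr0n addr0 sqrtr_sqr. Qed.

(** The exterior of a bounded set contains the complement of a ball. *)
Lemma bounded_exterior (D : set E3) : bounded_set D ->
  exists2 R0 : R, 0 < R0 & forall x, R0 < enorm x -> exterior D x.
Proof.
move=> [M [_ HM]]; pose M1 := `|M| + 1.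
have M10 : 0 < M1 by rewrite ltr_wpDl.
have MM : M < M1 by rewrite ltr_pwDr// ler_norm.
exists (2 * M1); first by rewrite mulr_gt0.
move=> x xM; rewrite /exterior => Dx.
have cl : closed [set y : E3 | enorm y <= 2 * M1].
  have -> : [set y : E3 | enorm y <= 2 * M1] = @enorm R @^-1` [set s | s <= 2 * M1] by [].
  by apply: preimage_closed => [y _|]; [exact: enorm_continuous | exact: closed_le].
suff : closure [set y : E3 | enorm y <= 2 * M1] x.
  by rewrite -((closure_id _).1 cl) /= leNgt xM.
move: x Dx {xM}; apply: closureS => y Dy /=.
have ym : `|y| <= M1 by exact: HM.
rewrite -ler_sqr ?nnegrE ?enorm_ge0 ?mulr_ge0 ?(ltW M10)// enorm_sqr.
apply: le_trans (_ : \sum_(i < 3) M1 ^+ 2 <= _).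
  apply: ler_sum => i _; rewrite -(real_normK (num_real (y 0 i))).
  by rewrite lerXn2r ?nnegrE ?(ltW M10)// (le_trans (norm_coord_le y i)).
have := sqr_ge0 M1; rewrite sumr_const card_ord -mulr_natl exprMn.
by move: (M1 ^+ 2) => u; lra.
Qed.

Lemma open_exterior (D : set E3) : open (exterior D).
Proof. by apply: closed_openC; exact: closed_closure. Qed.

Lemma laplacian_smooth2 U (f : E3 -> C) a1 a2 b1 b2 x : open U ->
  smooth2 U (fun x => complex.Re (f x)) a1 a2 ->
  smooth2 U (fun x => complex.Im (f x)) b1 b2 -> U x ->
  complex.Re (laplacian f x) = \sum_i a2 i x /\ complex.Im (laplacian f x) = \sum_i b2 i x.
Proof.
move=> oU sa sb Ux; rewrite /laplacian Re_sum Im_sum.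
split; apply: eq_bigr => i _ /=.
  by have [_ <-] := smooth2_partial i oU sa Ux.
by have [_ <-] := smooth2_partial i oU sb Ux.
Qed.

(** The Helmholtz defect of the scattered field is [2 k^2 u_M], by definition
    of [u_M]. *)
Lemma u_M_parts k (us : E3 -> C) x : 0 < k ->
  complex.Re (laplacian us x) + k ^+ 2 * complex.Re (us x) = 2 * k ^+ 2 * complex.Re (u_M k us x) /\
  complex.Im (laplacian us x) + k ^+ 2 * complex.Im (us x) = 2 * k ^+ 2 * complex.Im (u_M k us x).
Proof.
move=> k0; have k2 : k ^+ 2 != 0 by rewrite expf_neq0 ?gt_eqF.
have -> : u_M k us x = (2^-1)%:C * (us x + ((k ^+ 2)^-1)%:C * laplacian us x).
  by rewrite /u_M !fmorphV rmorph_nat [laplacian _ _ / _]mulrC.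
rewrite Re_scal Im_scal Re_add Im_add Re_scal Im_scal.
by split; field; rewrite gt_eqF.
Qed.

(** The radiation condition in real and imaginary parts. *)
Lemma radiating_parts U k (us : E3 -> C) a1 a2 b1 b2 : open U ->
  smooth2 U (fun x => complex.Re (us x)) a1 a2 ->
  smooth2 U (fun x => complex.Im (us x)) b1 b2 ->
  radiating k us -> forall e : R, 0 < e -> exists rho : R, forall x, U x -> rho < enorm x ->
   enorm x * `|\sum_i x 0 i / enorm x * a1 i x + k * complex.Im (us x)| <= e /\
   enorm x * `|\sum_i x 0 i / enorm x * b1 i x - k * complex.Re (us x)| <= e.
Proof.
move=> oU sa sb rad e e0; have [M [_ HM]] := rad e e0.
exists (Num.max M 0) => x Ux; rewrite gt_max => /andP[xM x0].
have := HM _ xM x erefl; set z := (_ - _ : C) => zl.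
have E : complex.Re z = \sum_i x 0 i / enorm x * a1 i x + k * complex.Im (us x) /\
  complex.Im z = \sum_i x 0 i / enorm x * b1 i x - k * complex.Re (us x).
  rewrite /z Re_add Im_add Re_opp Im_opp /cdirderiv Re_sum Im_sum.
  split.
    congr (_ + _).
      apply: eq_bigr => i _; rewrite Re_scal mxE mulrC [_^-1 * _]mulrC mulrC /=.
      by congr (_ * _); have [->] := smooth2_partial i oU sa Ux.
    by case: (us x) => u v /=; ring.
  congr (_ + _).
    apply: eq_bigr => i _; rewrite Im_scal mxE mulrC [_^-1 * _]mulrC mulrC /=.
    by congr (_ * _); have [->] := smooth2_partial i oU sb Ux.
  by case: (us x) => u v /=; ring.
move: E => [<- <-]; split; apply: le_trans (ltW zl); rewrite ler_wpM2l ?enorm_ge0//.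
  exact: Re_le_cmod.
exact: Im_le_cmod.
Qed.

End Components.

(** * Decay of the scattered field *)

Section Decay.
Variable R : realType.
Local Notation E3 := 'rV[R]_3.
Local Notation C := R[i].
Implicit Types (x v : E3) (t : R) (U : set E3).

(** Multiplication by [exp (- i k |x|)]. The function
    [cos (k |x|) a + sin (k |x|) b] is the real part of the product with
    [a + i b]; its radial derivative only involves the radiation defects, and its
    Laplacian is [2 k / |x|] times the imaginary part, up to the radiation and
    Helmholtz defects. The imaginary part of the product is the same expression
    for the pair [b], [- a]. *)
Lemma phase_removed U k a a1 a2 b b1 b2 : (forall x, U x -> 0 < enorm x) ->
  smooth2 U a a1 a2 -> smooth2 U b b1 b2 ->
  exists A1 A2, smooth2 U (fun x => cos (k * enorm x) * a x + sin (k * enorm x) * b x) A1 A2 /\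
  forall x, U x ->
    \sum_i x 0 i / enorm x * A1 i x =
      cos (k * enorm x) * (\sum_i x 0 i / enorm x * a1 i x + k * b x) +
      sin (k * enorm x) * (\sum_i x 0 i / enorm x * b1 i x - k * a x) /\
    \sum_i A2 i x = 2 * (k / enorm x) * (cos (k * enorm x) * b x - sin (k * enorm x) * a x) +
     (cos (k * enorm x) * ((\sum_i a2 i x + k ^+ 2 * a x) + 2 * k * (\sum_i x 0 i / enorm x * b1 i x - k * a x)) +
      sin (k * enorm x) * ((\sum_i b2 i x + k ^+ 2 * b x) - 2 * k * (\sum_i x 0 i / enorm x * a1 i x + k * b x))).
Proof.
move=> U0 sa sb; have sr : smooth2 U _ _ _ := smooth2S U0 (@smooth2_enorm R).
have sc := smooth2_cosk k sr; have ss := smooth2_sink k sr.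
have S := smooth2D (smooth2M sc sa) (smooth2M ss sb).
do 2 eexists; split; first exact: S.
move=> x Ux; have x0 := U0 _ Ux.
have S1 := sum_direction_sqr x0; have S2 := sum_enorm2 x0.
split; last exact: phase_removed_laplacian S1 S2.
apply/eqP; rewrite -subr_eq0; apply/eqP.
transitivity ((\sum_i (x 0 i / enorm x) ^+ 2 - 1) *
  (k * (cos (k * enorm x) * b x - sin (k * enorm x) * a x))).
  by rewrite !sum_ord3; ring.
by rewrite S1 subrr mul0r.
Qed.

Lemma phase_removed_remainder (k e ea y : R) (p q u v : R) : 0 < y -> 0 < k ->
  2 * k * ea <= e / 4 -> y * `|p| <= e / 4 -> y * `|q| <= e / 4 ->
  y * `|u| <= ea -> y * `|v| <= ea ->
  y * `|cos (k * y) * (p + 2 * k * v) + sin (k * y) * (q - 2 * k * u)| <= e.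
Proof.
move=> y0 k0 kea hp hq hu hv.
have tri (c s t w : R) : `|c| <= 1 -> `|c * (s + 2 * k * t)| <= `|s| + 2 * k * `|t|.
  move=> c1; rewrite normrM; apply: le_trans (_ : 1 * `|s + 2 * k * t| <= _).
    by rewrite ler_wpM2r.
  rewrite mul1r; apply: le_trans (ler_normD _ _) _.
  by rewrite lerD2l normrM gtr0_norm ?mulr_gt0.
have t1 := tri _ p v 0 (cos_max (k * y)).
have t2 := tri _ q (- u) 0 (sin_max (k * y)).
rewrite mulrN normrN in t2.
have t3 := ler_normD (cos (k * y) * (p + 2 * k * v)) (sin (k * y) * (q - 2 * k * u)).
have t4 : `|cos (k * y) * (p + 2 * k * v) + sin (k * y) * (q - 2 * k * u)| <=
   `|p| + 2 * k * `|v| + (`|q| + 2 * k * `|u|) by lra.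
apply: le_trans (ler_wpM2l (ltW y0) t4) _.
have hu' : 2 * k * (y * `|u|) <= 2 * k * ea by rewrite ler_pM2l ?mulr_gt0.
have hv' : 2 * k * (y * `|v|) <= 2 * k * ea by rewrite ler_pM2l ?mulr_gt0.
lra.
Qed.

Lemma expRN_le (s : R) : 0 < s -> expR (- s) <= s^-1.
Proof.
move=> s0; rewrite expRN lef_pV2 ?posrE ?expR_gt0//.
by have := expR_ge1Dx s; lra.
Qed.

(** The first term of the expansion of [u_M] gives its exponential decay,
    uniformly in the direction; the coefficient [g 1] is bounded on the unit
    sphere because [u_M] is bounded on one large sphere. *)
Lemma u_M_bound U k (us : E3 -> C) a1 a2 b1 b2 g R0 : 0 < k -> open U ->
  (forall x, R0 < enorm x -> U x) ->
  smooth2 U (fun x => complex.Re (us x)) a1 a2 ->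
  smooth2 U (fun x => complex.Im (us x)) b1 b2 ->
  atkinson_coefficients k (u_M k us) g ->
  exists G rho : R, 0 < G /\ forall x, rho < enorm x ->
    cmod (u_M k us x) <= expR (- (k * enorm x)) / enorm x * G.
Proof.
move=> k0 oU inU sa sb /(_ 1 isT)[M [M1 [_ HM]]].
pose r1 := Num.max (Num.max R0 M1) 0 + 1.
have [r1R r1M r10] : [/\ R0 < r1, M1 < r1 & 0 < r1].
  have : Num.max (Num.max R0 M1) 0 < r1 by rewrite ltrDl.
  by rewrite !gt_max => /andP[/andP[-> ->] ->].
have k2 : 0 < 2 * k ^+ 2 by rewrite mulr_gt0// exprn_gt0.
pose h x := (\sum_i a2 i x + k ^+ 2 * complex.Re (us x)) ^+ 2 +
   (\sum_i b2 i x + k ^+ 2 * complex.Im (us x)) ^+ 2.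
have hE x : U x -> h x = (2 * k ^+ 2 * cmod (u_M k us x)) ^+ 2.
  move=> Ux; have [E1 E2] := u_M_parts us x k0.
  have [L1 L2] := laplacian_smooth2 oU sa sb Ux.
  by rewrite /h -L1 -L2 E1 E2 !exprMn -mulrDr -cmod_sqr.
have [||x1 x1r hmax] := @sphere_max R r1 h.
- exact: ltW.
- move=> x xr; have Ux : U x by apply: inU; rewrite xr.
  have [ca Ha] := sa _ Ux; have [cb Hb] := sb _ Ux.
  have ec t : {for t, continuous (fun u : R => u ^+ 2)} by exact: exprn_continuous.
  apply: contD; apply: (cont_comp _ (ec _)); apply: contD.
  + by apply: cont_sum => i; have [] := Ha i.
  + by apply: contM => //; exact: cont_cst.
  + by apply: cont_sum => i; have [] := Hb i.
  + by apply: contM => //; exact: cont_cst.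
have uMb x : enorm x = r1 -> cmod (u_M k us x) <= cmod (u_M k us x1).
  move=> xr; have Ux : U x by apply: inU; rewrite xr.
  have Ux1 : U x1 by apply: inU; rewrite x1r.
  have := hmax _ xr; rewrite (hE x Ux) (hE x1 Ux1) => H.
  rewrite -(ler_pM2l k2) -ler_sqr ?nnegrE; [exact: H| |];
    exact: mulr_ge0 (ltW k2) (cmod_ge0 _).
pose q (r : R) := expR (- (k * r)) / r.
have q0 r : 0 < r -> 0 < q r by move=> r0; rewrite divr_gt0 ?expR_gt0.
have HM' r w : M1 < r -> 0 < r -> enorm w = 1 ->
    cmod (u_M k us (r *: w) - (q r)%:C * g 1 w) <= q r * (`|M| / r).
  move=> rM r0 w1; have := HM r rM w w1.
  rewrite big_nat1 expr0 divr1 expr1 => /le_trans; apply.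
  by rewrite ler_wpM2l ?(ltW (q0 _ r0))// ler_wpM2r ?invr_ge0 ?(ltW r0)// ler_norm.
pose G1 := (q r1)^-1 * cmod (u_M k us x1) + `|M| / r1.
have gb w : enorm w = 1 -> cmod (g 1 w) <= G1.
  move=> w1; have H := HM' r1 w r1M r10 w1.
  have Hu : cmod (u_M k us (r1 *: w)) <= cmod (u_M k us x1).
    by apply: uMb; rewrite enormZ w1 mulr1 gtr0_norm.
  have : q r1 * cmod (g 1 w) <= cmod (u_M k us x1) + q r1 * (`|M| / r1).
    have -> : q r1 * cmod (g 1 w) = cmod ((q r1)%:C * g 1 w).
      by rewrite cmodM cmod_real gtr0_norm// q0.
    have -> : (q r1)%:C * g 1 w = u_M k us (r1 *: w) + - (u_M k us (r1 *: w) - (q r1)%:C * g 1 w).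
      by ring.
    by apply: le_trans (cmodD _ _) _; rewrite cmodN lerD.
  move=> H1; rewrite -(@ler_pM2l _ (q r1)) ?q0//; apply: le_trans H1 _.
  by rewrite /G1 mulrDr mulVKf ?gt_eqF// q0.
exists (`|G1| + `|M| + 1), (Num.max M1 1); split.
  by rewrite ltr_wpDl// addr_ge0.
move=> x; rewrite gt_max => /andP[xM x1'].
have x0 : 0 < enorm x by apply: lt_trans x1'.
pose w := (enorm x)^-1 *: x.
have w1 : enorm w = 1 by rewrite enormZ normfV gtr0_norm// mulVf ?gt_eqF.
have xE : x = enorm x *: w by rewrite scalerA mulfV ?gt_eqF// scale1r.
have H := HM' _ w xM x0 w1; rewrite -xE in H.
have -> : u_M k us x = (u_M k us x - (q (enorm x))%:C * g 1 w) + (q (enorm x))%:C * g 1 w by ring.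
apply: le_trans (cmodD _ _) _; rewrite cmodM cmod_real gtr0_norm ?q0//.
apply: le_trans (lerD H (lexx _)) _; rewrite -mulrDr ler_pM2l ?q0//.
have h1 : `|M| / enorm x <= `|M|.
  by rewrite ler_pdivrMr// ler_peMr// ltW.
have := gb w w1; have := ler_norm G1; lra.
Qed.

(** A radiating field with exponentially small Helmholtz defect tends to zero at
    infinity. *)
Lemma scattered_field_decay U k (us : E3 -> C) a1 a2 b1 b2 (g : nat -> E3 -> C) R0 : 0 < k -> open U ->
  0 < R0 -> (forall x, R0 < enorm x -> U x) ->
  smooth2 U (fun x => complex.Re (us x)) a1 a2 ->
  smooth2 U (fun x => complex.Im (us x)) b1 b2 ->
  atkinson_coefficients k (u_M k us) g -> radiating k us ->
  forall e : R, 0 < e -> exists rho : R, forall x, rho < enorm x -> cmod (us x) <= e.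
Proof.
move=> k0 oU R00 inU sa sb atk rad e0 e00.
have [G [rG [G0 HG]]] := u_M_bound k0 oU inU sa sb atk.
have [Cc [rho [C0 [rho0 OS]]]] := one_scale_decay k0.
(* [ea] is the accuracy required of the radiation condition, [rE] the radius from
   which the Helmholtz defect is negligible. *)
pose e := e0 / Cc; have ep : 0 < e by rewrite divr_gt0.
pose ea := Num.min (e / (8 * k)) (e / 2).
have ea0 : 0 < ea by rewrite lt_min !divr_gt0// mulr_gt0.
have [rR HR] := radiating_parts oU sa sb rad ea0.
pose rE := 8 * k * G / e.
pose V := [set x : E3 | R0 < enorm x].
have VU : V `<=` U by move=> x; exact: inU.
have oV : open V by exact: open_outer.
have V0 x : V x -> 0 < enorm x by move=> xV; apply: lt_trans xV.
have saV := smooth2S VU sa; have sbV := smooth2S VU sb.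
have [A1 [A2 [sA HA]]] := phase_removed k V0 saV sbV.
have [B1 [B2 [sB HB]]] := phase_removed k V0 sbV (smooth2N saV).
pose rr := 2 * Num.max (Num.max R0 (Num.max rG rR)) (Num.max rE rho).
exists rr => x xr.
have [r1 r2 r3 r4 r5] : [/\ R0 < enorm x / 2, rG < enorm x / 2, rR < enorm x / 2, rE < enorm x / 2 & rho < enorm x].
  have : Num.max (Num.max R0 (Num.max rG rR)) (Num.max rE rho) < enorm x / 2.
    by rewrite ltr_pdivlMr// mulrC.
  rewrite !gt_max => /andP[/andP[h1 /andP[h2 h3]] /andP[h4 h5]]; split => //.
  by apply: lt_trans h5 _; rewrite ltr_pdivrMr//; have := enorm_ge0 x; have := lt_trans R00 h1; lra.
set r := enorm x in r1 r2 r3 r4 r5.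
have r0 : 0 < r by apply: lt_trans r5.
have ann y : r / 2 <= enorm y <= 2 * r ->
   [/\ V y, rG < enorm y, U y, rR < enorm y & rE < enorm y].
  move=> /andP[y1 _]; have Vy : V y by exact: lt_le_trans y1.
  by split; [| exact: lt_le_trans y1 | exact: VU | exact: lt_le_trans y1| exact: lt_le_trans y1].
have half y (s : R) : r / 2 <= enorm y <= 2 * r -> enorm y * `|s| <= e -> `|s| <= 2 * e / r.
  move=> /[dup] yr /andP[y1 _] H; have y0 : 0 < enorm y.
    by apply: lt_le_trans y1; rewrite divr_gt0.
  rewrite ler_pdivlMr//; have : r / 2 * `|s| <= enorm y * `|s| by rewrite ler_wpM2r.
  by have := H; rewrite mulrAC; lra.
have eae : ea <= e / 2 by rewrite ge_min lexx orbT.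
have kea : 2 * k * ea <= e / 4.
  have : ea <= e / (8 * k) by rewrite ge_min lexx.
  move=> H1; have -> : e / 4 = 2 * k * (e / (8 * k)) by field; rewrite gt_eqF.
  by rewrite ler_pM2l// mulr_gt0.
have osc y (p q : R) : `|cos (k * enorm y) * p + sin (k * enorm y) * q| <= `|p| + `|q|.
  apply: le_trans (ler_normD _ _) _; rewrite !normrM; apply: lerD; rewrite ler_piMl//.
    exact: cos_max.
  exact: sin_max.
have small y : r / 2 <= enorm y <= 2 * r ->
  [/\ enorm y * `|\sum_i a2 i y + k ^+ 2 * complex.Re (us y)| <= e / 4,
      enorm y * `|\sum_i b2 i y + k ^+ 2 * complex.Im (us y)| <= e / 4,
      enorm y * `|\sum_i y 0 i / enorm y * a1 i y + k * complex.Im (us y)| <= ea &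
      enorm y * `|\sum_i y 0 i / enorm y * b1 i y - k * complex.Re (us y)| <= ea].
  move=> yr; have [Vy yG Uy yR yE] := ann _ yr.
  have y0 := V0 _ Vy.
  have [p1 p2] := HR y Uy yR.
  have [L1 L2] := laplacian_smooth2 oU sa sb Uy.
  have [E1 E2] := u_M_parts us y k0.
  have ub : enorm y * (2 * k ^+ 2 * cmod (u_M k us y)) <= e / 4.
    have h1 : cmod (u_M k us y) <= (k * enorm y)^-1 / enorm y * G.
      apply: le_trans (HG _ yG) _; rewrite ler_wpM2r ?(ltW G0)// ler_wpM2r ?invr_ge0 ?(ltW y0)//.
      by apply: expRN_le; rewrite mulr_gt0.
    apply: le_trans (_ : enorm y * (2 * k ^+ 2 * ((k * enorm y)^-1 / enorm y * G)) <= _).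
      by rewrite ler_wpM2l ?(ltW y0)// ler_wpM2l// mulr_ge0// sqr_ge0.
    have -> : enorm y * (2 * k ^+ 2 * ((k * enorm y)^-1 / enorm y * G)) = 2 * k * G / enorm y.
      by field; rewrite !gt_eqF.
    rewrite ler_pdivrMr//; move: yE; rewrite /rE ltr_pdivrMr//; lra.
  have k2 : 0 <= 2 * k ^+ 2 by rewrite mulr_ge0// sqr_ge0.
  split => //; apply: le_trans ub; rewrite ler_wpM2l ?(ltW y0)//.
    by rewrite -L1 E1 normrM ger0_norm// ler_wpM2l// Re_le_cmod.
  by rewrite -L2 E2 normrM ger0_norm// ler_wpM2l// Im_le_cmod.
have F1b y : r / 2 <= enorm y <= 2 * r ->
  `|cos (k * enorm y) * ((\sum_i a2 i y + k ^+ 2 * complex.Re (us y)) + 2 * k * (\sum_i y 0 i / enorm y * b1 i y - k * complex.Re (us y))) +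
      sin (k * enorm y) * ((\sum_i b2 i y + k ^+ 2 * complex.Im (us y)) - 2 * k * (\sum_i y 0 i / enorm y * a1 i y + k * complex.Im (us y)))| <= 2 * e / r.
  move=> yr; apply: (half y) => //; have [h1 h2 h3 h4] := small _ yr.
  have [Vy _ _ _ _] := ann _ yr; have y0 := V0 _ Vy.
  exact: phase_removed_remainder y0 k0 kea h1 h2 h3 h4.
have F2b y : r / 2 <= enorm y <= 2 * r ->
  `|cos (k * enorm y) * ((\sum_i b2 i y + k ^+ 2 * complex.Im (us y)) + 2 * k * (\sum_i y 0 i / enorm y * - a1 i y - k * complex.Im (us y))) +
      sin (k * enorm y) * ((\sum_i - a2 i y + k ^+ 2 * - complex.Re (us y)) - 2 * k * (\sum_i y 0 i / enorm y * b1 i y + k * - complex.Re (us y)))| <= 2 * e / r.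
  move=> yr; apply: (half y) => //; have [h1 h2 h3 h4] := small _ yr.
  have [Vy _ _ _ _] := ann _ yr; have y0 := V0 _ Vy.
  apply: phase_removed_remainder y0 k0 kea h2 _ _ _.
  - by rewrite sumrN mulrN -opprD normrN.
  - by rewrite mulrN.
  - by under eq_bigr do rewrite mulrN; rewrite sumrN -opprD normrN.
have osc_ea y p q : r / 2 <= enorm y <= 2 * r -> enorm y * `|p| <= ea -> enorm y * `|q| <= ea ->
   `|cos (k * enorm y) * p + sin (k * enorm y) * q| <= 2 * e / r.
  move=> yr hp hq; apply: (half y) => //.
  have [Vy _ _ _ _] := ann _ yr; have y0 := V0 _ Vy.
  apply: le_trans (ler_wpM2l (ltW y0) (osc y p q)) _; rewrite mulrDr; lra.
have annV y (yr : r / 2 <= enorm y <= 2 * r) : V y by have [] := ann y yr.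
have H := OS V _ _ A1 A2 B1 B2 _ _ r e oV r5 ep sA sB annV _ _
  (fun y yr => conj (F1b y yr) (F2b y yr)) _ _ x erefl.
rewrite -ler_sqr ?nnegrE ?cmod_ge0 ?(ltW e00)// cmod_sqr.
have -> : e0 = Cc * e by rewrite mulrC divfK// gt_eqF.
have E : complex.Re (us x) ^+ 2 + complex.Im (us x) ^+ 2 =
  (cos (k * enorm x) * complex.Re (us x) + sin (k * enorm x) * complex.Im (us x)) ^+ 2 +
  (cos (k * enorm x) * complex.Im (us x) + sin (k * enorm x) * - complex.Re (us x)) ^+ 2.
  rewrite -[LHS]mul1r -(cos2Dsin2 (k * enorm x)); ring.
rewrite E; apply: H => y yr.
- by have [_ ->] := HA _ (annV y yr); congr (_ + _); ring.
- by have [_ ->] := HB _ (annV y yr); congr (_ + _); ring.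
- have [-> _] := HA _ (annV y yr); have [_ _ h3 h4] := small _ yr.
  exact: osc_ea.
- have [-> _] := HB _ (annV y yr); have [_ _ h3 h4] := small _ yr.
  apply: osc_ea => //; first by rewrite mulrN.
  by under eq_bigr do rewrite mulrN; rewrite sumrN -opprD normrN.
Qed.

End Decay.

(** * Stability of the Vandermonde system *)

Section Vandermonde.
Variable R : realType.

Lemma det_bound n (A : 'M[R]_n) (b : R) : 0 <= b -> (forall i j, `|A i j| <= b) ->
  `|\det A| <= #|'S_n|%:R * b ^+ n.
Proof.
move=> b0 Ab; rewrite /determinant; apply: le_trans (ler_norm_sum _ _ _) _.
rewrite mulr_natl -sumr_const; apply: ler_sum => s _.
rewrite normrM normrX normrN1 expr1n mul1r normr_prod.
rewrite -[n in b ^+ n]card_ord -prodr_const; apply: ler_prod => i _.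
by rewrite normr_ge0 Ab.
Qed.

(** The factor [b ^+ n] instead of [b ^+ n.-1] is harmless as [1 <= b]. *)
Lemma adj_bound n (A : 'M[R]_n) (b : R) : 1 <= b -> (forall i j, `|A i j| <= b) ->
  forall i j, `|(\adj A) i j| <= #|'S_n.-1|%:R * b ^+ n.
Proof.
move=> b1 Ab i j; have b0 : 0 <= b by apply: le_trans b1.
rewrite mxE /cofactor normrM normrX normrN1 expr1n mul1r.
apply: le_trans (@det_bound _ _ b b0 _) _.
  by move=> k l; rewrite !mxE.
by rewrite ler_wpM2l// ler_weXn2l// leq_pred.
Qed.

(** For nodes [s j] at bounded distance from [sigma j * t], the matrix [V_mx s] is
    invertible for large [t], and solving the system multiplies errors by a
    factor of order [t ^+ j] in the [j]-th coefficient. Indeed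
    [V_mx s = V * diag (t ^- j)], where [V] is the Vandermonde matrix of the
    numbers [t / s j], which stay bounded and apart; its determinant is bounded
    below and its adjugate above. *)
Lemma V_mx_solve_bound n (sigma : 'I_n -> R) (B : R) :
  (forall j, 0 < sigma j) -> injective sigma -> 0 <= B ->
  exists C : R, 0 <= C /\ \forall t \near +oo, forall s : 'I_n -> R,
    (forall j, `|s j - sigma j * t| <= B) ->
    V_mx s \in unitmx /\
    forall (v : 'cV[R]_n) (eta : R), (forall i, `|v i 0| <= eta) ->
      forall j, `|(invmx (V_mx s) *m v) j 0| <= C * t ^+ j * eta.
Proof.
move=> sp si B0.
pose m (i j : 'I_n) : R := `|sigma i - sigma j| / 2 / (2 * sigma i * (2 * sigma j)).
have m0 i j : i != j -> 0 < m i j.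
  move=> ij; rewrite !divr_gt0// ?mulr_gt0// normr_gt0 subr_eq0.
  by apply: contra ij => /eqP/si ->.
pose c0 : R := \prod_(i < n) \prod_(j < n | (i < j)%N) m i j.
have c00 : 0 < c0.
  apply: prodr_gt0 => i _; apply: prodr_gt0 => j ij; apply: m0.
  by rewrite neq_ltn ij.
pose b : R := (1 + \sum_i 2 / sigma i) ^+ n.
have b1' : 1 <= 1 + \sum_i 2 / sigma i.
  by rewrite lerDl sumr_ge0// => i _; rewrite divr_ge0// ltW.
have b1 : 1 <= b by rewrite exprn_ege1.
pose Ka : R := #|'S_n.-1|%:R * b ^+ n.
have Ka0 : 0 <= Ka by rewrite mulr_ge0// exprn_ge0// (le_trans _ b1).
exists (n%:R * Ka / c0); split; first by rewrite divr_ge0 ?(ltW c00)// mulr_ge0.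
have near_sigma : \forall t \near +oo, forall i : 'I_n, 2 * B / sigma i < t.
  by apply: filter_forall => i; apply: nbhs_pinfty_gt; exact: num_real.
have near_diff : \forall t \near +oo, forall ij : 'I_n * 'I_n,
    4 * B / `|sigma ij.1 - sigma ij.2| < t.
  by apply: filter_forall => i; apply: nbhs_pinfty_gt; exact: num_real.
near=> t => s sB.
have t0 : 0 < t by near: t; apply: nbhs_pinfty_gt; exact: num_real.
have ns : forall i : 'I_n, 2 * B / sigma i < t by near: t.
have nd : forall ij : 'I_n * 'I_n, 4 * B / `|sigma ij.1 - sigma ij.2| < t by near: t.
pose u i : R := s i / t.
have uB i : `|u i - sigma i| <= B / t.
  rewrite ler_pdivlMr// -[X in _ * X](gtr0_norm t0) -normrM mulrBl divfK ?gt_eqF//.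
have us i : sigma i / 2 <= u i <= 2 * sigma i.
  have : B / t <= sigma i / 2.
    have := ns i; rewrite ltr_pdivrMr// ler_pdivrMr//; move: (sp i) => h; lra.
  have := uB i; rewrite ler_norml => /andP[h1 h2] h3.
  by have := sp i => h; apply/andP; split; lra.
have u0 i : 0 < u i.
  by have /andP[h _] := us i; apply: lt_le_trans h; rewrite divr_gt0.
have s0 i : 0 < s i by have := u0 i; rewrite /u pmulr_lgt0 ?invr_gt0.
have ud i j : i != j -> `|sigma i - sigma j| / 2 <= `|u i - u j|.
  move=> ij; have d0 : 0 < `|sigma i - sigma j|.
    by rewrite normr_gt0 subr_eq0; apply: contra ij => /eqP/si ->.
  have h : 2 * (B / t) <= `|sigma i - sigma j| / 2.
    have := nd (i, j); rewrite /= ltr_pdivrMr// mulrA ler_pdivrMr//; lra.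
  have := uB i; have := uB j => h1 h2.
  have -> : u i - u j = (sigma i - sigma j) - ((sigma i - u i) - (sigma j - u j)) by ring.
  apply: le_trans (_ : `|sigma i - sigma j| - `|(sigma i - u i) - (sigma j - u j)| <= _); last exact: lerB_dist.
  have := ler_normB (sigma i - u i) (sigma j - u j).
  rewrite (distrC _ (u i)) (distrC _ (u j)); lra.
pose x : 'rV[R]_n := \row_i (u i)^-1.
pose V := (Vandermonde n x)^T.
have VE i j : V i j = (u i)^-1 ^+ j by rewrite !mxE.
have Vb i j : `|V i j| <= b.
  rewrite VE normrX normfV gtr0_norm//.
  apply: le_trans (_ : (1 + \sum_i 2 / sigma i) ^+ j <= _); last first.
    by rewrite ler_weXn2l// ltnW.
  rewrite lerXn2r ?nnegrE ?invr_ge0 ?(ltW (u0 _))//; first by rewrite (le_trans _ b1').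
  apply: le_trans (_ : 2 / sigma i <= _).
    rewrite -[2 / _]invrK lef_pV2 ?posrE ?invr_gt0 ?divr_gt0// invf_div.
    by case/andP: (us i).
  rewrite (bigD1 i)//= addrCA lerDl addr_ge0// sumr_ge0// => l _.
  by rewrite divr_ge0// ltW.
have dV : c0 <= `|(\det V : R)|.
  rewrite det_tr det_Vandermonde normr_prod; apply: ler_prod => i _.
  apply/andP; split.
    by apply: prodr_ge0 => j ij; apply/ltW/m0; rewrite neq_ltn ij.
  rewrite normr_prod; apply: ler_prod => j ij.
  have nij : i != j by rewrite neq_ltn ij.
  rewrite (ltW (m0 _ _ nij)) /= !mxE.
  have -> : (u j)^-1 - (u i)^-1 = (u i - u j) / (u i * u j).
    by field; rewrite !gt_eqF.
  rewrite normrM normfV (gtr0_norm (mulr_gt0 (u0 i) (u0 j))) /m.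
  have up i' : 0 <= 2 * sigma i' by rewrite mulr_ge0 ?(ltW (sp _)).
  apply: ler_pM; [by rewrite divr_ge0|by rewrite invr_ge0 mulr_ge0|exact: ud|].
  have uu := mulr_gt0 (u0 i) (u0 j).
  have ss : 0 < 2 * sigma i * (2 * sigma j) by rewrite !mulr_gt0.
  rewrite lef_pV2 ?posrE//.
  have [/andP[_ h1] /andP[_ h2]] := (us i, us j).
  exact: ler_pM (ltW (u0 i)) (ltW (u0 j)) h1 h2.
have detV0 : (\det V : R) != 0 by have := lt_le_trans c00 dV; rewrite normr_gt0.
have SVE : V_mx s = V *m diag_mx (\row_j t ^- j).
  apply/matrixP => i j; rewrite mul_mx_diag [LHS]mxE [RHS]mxE VE [_ 0 j]mxE.
  by rewrite /u invf_div exprMn exprVn mulrAC mulfV ?mul1r// expf_neq0// gt_eqF.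
have Vu : V \in unitmx by rewrite unitmxE unitfE.
have Du : diag_mx (\row_j t ^- j) \in @unitmx R n.
  rewrite unitmxE unitfE det_diag prodf_seq_neq0; apply/allP => j _.
  by rewrite mxE invr_eq0 expf_neq0// gt_eqF.
have SVu : V_mx s \in unitmx by rewrite SVE unitmx_mul Vu.
split => // v eta ve j.
have : V_mx s *m (invmx (V_mx s) *m v) = v by rewrite mulmxA mulmxV// mul1mx.
move: (invmx (V_mx s) *m v) => y Vyv.
have Vy : \det V *: (diag_mx (\row_j t ^- j) *m y) = \adj V *m v.
  by rewrite -Vyv SVE -(mulmxA V) [RHS]mulmxA mul_adj_mx mul_scalar_mx.
have /(congr1 (fun z : 'cV_n => z j 0)) := Vy.
rewrite mxE mul_diag_mx !mxE => E.
have e0 : 0 <= eta by apply: le_trans (ve j).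
have up : `|\det V * (t ^- j * y j 0)| <= n%:R * Ka * eta.
  rewrite E; apply: le_trans (ler_norm_sum _ _ _) _.
  apply: le_trans (_ : \sum_(i < n) Ka * eta <= _).
    apply: ler_sum => i _; rewrite normrM ler_pM//; exact: adj_bound.
  by rewrite sumr_const card_ord -mulrA mulr_natl.
have lo : c0 * (t ^- j * `|y j 0|) <= `|\det V * (t ^- j * y j 0)|.
  have tj : 0 <= t ^- j by rewrite invr_ge0 exprn_ge0 ?ltW.
  by rewrite normrM [`|_ * y j 0|]normrM (ger0_norm tj) ler_wpM2r// mulr_ge0.
have := le_trans lo up.
move=> H; have tj : 0 < t ^+ j by rewrite exprn_gt0.
have -> : `|y j 0| = c0 * (t ^- j * `|y j 0|) * (t ^+ j / c0).
  by field; rewrite !gt_eqF.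
have -> : n%:R * Ka / c0 * t ^+ j * eta = n%:R * Ka * eta * (t ^+ j / c0) by ring.
by rewrite ler_wpM2r// divr_ge0 ?(ltW c00) ?(ltW tj).
Unshelve. all: by end_near. Qed.

End Vandermonde.

(** * Asymptotic expansion of the phaseless data *)

Section Phaseless.
Variable R : realType.
Local Notation E3 := 'rV[R]_3.
Local Notation C := R[i].
Implicit Types (x d : E3) (us : E3 -> C).

Lemma expi_cmod (t : R) : cmod (expi t) = 1.
Proof. by rewrite cmodE/= cos2Dsin2 sqrtr1. Qed.

Lemma real_complexVK (r : R) (z : C) : r != 0 -> (r^-1)%:C * (r%:C * z) = z.
Proof.
move=> r0; case: z => a b; apply/eqP; rewrite eq_complex /=.
by apply/andP; split; apply/eqP; field.
Qed.

Lemma u_H_add_u_M k us x : u_H k us x + u_M k us x = us x.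
Proof.
rewrite /u_H /u_M -mulrDr [X in _ * X](_ : _ = us x + us x); last by ring.
by field.
Qed.

Lemma dotZl (s : R) x d : dot (s *: x) d = s * dot x d.
Proof. by rewrite /dot mulr_sumr; apply: eq_bigr => i _; rewrite mxE mulrA. Qed.

(** The exponential [expR (- (k * s))] decays faster than every power of [s]. *)
Lemma expRN_pow (k s : R) n : 0 < k -> 0 < s ->
  expR (- (k * s)) <= n`!%:R / k ^+ n / s ^+ n.
Proof.
move=> k0 s0; have ks : 0 < k * s by rewrite mulr_gt0.
case: n => [|n].
  rewrite fact0 !expr0 !divr1 -expR0 ler_expR oppr_le0 ltW//.
have h : (k * s) ^+ n.+1 / n.+1`!%:R <= expR (k * s).
  by apply: le_trans (expR_ge1Dxn n (ltW ks)); rewrite lerDr.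
have f0 : 0 < n.+1`!%:R :> R by rewrite ltr0n fact_gt0.
have ks0 : 0 < (k * s) ^+ n.+1 by rewrite exprn_gt0.
rewrite expRN -mulrA -invfM -exprMn -[leRHS]invrK lef_pV2 ?posrE ?expR_gt0//.
  by rewrite invf_div.
by rewrite invr_gt0 divr_gt0.
Qed.

Lemma cmod2D (z z' : C) : cmod (z + z') ^+ 2 =
  cmod z ^+ 2 + 2 * complex.Re (z^*%C * z') + cmod z' ^+ 2.
Proof. by rewrite !cmod_sqr; case: z z' => a b [a' b'] /=; ring. Qed.

(** With the phase of the total Helmholtz part known, the phaseless quantity is
    linear in [u_M] up to a quadratic term. *)
Lemma phaseless_difference (A u : C) (theta : R) : has_arg A theta ->
  (cmod (A + u) ^+ 2 - cmod A ^+ 2) / cmod A =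
  2 * complex.Re (expi (- theta) * u) + cmod u ^+ 2 / cmod A.
Proof.
move=> [A0 AE]; have cA : cmod A != 0.
  by apply/eqP => h; apply: A0; rewrite AE h mul0r.
rewrite cmod2D.
have -> : complex.Re (A^*%C * u) = cmod A * complex.Re (expi (- theta) * u).
  rewrite -Re_scal mulrA; congr (complex.Re (_ * u)).
  rewrite {1}AE; apply/eqP; rewrite eq_complex /= cosN sinN.
  by apply/andP; split; apply/eqP; ring.
by field.
Qed.

(** With [theta] the phase of the total Helmholtz part [A], the data [w] is
    [2 Re (exp (- i theta) sum_l g_(l+1) / s^l)] up to an error of order [s^-n].
    The decay of the scattered field enters through [1 / 2 <= cmod A], which makes
    the term quadratic in [u_M] exponentially small. *)
Lemma w_expansion k d us g xhat n : 0 < k -> unit_sphere xhat -> (0 < n)%N ->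
  (exists rho : R, forall x, rho < enorm x -> cmod (us x) <= 1 / 4) ->
  (exists G rho : R, 0 < G /\ forall x, rho < enorm x ->
    cmod (u_M k us x) <= expR (- (k * enorm x)) / enorm x * G) ->
  atkinson_coefficients k (u_M k us) g ->
  exists Mw S0 : R, 0 <= Mw /\ forall s theta, S0 < s ->
    has_arg (expi (k * s * dot xhat d) + u_H k us (s *: xhat)) theta ->
    `|w_data k d us (s *: xhat) -
       \sum_(l < n) 2 * complex.Re (expi (- theta) * g l.+1 xhat) * s ^- l| <= Mw / s ^+ n.
Proof.
move=> k0 x1 n0 [r1 Hus] [G [r2 [G0 HuM]]] /(_ n n0)[M [r3 [_ HM]]].
pose F : R := n`!%:R / k ^+ n.
have F0 : 0 <= F by rewrite divr_ge0// exprn_ge0 ?ltW.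
exists (2 * `|M| + 2 * G ^+ 2 * F).
exists (Num.max (Num.max r1 r2) (Num.max r3 (1 + 4 * G))).
have G2 := sqr_ge0 G.
split; first by apply: addr_ge0; apply: mulr_ge0 => //; exact: mulr_ge0.
move=> s th; rewrite !gt_max => /andP[/andP[s1 s2] /andP[s3 s4]] hA.
have s11 : 1 < s by apply: le_lt_trans s4; rewrite lerDl mulr_ge0// ltW.
have s0 : 0 < s by apply: lt_trans s11.
have es : enorm (s *: xhat) = s by rewrite enormZ x1 mulr1 gtr0_norm.
pose q : R := expR (- (k * s)) / s.
have q0 : 0 < q by rewrite divr_gt0 ?expR_gt0.
have q1 : q <= s^-1.
  rewrite ler_piMl ?invr_ge0 ?(ltW s0)// -expR0 ler_expR oppr_le0.
  by rewrite mulr_ge0 ?ltW.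
have uMq : cmod (u_M k us (s *: xhat)) <= q * G by have := HuM (s *: xhat); rewrite es; apply.
have usl : cmod (us (s *: xhat)) <= 1 / 4 by apply: Hus; rewrite es.
have uM4 : cmod (u_M k us (s *: xhat)) <= 1 / 4.
  apply: le_trans uMq _; apply: le_trans (ler_wpM2r (ltW G0) q1) _.
  by rewrite mulrC ler_pdivrMr//; lra.
set u := u_M k us (s *: xhat) in uMq uM4.
set A := expi (k * s * dot xhat d) + u_H k us (s *: xhat) in hA.
have incE : u_inc k d (s *: xhat) = expi (k * s * dot xhat d).
  by rewrite /u_inc dotZl mulrA.
have Ahalf : 1 / 2 <= cmod A.
  have E : expi (k * s * dot xhat d) = A - us (s *: xhat) + u.
    by rewrite /A /u -(u_H_add_u_M k us); ring.
  have := expi_cmod (k * s * dot xhat d); rewrite E.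
  have := cmodD (A - us (s *: xhat)) u; have := cmodD A (- us (s *: xhat)).
  rewrite cmodN; lra.
have A0 : 0 < cmod A by lra.
have -> : w_data k d us (s *: xhat) =
   2 * complex.Re (expi (- th) * ((q^-1)%:C * u)) + q^-1 * (cmod u ^+ 2 / cmod A).
  rewrite /w_data es incE -/A.
  have -> : u_tot k d us (s *: xhat) = A + u.
    by rewrite /u_tot incE /A /u -(u_H_add_u_M k us) addrA.
  rewrite -mulrA (phaseless_difference u hA) mulrDr [expi _ * (_ * _)]mulrCA Re_scal.
  have -> : s * expR (k * s) = q^-1 by rewrite /q invf_div expRN invrK.
  by congr (_ + _); ring.
have Mexp := HM s s3 xhat x1.
set P := (\sum_(_ <= j < _) _ : C) in Mexp.
have -> : \sum_(l < n) 2 * complex.Re (expi (- th) * g l.+1 xhat) * s ^- l =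
   2 * complex.Re (expi (- th) * P).
  rewrite /P big_add1 big_mkord mulr_sumr Re_sum mulr_sumr; apply: eq_bigr => l _.
  rewrite -mulrA; congr (2 * _); rewrite -fmorphV mulrA [_ * _%:C]mulrC Re_scal.
  by rewrite mulrC.
have t1 : `|2 * complex.Re (expi (- th) * ((q^-1)%:C * u)) - 2 * complex.Re (expi (- th) * P)|
    <= 2 * `|M| / s ^+ n.
  rewrite -mulrBr normrM gtr0_norm// -mulrA ler_pM2l// -Re_opp -Re_add -mulrN -mulrDr.
  apply: le_trans (Re_le_cmod _) _; rewrite cmodM expi_cmod mul1r.
  have -> : (q^-1)%:C * u - P = (q^-1)%:C * (u - q%:C * P).
    by rewrite mulrBr real_complexVK// gt_eqF.
  rewrite cmodM cmod_real ger0_norm ?invr_ge0 ?(ltW q0)//.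
  have : q^-1 * cmod (u - q%:C * P) <= q^-1 * (q * (M / s ^+ n)).
    by rewrite ler_pM2l ?invr_gt0.
  move=> /le_trans; apply; rewrite mulKf ?gt_eqF//.
  by rewrite ler_wpM2r ?invr_ge0 ?exprn_ge0 ?(ltW s0)// ler_norm.
have t2 : q^-1 * (cmod u ^+ 2 / cmod A) <= 2 * G ^+ 2 * F / s ^+ n.
  have h1 : cmod u ^+ 2 <= (q * G) ^+ 2.
    by rewrite lerXn2r ?nnegrE ?cmod_ge0// mulr_ge0 ?ltW.
  have h2 : (cmod A)^-1 <= 2 by rewrite -[leRHS]invrK lef_pV2 ?posrE ?invr_gt0//; lra.
  apply: le_trans (_ : q^-1 * ((q * G) ^+ 2 * 2) <= _).
    rewrite ler_pM2l ?invr_gt0//; apply: ler_pM => //; first exact: sqr_ge0.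
    by rewrite invr_ge0 ltW.
  have -> : q^-1 * ((q * G) ^+ 2 * 2) = 2 * G ^+ 2 * q by field; rewrite gt_eqF.
  have G22 : 0 <= 2 * G ^+ 2 by apply: mulr_ge0.
  rewrite -[leRHS]mulrA ler_wpM2l//.
  apply: le_trans (expRN_pow n k0 s0).
  by rewrite ler_pdivrMr// ler_peMr ?expR_ge0 ?ltW.
have t20 : 0 <= q^-1 * (cmod u ^+ 2 / cmod A).
  by rewrite mulr_ge0 ?invr_ge0 ?(ltW q0)// divr_ge0 ?sqr_ge0// ltW.
rewrite [leRHS]mulrDl [X in `|X|]addrAC; apply: le_trans (ler_normD _ _) _.
by rewrite (ger0_norm t20); exact: lerD.
Qed.

End Phaseless.

(** * Inversion of the data for two phases *)

Section TwoPhases.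
Variable R : realType.
Local Notation E3 := 'rV[R]_3.
Local Notation C := R[i].

Lemma sin_nat_pi (n : nat) : sin (n%:R * pi) = 0 :> R.
Proof.
elim: n => [|n IH]; first by rewrite mul0r sin0.
by rewrite -natr1 mulrDl mul1r sinD IH sinpi mul0r mulr0 addr0.
Qed.

Lemma sin_int_pi (l : int) : sin (l%:~R * pi) = 0 :> R.
Proof.
case: l => n; first exact: sin_nat_pi.
by rewrite NegzE rmorphN/= mulNr sinN sin_nat_pi oppr0.
Qed.

(** The zeros of the sine. *)
Lemma sin_eq0_pi (x : R) : sin x = 0 -> exists l : int, x = l%:~R * pi.
Proof.
move=> sx; pose l := Num.floor (x / pi); exists l.
have pi0 := @pi_gt0 R.
have /andP[h1 h2] := floor_itv (x / pi).
pose y := x - l%:~R * pi.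
have sy : sin y = 0 by rewrite sinB sx sin_int_pi mul0r mulr0 subr0.
have y0 : 0 <= y by rewrite subr_ge0 -ler_pdivlMr.
have yp : y < pi.
  move: h2; rewrite intrD ltr_pdivrMr// mulrDl mul1r => h2.
  by rewrite /y ltrBlDl.
apply/eqP; rewrite -subr_eq0 -/y eq_le y0 andbT leNgt; apply/negP => yp0.
by have := @sin_gt0_pi R y; rewrite yp0 yp sy ltxx => /(_ isT).
Qed.

(** The computed coefficient [G_data] recovers [2 Re (exp (- i th t) g_(j+1))] up
    to [t ^- (n - j)], for a column index [j] counted from 0. *)
Lemma G_data_expansion k d us g xhat n (sigma : 'I_n -> R) (Bb : R)
    (b : R -> 'I_n -> R) (th : R -> R) :
  (forall j, 0 < sigma j) -> injective sigma ->
  (exists Mw S0 : R, 0 <= Mw /\ forall s theta, S0 < s ->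
    has_arg (expi (k * s * dot xhat d) + u_H k us (s *: xhat)) theta ->
    `|w_data k d us (s *: xhat) -
       \sum_(l < n) 2 * complex.Re (expi (- theta) * g l.+1 xhat) * s ^- l| <= Mw / s ^+ n) ->
  (\forall t \near +oo, forall j : 'I_n, `|b t j| <= Bb /\
     has_arg (expi (k * (sigma j * t + b t j) * dot xhat d) +
       u_H k us ((sigma j * t + b t j) *: xhat)) (th t)) ->
  exists K : R, \forall t \near +oo, forall j : 'I_n,
    `|2 * complex.Re (expi (- th t) * g j.+1 xhat) -
      G_data k d us xhat (fun i => sigma i * t + b t i) j 0| <= K * t ^- (n - j).
Proof.
move=> sp si [Mw [S0 [Mw0 HW]]] Hb.
pose B := `|Bb|.
have [Cv [Cv0 HV]] := V_mx_solve_bound sp si (normr_ge0 Bb : 0 <= B).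
pose Sg : R := \sum_i (2 / sigma i) ^+ n.
exists (Cv * Mw * Sg).
have n1 : \forall t \near +oo, forall i : 'I_n, (`|S0| + 2 * B) * 2 / sigma i < t.
  by apply: filter_forall => i; apply: nbhs_pinfty_gt; exact: num_real.
near=> t => j.
have t0 : 0 < t by near: t; apply: nbhs_pinfty_gt; exact: num_real.
have bt : forall j : 'I_n, `|b t j| <= Bb /\
     has_arg (expi (k * (sigma j * t + b t j) * dot xhat d) +
       u_H k us ((sigma j * t + b t j) *: xhat)) (th t) by near: t.
have tn : forall i : 'I_n, (`|S0| + 2 * B) * 2 / sigma i < t by near: t.
have HV' : forall s : 'I_n -> R,
    (forall j, `|s j - sigma j * t| <= B) ->
    V_mx s \in unitmx /\
    forall (v : 'cV[R]_n) (eta : R), (forall i, `|v i 0| <= eta) ->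
      forall j, `|(invmx (V_mx s) *m v) j 0| <= Cv * t ^+ j * eta by near: t.
pose s i := sigma i * t + b t i.
have sB i : `|s i - sigma i * t| <= B.
  by rewrite /s addrAC subrr add0r; have [h _] := bt i; apply: le_trans h (ler_norm _).
have [Vu HS] := HV' s sB.
have sig i : S0 < s i /\ sigma i / 2 * t <= s i.
  have := tn i; rewrite ltr_pdivrMr// => h1; have := sB i.
  rewrite ler_norml => /andP[h2 _]; have := ler_norm S0; have : 0 <= B by exact: normr_ge0.
  have := normr_ge0 S0; have -> : sigma i / 2 * t = sigma i * t / 2 by ring.
  move: h1 h2; rewrite (mulrC t); move: (sigma i * t) (s i) `|S0| => z z' S0'.
  by move=> *; split; lra.
have s0 i : 0 < s i.
  by have [_ h] := sig i; apply: lt_le_trans h; rewrite mulr_gt0// divr_gt0.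
pose gam : 'cV[R]_n := \col_l (2 * complex.Re (expi (- th t) * g l.+1 xhat)).
pose w : 'cV[R]_n := \col_i w_data k d us (s i *: xhat).
pose v := w - V_mx s *m gam.
have vb i : `|v i 0| <= Mw * Sg * t ^- n.
  have [h1 h2] := sig i; have [_ ha] := bt i.
  have -> : v i 0 = w_data k d us (s i *: xhat) -
       \sum_(l < n) 2 * complex.Re (expi (- th t) * g l.+1 xhat) * s i ^- l.
    rewrite !mxE; congr (_ - _); apply: eq_bigr => l _.
    by rewrite !mxE mulrC.
  apply: le_trans (HW (s i) (th t) h1 ha) _.
  rewrite -mulrA ler_wpM2l//.
  apply: le_trans (_ : (2 / sigma i) ^+ n * t ^- n <= _).
    have z0 : 0 < sigma i / 2 * t by rewrite mulr_gt0// divr_gt0.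
    have -> : (2 / sigma i) ^+ n * t ^- n = (sigma i / 2 * t)^-1 ^+ n.
      by rewrite -exprVn -exprMn; congr (_ ^+ n); field; rewrite !gt_eqF.
    rewrite -exprVn lerXn2r ?nnegrE ?invr_ge0 ?(ltW z0) ?(ltW (s0 i))//.
    by rewrite lef_pV2 ?posrE.
  rewrite ler_wpM2r ?invr_ge0 ?exprn_ge0 ?(ltW t0)//.
  rewrite /Sg (bigD1 i)//= lerDl sumr_ge0// => l _.
  by rewrite exprn_ge0// divr_ge0// ltW.
have E : G_data k d us xhat s j 0 = gam j 0 + (invmx (V_mx s) *m v) j 0.
  have <- : (gam + invmx (V_mx s) *m v) j 0 = gam j 0 + (invmx (V_mx s) *m v) j 0.
    by rewrite mxE.
  by rewrite /v mulmxBr mulmxA mulVmx// mul1mx addrC subrK.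
rewrite E [gam j 0]mxE opprD addrA subrr add0r normrN.
apply: le_trans (HS v _ vb j) _; apply: le_of_eq.
have -> : t ^- n = t ^- (n - j) * t ^- j.
  by rewrite -invfM -exprD subnK// ltnW.
by field; rewrite !expf_neq0// gt_eqF.
Unshelve. all: by end_near. Qed.

(** Inversion of the two-phase system, with an explicit bound. *)
Lemma phase_mx_solve (th th' : R) (z : 'cV[C]_2) (x : C) (y y' : R) :
  sin (th' - th) != 0 ->
  z = col2 x x^*%C - invmx (phase_mx th th') *m col2 y%:C y'%:C ->
  forall i, cmod (z i 0) <=
    (`|2 * complex.Re (expi (- th) * x) - y| + `|2 * complex.Re (expi (- th') * x) - y'|)
     / (2 * `|sin (th' - th)|).
Proof.
pose w := th' - th; move=> sw zE.
pose P := phase_mx th th'.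
have [P00 P01 P10 P11] : [/\ P 0 0 = expi (- th), P 0 1 = expi th,
    P 1 0 = expi (- th') & P 1 1 = expi th'] by split; rewrite !mxE.
pose D : C := expi th' * expi (- th) - expi th * expi (- th').
have DE : D = 0 +i* (2 * sin w).
  apply/eqP; rewrite eq_complex /= /w sinB !cosN !sinN.
  by apply/andP; split; apply/eqP; ring.
have cD : cmod D = 2 * `|sin w|.
  rewrite cmodE DE /= expr0n add0r sqrtr_sqr normrM.
  by rewrite (gtr0_norm (_ : 0 < 2 :> R)).
have D0 : D != 0.
  apply/eqP => DZ; have := cD; rewrite DZ cmodE /= expr0n addr0 sqrtr0 => /esym/eqP.
  by rewrite mulf_eq0 pnatr_eq0/= normr_eq0 (negbTE sw).
have Pu : P \in unitmx.
  pose Q : 'M[C]_2 := \matrix_(i, j)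
    (D^-1 * (nth [::] [:: [:: expi th'; - expi th]; [:: - expi (- th'); expi (- th)]] i)`_j).
  have QP : Q *m P = 1%:M.
    apply/matrixP => i j; rewrite mxE !big_ord_recl big_ord0 addr0.
    have DV : D^-1 * (expi th' * expi (- th) - expi th * expi (- th')) = 1 by exact: mulVf.
    case: i => -[|[|//]] hi; case: j => -[|[|//]] hj; rewrite !mxE /=; move: DV.
    - by move=> <-; ring.
    - by move=> _; ring.
    - by move=> _; ring.
    - by move=> <-; ring.
  by case: (mulmx1_unit QP).
pose r0 : R := 2 * complex.Re (expi (- th) * x) - y.
pose r1 : R := 2 * complex.Re (expi (- th') * x) - y'.
have ReE t : expi (- t) * x + expi t * x^*%C = (2 * complex.Re (expi (- t) * x))%:C.
  case: x {zE r0 r1} => a b; apply/eqP; rewrite eq_complex /= cosN sinN.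
  by apply/andP; split; apply/eqP; ring.
have Pz : P *m z = col2 r0%:C r1%:C.
  rewrite zE mulmxBr mulmxA mulmxV// mul1mx.
  apply/matrixP => i j; rewrite mxE [(P *m _) _ _]mxE !big_ord_recl big_ord0 addr0.
  case: i => -[|[|//]] hi; rewrite !mxE /=.
  - by rewrite ReE -rmorphB.
  - by rewrite ReE -rmorphB.
have Pzi i : P i 0 * z 0 0 + P i 1 * z 1 0 = (col2 r0%:C r1%:C) i 0.
  rewrite -Pz [RHS]mxE !big_ord_recl big_ord0 addr0.
  by congr (_ + _ * z _ _); [congr (P _ _)|]; exact: val_inj.
have Pz0 : expi (- th) * z 0 0 + expi th * z 1 0 = r0%:C.
  by rewrite -P00 -P01 Pzi mxE.
have Pz1 : expi (- th') * z 0 0 + expi th' * z 1 0 = r1%:C.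
  by rewrite -P10 -P11 Pzi mxE.
have S0 : D * z 0 0 = expi th' * r0%:C - expi th * r1%:C.
  by rewrite -Pz0 -Pz1 /D; ring.
have S1 : D * z 1 0 = expi (- th) * r1%:C - expi (- th') * r0%:C.
  by rewrite -Pz0 -Pz1 /D; ring.
have fin (t t' : R) (u : C) (p q : R) : D * u = expi t * p%:C - expi t' * q%:C ->
    cmod u <= (`|p| + `|q|) / (2 * `|sin w|).
  move=> E; have s0 : 0 < 2 * `|sin w| by rewrite mulr_gt0// normr_gt0.
  rewrite ler_pdivlMr// mulrC -cD -cmodM E; apply: le_trans (cmodD _ _) _.
  by rewrite cmodN !cmodM !expi_cmod !mul1r !cmod_real.
move=> i; have [->|->] : i = 0 \/ i = 1.
  by case: i => -[|[|//]] hi; [left|right]; exact: val_inj.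
- exact: fin S0.
- by rewrite addrC; exact: fin S1.
Qed.

End TwoPhases.

Theorem theorem4p6 (R : realType) (k alpha : R)
    (D : set 'rV[R]_3) (nu : 'rV[R]_3 -> 'rV[R]_3) (B : boundary_operator)
    (d : 'rV[R]_3) (us : 'rV[R]_3 -> R[i]) (g : nat -> 'rV[R]_3 -> R[i])
    (n : nat) (hn : (0 < n)%N) (delta : R) (sigma : 'I_n -> R)
    (xhat : 'rV[R]_3) (tau : R) (b bt : R -> 'I_n -> R) :
  0 < k ->
  0 < alpha < 1 ->
  obstacle alpha D ->
  unit_exterior_normal alpha D nu ->
  unit_sphere d ->
  scattering_solution k D nu B d us ->
  atkinson_coefficients k (u_M k us) g ->
  0 < delta ->
  (forall j, 0 < sigma j) ->
  injective sigma ->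
  (forall j, sigma j <> delta) ->
  unit_sphere xhat ->
  dot xhat d <> 0 ->
  (forall l : int, tau <> l%:~R * pi / (k * dot xhat d)) ->
  let sigma1 := sigma (Ordinal hn) in
  let th (t : R) := k * (sigma1 * t) * dot xhat d in
  let th' (t : R) := k * (sigma1 * t + tau) * dot xhat d in
  let tj (t : R) (j : 'I_n) := sigma j * t + b t j in
  let tj' (t : R) (j : 'I_n) := sigma j * t + bt t j in
  (\forall t \near +oo, forall j : 'I_n,
     (if j == 0%N :> nat then - delta < b t j < delta
      else - delta < b t j < 2 * pi / (k * `|dot xhat d|) + delta) /\
     has_arg (expi (k * tj t j * dot xhat d) + u_H k us (tj t j *: xhat))
             (th t)) ->
  (\forall t \near +oo, forall j : 'I_n,
     (if j == 0%N :> nat then tau - delta < bt t j < tau + delta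
      else - delta < bt t j < 2 * pi / (k * `|dot xhat d|) + delta) /\
     has_arg (expi (k * tj' t j * dot xhat d) + u_H k us (tj' t j *: xhat))
             (th' t)) ->
  forall j : 'I_n,
    bigO_col
      (fun t =>
         col2 (g j.+1 xhat) (g j.+1 xhat)^*%C
         - invmx (phase_mx (th t) (th' t))
           *m col2 (G_data k d us xhat (tj t) j 0)%:C
                   (G_data k d us xhat (tj' t) j 0)%:C)
      (fun t => t ^- (n - j)).
Proof.
move=> k0 _ [_ Dbd _ _] _ _ [reg _ _ rad] atk delta0 sp si _ x1 c0 tau_ne.
move=> sigma1 th th' tj tj' Hb Hbt j.
set c := dot xhat d in c0 tau_ne th th' Hb Hbt *.
have [R0 R00 inU] := bounded_exterior Dbd.
have oU := @open_exterior R D.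
have [a1 [a2 [b1 [b2 [sa sb]]]]] := smooth2_scattered_field reg.
have HuM := u_M_bound k0 oU inU sa sb atk.
have Hus : exists rho : R, forall x, rho < enorm x -> cmod (us x) <= 1 / 4.
  by apply: (scattered_field_decay k0 oU R00 inU sa sb atk rad); rewrite divr_gt0.
have HW := w_expansion d k0 x1 hn Hus HuM atk.
pose Bb := delta + `|tau| + 2 * pi / (k * `|c|).
have kc0 : 0 < k * `|c| by rewrite mulr_gt0// normr_gt0; exact/eqP.
have P0 : 0 <= 2 * pi / (k * `|c|).
  by rewrite divr_ge0 ?(ltW kc0)// mulr_ge0// pi_ge0.
have T0 := normr_ge0 tau.
have [K1 HK1] : exists K : R, \forall t \near +oo, forall j : 'I_n,
    `|2 * complex.Re (expi (- th t) * g j.+1 xhat) - G_data k d us xhat (tj t) j 0| <= K * t ^- (n - j).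
  apply: (@G_data_expansion R k d us g xhat n sigma Bb b th sp si HW).
  apply: filterS Hb => t Ht l; have [bl ha] := Ht l; split; last exact: ha.
  rewrite /Bb ler_norml; move: bl; case: ifP => _ /andP[h1 h2]; apply/andP; split; lra.
have [K2 HK2] : exists K : R, \forall t \near +oo, forall j : 'I_n,
    `|2 * complex.Re (expi (- th' t) * g j.+1 xhat) - G_data k d us xhat (tj' t) j 0| <= K * t ^- (n - j).
  apply: (@G_data_expansion R k d us g xhat n sigma Bb bt th' sp si HW).
  apply: filterS Hbt => t Ht l; have [bl ha] := Ht l; split; last exact: ha.
  have := ler_norm tau; have := ler_norm (- tau); rewrite normrN.
  rewrite /Bb ler_norml; move: bl; case: ifP => _ /andP[h1 h2] h3 h4; apply/andP; split; lra.
pose S := sin (k * tau * c).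
(* The difference of the two phases does not depend on [t]. *)
have thS t : sin (th' t - th t) = S by rewrite /S /th /th'; congr (sin _); ring.
have S0 : S != 0.
  apply/eqP => /sin_eq0_pi[l E]; apply: (tau_ne l).
  have c0' : c != 0 by exact/eqP.
  by rewrite -E; field; rewrite c0' gt_eqF.
exists ((K1 + K2) / (2 * `|S|)).
near=> t => i.
have h1 : forall j : 'I_n, `|2 * complex.Re (expi (- th t) * g j.+1 xhat) -
    G_data k d us xhat (tj t) j 0| <= K1 * t ^- (n - j) by near: t.
have h2 : forall j : 'I_n, `|2 * complex.Re (expi (- th' t) * g j.+1 xhat) -
    G_data k d us xhat (tj' t) j 0| <= K2 * t ^- (n - j) by near: t.
have sth : sin (th' t - th t) != 0 by rewrite thS.
have H := phase_mx_solve (x := g j.+1 xhat) (y := G_data k d us xhat (tj t) j 0)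
  (y' := G_data k d us xhat (tj' t) j 0) sth erefl i.
apply: le_trans H _.
rewrite thS [leRHS]mulrAC; apply: ler_wpM2r; first by rewrite invr_ge0 mulr_ge0.
rewrite [leRHS]mulrDl.
by apply: lerD; [exact: h1 | exact: h2].
Unshelve. all: by end_near. Qed.
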